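(* Let $(M,\mathcal{T})$ be a closed triangulated surface with inversive distance $I\ge 0$, with Euclidean or hyperbolic background geometry. Given a function $\overline{R}\in C(V)$, the modified combinatorial Ricci flow is defined to be $$\frac{dg_i}{dt}=(\overline{R}_i-R_i)g_i,\qquad (\ast)$$ where $g_i=r_i^2$ for the Euclidean background geometry and $g_i=\tanh^2\frac{r_i}{2}$ for the hyperbolic background geometry. (1) If the solution of $(\ast)$ stays in $\Omega$ and converges to $\overline{r}\in\Omega$, then $\overline{R}$ is admissible and $R(\overline{r})=\overline{R}$. (2) Suppose $\overline{R}\le 0$ and $\overline{R}$ is admissible with $R(\overline{r})=\overline{R}$, $\overline r\in\Omega$. Then the flow $(\ast)$ develops no essential singularity in finite time and at time infinity. Furthermore, if the solution of $(\ast)$ develops no removable singularities in finite time, then the solution of $(\ast)$ exists for all time, converges exponentially fast to $\overline{r}$, and does not develop removable singularities at time infinity. (3) If $\overline{R}\in C(V)$ is admissible, $R(\overline{r})=\overline{R}$ with $\overline{r}\in\Omega$, and $\overline{R}\le 0$, then any solution of the extended combinatorial Ricci flow $$\frac{dg_i}{dt}=(\overline{R}_i-\widetilde{R}_i)g_i$$ exists for all time and converges exponentially fast to $\overline{r}$.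
   Context: $M$ is a closed surface with a triangulation $\mathcal{T}=\{V,E,F\}$ (vertices, edges, faces), $V=\{1,\dots,N\}$; $C(V)$ is the set of functions $V\to\mathbb{R}$, with pointwise inequalities. The inversive distance is a function $I:E\to[0,+\infty)$ (written $I\ge0$). For $r\in\mathbb{R}^N_{>0}$, the length of an edge $\{ij\}\in E$ is $l_{ij}=\sqrt{r_i^2+r_j^2+2r_ir_jI_{ij}}$ in Euclidean background geometry, and $l_{ij}=\cosh^{-1}(\cosh r_i\cosh r_j+I_{ij}\sinh r_i\sinh r_j)$ in hyperbolic background geometry. The admissible space is $\Omega=\{r\in\mathbb{R}^N_{>0}: l_{ij}<l_{ik}+l_{kj},\ l_{ik}<l_{ij}+l_{jk},\ l_{jk}<l_{ji}+l_{ik}\ \text{for all faces }\triangle ijk\in F\}$; its elements are the inversive distance circle packing metrics. For $r\in\Omega$, $\theta_i^{jk}$ is the inner angle at $i$ of the Euclidean (resp. hyperbolic) triangle with edge lengths $l_{ij},l_{jk},l_{ik}$, and $K_i=2\pi-\sum_{\triangle ijk\in F}\theta_i^{jk}$ (sum over faces having $i$ as a vertex). The $R$-curvature is $R_i=K_i/s_i^2$, where $s_i=r_i$ (Euclidean) or $s_i=\tanh\frac{r_i}{2}$ (hyperbolic). A function $\overline R\in C(V)$ is admissible if there is $\overline r\in\Omega$ with $R(\overline r)=\overline R$. The flow $(\ast)$ is considered in $\Omega$, with initial value in $\Omega$; the extended flow is considered on $\mathbb{R}^N_{>0}$. Extended curvature: for any $r\in\mathbb{R}^N_{>0}$ and face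 $\triangle ijk$, $\widetilde\theta_i^{jk}=\theta_i^{jk}$ if the three strict triangle inequalities hold for $l_{ij},l_{jk},l_{ik}$; $\widetilde\theta_i^{jk}=\pi$ if $l_{jk}\ge l_{ik}+l_{ij}$; $\widetilde\theta_i^{jk}=0$ if $l_{ik}\ge l_{jk}+l_{ij}$ or $l_{ij}\ge l_{jk}+l_{ik}$. Set $\widetilde K_i=2\pi-\sum_{\triangle ijk\in F}\widetilde\theta_i^{jk}$ and $\widetilde R_i=\widetilde K_i/s_i^2$. Singularities: suppose the solution of the flow $(\ast)$ exists on $[0,\tau)$, $\tau\le+\infty$. It develops an essential singularity at time $\tau$ if there is $i\in V$ such that $r_i(t_n)\to 0$ for some sequence $t_n\to\tau$. It develops a removable singularity at $\tau$ if there is a sequence $t_n\to\tau$ such that $r(t_n)$ stays in a compact subset of $\mathbb{R}^N_{>0}$ and there is a face $\triangle ijk\in F$ whose triangle inequalities degenerate as $t_n\to\tau$. ''In finite time'' means $\tau<+\infty$, ''at time infinity'' means $\tau=+\infty$.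
   Formalization: In Euclidean geometry with R̄ identically 0, r̄ is determined only up to scaling, so convergence to r̄ in (2), (3) fails as stated; there the limit is the multiple of r̄ whose sum of squared radii equals that of the initial value. In all other cases the limit is r̄. *)

(* Defs.v *)
From HB Require Import structures.
From mathcomp Require Import all_boot all_order all_algebra.
From mathcomp Require Import all_classical all_reals all_analysis.
From mathcomp Require Import ring lra.

Set Implicit Arguments.
Unset Strict Implicit.
Unset Printing Implicit Defensive.

Import Order.TTheory GRing.Theory Num.Theory.
Import numFieldNormedType.Exports.

Local Open Scope classical_set_scope.
Local Open Scope ring_scope.

Section Hyperbolic.
Context {R : realType}.
Implicit Type x : R.

Definition cosh x : R := (expR x + expR (- x)) / 2.
Definition sinh x : R := (expR x - expR (- x)) / 2.
Definition tanh x : R := sinh x / cosh x.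
Definition acosh x : R := ln (x + Num.sqrt (x ^+ 2 - 1)).

Lemma acoshK x : 1 <= x -> cosh (acosh x) = x.
Proof.
move=> x1; rewrite /cosh /acosh expRN.
have s0 : 0 <= Num.sqrt (x ^+ 2 - 1) by rewrite sqrtr_ge0.
have ss : Num.sqrt (x ^+ 2 - 1) ^+ 2 = x ^+ 2 - 1.
  by rewrite sqr_sqrtr // subr_ge0 expr_ge1 // (le_trans _ x1).
have y0 : 0 < x + Num.sqrt (x ^+ 2 - 1) by lra.
rewrite lnK ?posrE //; move: ss y0; set s := Num.sqrt _ => ss y0.
suff -> : (x + s)^-1 = x - s by field.
apply: (mulfI (lt0r_neq0 y0)); rewrite divff ?lt0r_neq0 //; lra.
Qed.

Lemma acosh_ge0 x : 1 <= x -> 0 <= acosh x.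
Proof.
move=> x1; apply: ln_ge0.
by rewrite (le_trans x1)// lerDl sqrtr_ge0.
Qed.

End Hyperbolic.

(* Edges of the pure two-dimensional simplicial complex with set of facets F. *)
Definition edges_of (N : nat) (F : {set {set 'I_N}}) : {set {set 'I_N}} :=
  [set e : {set 'I_N} | (#|e| == 2)%N && [exists f in F, e \subset f]].

(* A triangulation, with vertex set 'I_N, of a closed (compact, connected,
   without boundary) surface, orientable or not.  Since every edge lies on
   exactly two faces, the link of a vertex is a disjoint union of cycles, and
   [link_connected] makes it a single cycle, so that the complex is a
   2-manifold. *)
Record triangulation (N : nat) := Triangulation {
  faces : {set {set 'I_N}};
  faces_neq0 : faces != finset.set0;
  card_face : forall f, f \in faces -> #|f| = 3%N;
  vertex_in_face : forall i, exists2 f, f \in faces & i \in f;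
  card_edge_faces : forall e, e \in edges_of faces ->
    #|[set f in faces | e \subset f]%SET| = 2%N;
  link_connected : forall i j k,
    [set i; j]%SET \in edges_of faces -> [set i; k]%SET \in edges_of faces ->
    connect (fun a b => [set i; a; b]%SET \in faces) j k;
  surface_connected : forall i j,
    connect (fun a b => [set a; b]%SET \in edges_of faces) i j }.

Definition edges (N : nat) (T : triangulation N) := edges_of (faces T).

Inductive background := Euclidean | Hyperbolic.

Section Background.
Context {R : realType}.
Variable bg : background.

(* Length of an edge with inversive distance [w] between circles of radii
   [x], [y]. *)
Definition edge_length (w x y : R) : R :=
  match bg with
  | Euclidean => Num.sqrt (x ^+ 2 + y ^+ 2 + 2 * x * y * w)
  | Hyperbolic => acosh (cosh x * cosh y + w * sinh x * sinh y)
  end.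

(* Angle opposite to the side [a] in the triangle with side lengths [a], [b],
   [c], by the Euclidean or the hyperbolic law of cosines. *)
Definition angle (a b c : R) : R :=
  match bg with
  | Euclidean => acos ((b ^+ 2 + c ^+ 2 - a ^+ 2) / (2 * b * c))
  | Hyperbolic => acos ((cosh b * cosh c - cosh a) / (sinh b * sinh c))
  end.

Definition ext_angle (a b c : R) : R :=
  if [&& a < b + c, b < a + c & c < a + b] then angle a b c
  else if b + c <= a then pi else 0.

Definition scale (x : R) : R :=
  match bg with Euclidean => x | Hyperbolic => tanh (x / 2) end.

Definition metric_coef (x : R) : R := scale x ^+ 2.

End Background.

Section Flow.
Context {R : realType} {N : nat}.
Variables (T : triangulation N) (I : {set 'I_N} -> R) (bg : background).
Implicit Types (r : 'rV[R]_N) (i j k : 'I_N).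

Definition len r i j : R := edge_length bg (I [set i; j]%SET) (r 0 i) (r 0 j).

Definition positive_radii : set 'rV[R]_N := [set r | forall i, 0 < r 0 i].

(* The admissible space; letting i, j, k range over all orderings of a face
   yields its three triangle inequalities. *)
Definition Omega : set 'rV[R]_N := [set r | positive_radii r /\
  forall i j k, [set i; j; k]%SET \in faces T ->
    len r i j < len r i k + len r k j].

(* The condition p.1 < p.2 makes every face containing i occur once. *)
Definition curvature_with (ang : R -> R -> R -> R) r i : R :=
  2 * pi - \sum_(p : 'I_N * 'I_N |
                 (p.1 < p.2)%N && ([set i; p.1; p.2]%SET \in faces T))
    ang (len r p.1 p.2) (len r i p.1) (len r i p.2).

Definition Kcurv := curvature_with (angle bg).
Definition ext_Kcurv := curvature_with (ext_angle bg).

Definition Rcurv r i : R := Kcurv r i / scale bg (r 0 i) ^+ 2.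
Definition ext_Rcurv r i : R := ext_Kcurv r i / scale bg (r 0 i) ^+ 2.

Definition admissible (Rbar : 'I_N -> R) : Prop :=
  exists2 rbar, Omega rbar & Rcurv rbar =1 Rbar.

(* [r] solves dg_i/dt = (Rbar_i - curv_i) g_i on [0, tau) and stays in [D];
   the values of [r] outside [0, tau) are irrelevant. *)
Definition flow_solution (D : set 'rV[R]_N) (curv : 'rV[R]_N -> 'I_N -> R)
    (Rbar : 'I_N -> R) (r : R -> 'rV[R]_N) (tau : \bar R) : Prop :=
  [/\ (0 < tau)%E,
      forall t, 0 <= t -> (t%:E < tau)%E -> D (r t),
      r t @[t --> 0^'+] --> r 0
    & forall t i, 0 < t -> (t%:E < tau)%E ->
        is_derive t 1 (fun s => metric_coef bg (r s 0 i))
          ((Rbar i - curv (r t) i) * metric_coef bg (r t 0 i))].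

Definition maximal_solution (D : set 'rV[R]_N) (curv : 'rV[R]_N -> 'I_N -> R)
    (Rbar : 'I_N -> R) (r : R -> 'rV[R]_N) (tau : \bar R) : Prop :=
  flow_solution D curv Rbar r tau /\
  forall (r' : R -> 'rV[R]_N) (tau' : \bar R),
    flow_solution D curv Rbar r' tau' -> (tau <= tau')%E ->
    (forall t, 0 <= t -> (t%:E < tau)%E -> r' t = r t) -> tau' = tau.

Definition time_sequence (tau : \bar R) (t_ : nat -> R) : Prop :=
  (forall n, 0 <= t_ n /\ ((t_ n)%:E < tau)%E) /\
  (t_ n)%:E @[n --> \oo] --> tau.

Definition essential_singularity (r : R -> 'rV[R]_N) (tau : \bar R) : Prop :=
  exists i (t_ : nat -> R), time_sequence tau t_ /\
    r (t_ n) 0 i @[n --> \oo] --> (0 : R).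

Definition removable_singularity (r : R -> 'rV[R]_N) (tau : \bar R) : Prop :=
  exists t_ : nat -> R, [/\ time_sequence tau t_,
    exists2 A : set 'rV[R]_N, compact A /\ A `<=` positive_radii
      & forall n, A (r (t_ n))
    & exists i j k, [set i; j; k]%SET \in faces T /\
        (len (r (t_ n)) i k + len (r (t_ n)) k j - len (r (t_ n)) i j)
          @[n --> \oo] --> (0 : R)].

Definition converges_exponentially (r : R -> 'rV[R]_N) (rbar : 'rV[R]_N) :=
  exists C c : R, [/\ 0 < C, 0 < c &
    forall t, 0 <= t -> `|r t - rbar| <= C * expR (- c * t)].

(* In Euclidean geometry with Rbar = 0 the equation R(r) = Rbar is invariant
   under r |-> c *: r and the flow preserves the sum of the r_i ^+ 2, so [rbar]
   is only determined up to scaling, and its representative relevant to a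
   solution is the one with the same sum of squares as the initial value [r0].
   In all the other cases [normalize Rbar r0 rbar] is [rbar]. *)
Definition normalize (Rbar : 'I_N -> R) (r0 rbar : 'rV[R]_N) : 'rV[R]_N :=
  match bg with
  | Euclidean =>
      if [forall i, Rbar i == 0] then
        Num.sqrt ((\sum_i r0 0 i ^+ 2) / (\sum_i rbar 0 i ^+ 2)) *: rbar
      else rbar
  | Hyperbolic => rbar
  end.

End Flow.

(* Main.v *)
(* Put s_i = r_i, resp. tanh (r_i / 2), and u_i = ln s_i. The Jacobian of the
   angles of a face in the coordinates u is symmetric and, where the triangle is
   nondegenerate, minus a positive form controlling the (u_i - u_j)^2 (and the
   u_i^2 in hyperbolic geometry): at most one of its three edge weights is
   negative, and its determinant and a principal minor are explicit. The extended
   angles are constant on the degenerate part of a ray, so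
   sum_i w_i (K_i(s) - K_i(sbar)) >= 0 with w_i = u_i - ubar_i, with a quadratic
   lower bound for w in a bounded set.

   Let g_i = s_i^2. Along the extended flow
   L = sum_i (g_i ln (g_i / gbar_i) - g_i + gbar_i) satisfies
   L' = - 2 sum_i w_i (K_i - Kbar_i) + 2 sum_i Rbar_i w_i (g_i - gbar_i) <= 0,
   which bounds the Euclidean radii from above; in hyperbolic geometry K_i > 0 as
   soon as s_i is close to 1. If the radii of a set A of vertices tend to 0, then
   sum_A K_i has a limit, which is less than sum_A Kbar_i <= 0, so sum_A g_i
   increases near 0 and the radii are bounded below. On the resulting compact set
   L' <= - c L, which gives the exponential convergence. In finite time the flow
   has a limit with positive radii, and Peano's theorem continues the extended
   flow past it; the flow in Omega stops only if this limit is not in Omega, that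
   is, at a removable singularity. *)
Require Import Defs.
From HB Require Import structures.
From mathcomp Require Import all_boot all_order all_algebra.
From mathcomp Require Import all_classical all_reals all_analysis.
From mathcomp Require Import ring lra.

Set Implicit Arguments.
Unset Strict Implicit.
Unset Printing Implicit Defensive.

Import Order.TTheory GRing.Theory Num.Theory.
Import numFieldNormedType.Exports.

Local Open Scope classical_set_scope.
Local Open Scope ring_scope.

(** Two obstacles shape the argument. A segment in the coordinates u from the target metric to
    another one may leave the admissible space, whose convexity is not at hand. Hence the comparison
    with the target is made face by face along rays, with angles that make sense for all radii, and
    strict decrease is only claimed near the target, where the triangles are nondegenerate.

    A parameter k, equal to 0 or 1, carries both geometries through the same polynomial identities.
    The entropy is chosen because its derivative in g_i is ln (g_i / gbar_i) = 2 w_i, the weight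
    against which the curvature difference has a sign; no potential of the curvature has to be
    constructed. *)

Ltac nneg := repeat first
  [ assumption | apply: ltW; assumption | exact: sqr_ge0 | exact: ler01
  | exact: ler0n | apply: addr_ge0 | apply: mulr_ge0 | apply: exprn_ge0
  | apply: divr_ge0 | rewrite invr_ge0 | exact: normr_ge0 | exact: sqrtr_ge0
  | exact: expR_ge0 ].
Ltac pos := repeat first
  [ assumption | exact: ltr01 | exact: ltr0Sn | apply: addr_gt0 | apply: mulr_gt0
  | apply: exprn_gt0 | apply: divr_gt0 | rewrite invr_gt0 | exact: expR_gt0 ].

(** * Triangles of circles *)

Section TriangleAlgebra.
Context {R : realType}.
Variable k : R.
Implicit Types (a b c : R) (p q r : R * R).

(* A circle of radius r is encoded by the pair (r, 1) in Euclidean geometry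
   (k = 0) and by (sinh r, cosh r) in hyperbolic geometry (k = 1). For inversive
   distance c, the side l between p and q satisfies qlen = l^2, ccosh = 1 for
   k = 0 and qlen = sinh(l)^2, ccosh = cosh l for k = 1; the angle at p of the
   triangle p, q, r has cosine ncos / sqrt (qlen c p q * qlen b p r), where a, b, c
   are the inversive distances of the sides opposite to p, q, r. The triangle is
   nondegenerate when gram > 0. In the coordinate u with du = dr / r, resp.
   dr / sinh r, k * pder is the derivative of ccosh in the coordinate of p. *)
Definition ccosh c p q : R := p.2 * q.2 + k * c * p.1 * q.1.
Definition qlen c p q : R :=
  p.1 ^+ 2 + q.1 ^+ 2 + k * p.1 ^+ 2 * q.1 ^+ 2 * (1 + c ^+ 2)
  + 2 * c * p.1 * q.1 * p.2 * q.2.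
Definition ncos a b c p q r : R :=
  p.1 ^+ 2 * q.2 * r.2 + b * p.1 * r.1 * p.2 * q.2 + c * p.1 * q.1 * p.2 * r.2
  + k * b * c * p.1 ^+ 2 * q.1 * r.1 - a * q.1 * r.1.
Definition pder c p q : R := p.1 * (p.1 * q.2 + c * p.2 * q.1).
Definition gram a b c p q r : R :=
  qlen c p q * qlen b p r - ncos a b c p q r ^+ 2.
Definition nwgt a b c p q r : R :=
  p.1 * q.1 * (p.1 * q.1 * r.2 * (1 - c ^+ 2) + p.1 * r.1 * q.2 * (a + b * c)
               + q.1 * r.1 * p.2 * (b + a * c)).

Definition onk p : Prop := [/\ 0 < p.1, 1 <= p.2 & p.2 ^+ 2 = 1 + k * p.1 ^+ 2].

Lemma ccoshC c p q : ccosh c p q = ccosh c q p.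
Proof. rewrite /ccosh; ring. Qed.
Lemma qlenC c p q : qlen c p q = qlen c q p.
Proof. rewrite /qlen; ring. Qed.
Lemma ncosC a b c p q r : ncos a b c p q r = ncos a c b p r q.
Proof. rewrite /ncos; ring. Qed.
Lemma gramC a b c p q r : gram a b c p q r = gram a c b p r q.
Proof. by rewrite /gram ncosC mulrC. Qed.
Lemma nwgtC a b c p q r : nwgt a b c p q r = nwgt b a c q p r.
Proof. rewrite /nwgt; ring. Qed.


(** Reduces an identity to coordinates in which [X ^+ 2] is replaced by [1 + k * x ^+ 2], so that
    [ring] decides it modulo the equations of the three circles. *)
Let ring_onk (P : R -> R -> R -> (R * R) -> (R * R) -> (R * R) -> Prop) :
  (forall a b c x X y Y z Z, X ^+ 2 = 1 + k * x ^+ 2 -> Y ^+ 2 = 1 + k * y ^+ 2 ->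
     Z ^+ 2 = 1 + k * z ^+ 2 -> P a b c (x, X) (y, Y) (z, Z)) ->
  forall a b c p q r, onk p -> onk q -> onk r -> P a b c p q r.
Proof. by move=> h a b c [x X] [y Y] [z Z] [_ _ ?] [_ _ ?] [_ _ ?]; exact: h. Qed.

(** [gram] is [qlen c p q * qlen b p r] times the squared sine of the angle at p. Its independence
    of the vertex is the law of sines, squared. *)
Lemma gram_vertex a b c p q r : onk p -> onk q -> onk r ->
  gram a b c p q r = gram b a c q p r.
Proof.
move: a b c p q r; apply: ring_onk => a b c x X y Y z Z e1 e2 e3.
rewrite /gram /qlen /ncos /=; ring: e1 e2 e3.
Qed.

(** After division by the lengths: cos C + cos A cos B = sin A sin B cosh c, the law of cosines for
    angles. In Euclidean geometry [ccosh] is 1 and this is cos C = - cos (A + B). *)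
Lemma dual_cosine_law a b c p q r : onk p -> onk q -> onk r ->
  ncos c a b r p q * qlen c p q + ncos a b c p q r * ncos b a c q p r
  = gram a b c p q r * ccosh c p q.
Proof.
move: a b c p q r; apply: ring_onk => a b c x X y Y z Z e1 e2 e3.
rewrite /gram /qlen /ncos /ccosh /=; ring: e1 e2 e3.
Qed.

(** In Euclidean geometry: the projections of the other two sides on pq add up to pq. For
    nonnegative inversive distances the right-hand side is positive, which bounds A + B by pi and
    describes the degenerate triangles. *)
Lemma ncos_add a b c p q r : onk p -> onk q -> onk r ->
  (ccosh c p q + 1) * (ncos a b c p q r + ncos b a c q p r)
  = qlen c p q * (ccosh b p r + ccosh a q r).
Proof.
move: a b c p q r; apply: ring_onk => a b c x X y Y z Z e1 e2 e3.
rewrite /qlen /ncos /ccosh /=; ring: e1 e2 e3.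
Qed.

(** In hyperbolic geometry [pder c p q / (p.2 * sinh l)] is tanh d, with d the distance from p to
    the foot of the radical axis on pq. The identity says that the distances of p and of q to this
    foot add up to l. *)
Lemma pder_swap c p q : onk p -> onk q ->
  p.2 * qlen c p q - ccosh c p q * pder c p q = pder c q p.
Proof.
move: p q => [x X] [y Y] [_ _ /= e1] [_ _ /= e2].
rewrite /qlen /pder /ccosh /=; ring: e1 e2.
Qed.

(** With d as in [pder_swap], the right-hand side is [p.2 ^+ 2 * qlen c p q] times 1 - tanh(d)^2 in
    hyperbolic geometry. It lets distances to feet be compared by polynomial inequalities. *)
Lemma pder_sqr c p q : onk p -> onk q ->
  q.2 * pder c p q + p.2 * pder c q p = p.2 ^+ 2 * qlen c p q - k * pder c p q ^+ 2.
Proof.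
move: p q => [x X] [y Y] [_ _ /= e1] [_ _ /= e2].
rewrite /qlen /pder /=; ring: e1 e2.
Qed.

(** The right-hand side is what differentiating an angle produces; the left-hand side is visibly
    symmetric in p and q. This is the symmetry of the Jacobian. *)
Lemma nwgtE a b c p q r : onk p -> onk q -> onk r ->
  nwgt a b c p q r
  = pder b p r * qlen c p q - ncos a b c p q r * pder c p q.
Proof.
move: a b c p q r; apply: ring_onk => a b c x X y Y z Z e1 e2 e3.
rewrite /nwgt /qlen /pder /ncos /=; ring: e1 e2 e3.
Qed.

Lemma ncos_ccosh a b c p q r : onk p -> onk q -> onk r ->
  ncos b a c q p r + ccosh c p q * ncos a b c p q r = qlen c p q * ccosh b p r.
Proof.
move: a b c p q r; apply: ring_onk => a b c x X y Y z Z e1 e2 e3.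
rewrite /qlen /ncos /ccosh /=; ring: e1 e2 e3.
Qed.

Lemma gram_ccosh a b c p q r : onk p -> onk q -> onk r ->
  2 * ccosh c p q * ncos c a b r p q + qlen c p q - qlen b p r - qlen a q r
  = k * gram a b c p q r.
Proof.
move: a b c p q r; apply: ring_onk => a b c x X y Y z Z e1 e2 e3.
rewrite /gram /qlen /ncos /ccosh /=; ring: e1 e2 e3.
Qed.

Lemma ncos_cosine_law a b c p q r : onk p -> onk q -> onk r ->
  k * ncos a b c p q r = ccosh b p r * ccosh c p q - ccosh a q r.
Proof.
move: a b c p q r; apply: ring_onk => a b c x X y Y z Z e1 e2 e3.
rewrite /ncos /ccosh /=; ring: e1 e2 e3.
Qed.

Lemma qlen_ccosh c p q : onk p -> onk q -> k * qlen c p q = ccosh c p q ^+ 2 - 1.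
Proof.
move: p q => [x X] [y Y] [_ _ /= e1] [_ _ /= e2].
rewrite /qlen /ccosh /=; ring: e1 e2.
Qed.

End TriangleAlgebra.

(** * Edge weights, minors and determinant of the Jacobian of the angles *)

Section PositiveForm.
Context {R : realType}.
Variable k : R.
Hypothesis k0 : 0 <= k.
Implicit Types (a b c : R) (p q r : R * R).

Lemma ccosh_ge c p q : 0 <= c -> onk k p -> onk k q -> p.2 * q.2 <= ccosh k c p q.
Proof.
move=> c0 [p0 _ _] [q0 _ _]; rewrite /ccosh lerDl.
by rewrite !mulr_ge0// ltW.
Qed.

Lemma ccosh_ge1 c p q : 0 <= c -> onk k p -> onk k q -> 1 <= ccosh k c p q.
Proof.
move=> c0 hp hq; apply: le_trans (ccosh_ge c0 hp hq).
by case: hp hq => [_ p1 _] [_ q1 _]; rewrite -[leLHS]mulr1 ler_pM.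
Qed.

Lemma pder_gt0 c p q : 0 <= c -> onk k p -> onk k q -> 0 < pder c p q.
Proof.
move=> c0 [p0 p1 _] [q0 q1 _]; rewrite /pder mulr_gt0// ltr_pwDl//.
  by rewrite mulr_gt0// (lt_le_trans _ q1).
by rewrite !mulr_ge0// ltW// (lt_le_trans _ p1).
Qed.

Lemma qlen_ge c p q : 0 <= c -> onk k p -> onk k q -> p.1 ^+ 2 + q.1 ^+ 2 <= qlen k c p q.
Proof.
move=> c0 [p0 p1 _] [q0 q1 _]; rewrite /qlen -addrA lerDl.
have P0 : 0 <= p.2 by rewrite (le_trans _ p1).
have Q0 : 0 <= q.2 by rewrite (le_trans _ q1).
by rewrite addr_ge0// !mulr_ge0 ?exprn_ge0 ?addr_ge0 ?exprn_ge0 ?(ltW p0) ?(ltW q0).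
Qed.

Lemma qlen_gt0 c p q : 0 <= c -> onk k p -> onk k q -> 0 < qlen k c p q.
Proof.
move=> c0 hp hq; apply: lt_le_trans (qlen_ge c0 hp hq).
by case: hp hq => [p0 _ _] [q0 _ _]; rewrite addr_gt0// exprn_gt0.
Qed.

(* At most one of the three edge weights is negative: two nonpositive ones
   would force (b^2 - 1)(c^2 - 1) >= (a + b c)^2. *)
Lemma nwgt_neg_other a b c p q r : 0 <= a -> 0 <= b -> 0 <= c ->
  onk k p -> onk k q -> onk k r ->
  nwgt a b c p q r <= 0 -> 0 < nwgt a c b p r q.
Proof.
move=> a0 b0 c0 [p0 p1 _] [q0 q1 _] [r0 r1 _].
have P0 : 0 < p.2 by rewrite (lt_le_trans _ p1).
have Q0 : 0 < q.2 by rewrite (lt_le_trans _ q1).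
have R0 : 0 < r.2 by rewrite (lt_le_trans _ r1).
have pq : 0 < p.1 * q.1 by rewrite mulr_gt0.
have pr : 0 < p.1 * r.1 by rewrite mulr_gt0.
rewrite /nwgt (pmulr_rle0 _ pq) (pmulr_rgt0 _ pr).
set u := p.1 * q.1 * r.2; set v := p.1 * r.1 * q.2.
have u0 : 0 < u by rewrite /u !mulr_gt0.
have v0 : 0 < v by rewrite /v !mulr_gt0.
have w1 : 0 <= q.1 * r.1 * p.2 * (b + a * c).
  by rewrite !mulr_ge0 ?addr_ge0 ?mulr_ge0// ltW.
have w2 : 0 <= r.1 * q.1 * p.2 * (c + a * b).
  by rewrite !mulr_ge0 ?addr_ge0 ?mulr_ge0// ltW.
move=> h1; rewrite ltNge; apply/negP => h2.
have {w1}h1 : v * (a + b * c) <= u * (c ^+ 2 - 1) by lra.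
have {w2}h2 : u * (a + b * c) <= v * (b ^+ 2 - 1).
  move: h2; rewrite [c * b]mulrC; lra.
have d0 : b * c <= a + b * c by lra.
have bc0 : 0 <= b * c by rewrite mulr_ge0.
have c1 : 0 <= c ^+ 2 - 1.
  by rewrite -(pmulr_rge0 _ u0) (le_trans _ h1)// mulr_ge0 ?(ltW v0)// (le_trans bc0).
have h3 : u * (c ^+ 2 - 1) * (a + b * c) <= v * (b ^+ 2 - 1) * (c ^+ 2 - 1).
  by rewrite mulrAC ler_wpM2r.
have h4 : v * (a + b * c) * (a + b * c) <= u * (c ^+ 2 - 1) * (a + b * c).
  by rewrite ler_wpM2r ?h1// (le_trans bc0).
have h5 : (a + b * c) * (a + b * c) <= (b ^+ 2 - 1) * (c ^+ 2 - 1).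
  by rewrite -(ler_pM2l v0) !mulrA; exact: le_trans h4 h3.
have h6 : (b * c) * (b * c) <= (a + b * c) * (a + b * c) by rewrite ler_pM.
have b1 : 0 <= b ^+ 2 - 1.
  by rewrite -(pmulr_rge0 _ v0) (le_trans _ h2)// mulr_ge0 ?(ltW u0)// (le_trans bc0).
have := le_trans h6 h5; lra.
Qed.

(* Off the degenerate set, a negative weight on the edge pq makes the principal
   minor of the Jacobian at p, r positive: the foot of the radical axis of p, q
   is then farther from p than the one of p, r. *)
Lemma minor_factor_gt0 a b c p q r : 0 <= a -> 0 <= b -> 0 <= c ->
  onk k p -> onk k q -> onk k r ->
  0 < gram k a b c p q r -> nwgt a b c p q r <= 0 ->
  0 < - qlen k b p r * pder a r q * pder c p q
      + qlen k c p q * ccosh k a q r * pder a r q * pder b p r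
      + qlen k a q r * ccosh k c p q * pder c p q * pder b r p.
Proof.
move=> a0 b0 c0 hp hq hr D0 n0.
have q12 := qlen_gt0 c0 hp hq; have q13 := qlen_gt0 b0 hp hr.
have q23 := qlen_gt0 a0 hq hr.
have p12 := pder_gt0 c0 hp hq; have p21 := pder_gt0 c0 hq hp.
have p13 := pder_gt0 b0 hp hr; have p31 := pder_gt0 b0 hr hp.
have p23 := pder_gt0 a0 hq hr; have p32 := pder_gt0 a0 hr hq.
have C12 := ccosh_ge c0 hp hq; have C23 := ccosh_ge a0 hq hr.
have s12 := pder_swap c hp hq; have s32 := pder_swap a hr hq.
have Y12 := pder_sqr c hp hq; have Y13 := pder_sqr b hp hr.
move: n0; rewrite (nwgtE a b c hp hq hr).
move: D0; rewrite /gram.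
rewrite (qlenC k a r q) (ccoshC k a r q) in s32.
case: hp hq hr => [_ P1 _] [_ Q1 _] [_ R1 _].
move: q12 q13 q23 p12 p21 p13 p31 p23 p32 C12 C23 s12 s32 Y12 Y13 P1 Q1 R1.
move: (qlen k c p q) (qlen k b p r) (qlen k a q r) => q12 q13 q23.
move: (pder c p q) (pder c q p) (pder b p r) (pder b r p) (pder a q r) (pder a r q).
move=> p12 p21 p13 p31 p23 p32.
move: (ccosh k c p q) (ccosh k a q r) (ncos k a b c p q r) => C12 C23 N1.
move: p.2 q.2 r.2 => X Y Z q12p q13p q23p p12p p21p p13p p31p p23p p32p.
move=> C12g C23g s12 s32 Y12 Y13 X1 Z1 W1 D0 n0.
have X0 : 0 < X by lra. have Y0 : 0 < Y by lra. have Z0 : 0 < Z by lra.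
have C12p : 0 < C12 by rewrite (lt_le_trans _ C12g)// mulr_gt0.
have C23p : 0 < C23 by rewrite (lt_le_trans _ C23g)// mulr_gt0.
(* A nonpositive weight gives [p13 * q12 <= N1 * p12], and a positive [gram] gives
   [N1 ^+ 2 < q12 * q13]. *)
have h1 : p13 ^+ 2 * q12 <= q13 * p12 ^+ 2.
  have e1 : (p13 * q12) ^+ 2 <= (N1 * p12) ^+ 2.
    have u0 : 0 <= p13 * q12 by rewrite mulr_ge0// ltW.
    by rewrite ler_sqr ?nnegrE//; lra.
  have e2 : (N1 * p12) ^+ 2 <= q12 * q13 * p12 ^+ 2.
    by rewrite exprMn ler_wpM2r ?sqr_ge0//; lra.
  rewrite -(ler_pM2r q12p).
  have := le_trans e1 e2; rewrite !exprMn !expr2; lra.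
set Y12v := Y * p12 + X * p21 in Y12; set Y13v := Z * p13 + X * p31 in Y13.
have h2 : Y12v * q13 <= Y13v * q12.
  have := ler_wpM2l k0 h1; rewrite Y12 Y13; lra.
have h3 : X * Y * q12 <= C12 * Y12v.
  have e : C12 * Y12v - X * Y * q12 = p21 * (X * C12 - Y).
    rewrite /Y12v -s12; ring.
  rewrite -subr_ge0 e mulr_ge0 ?(ltW p21p)// subr_ge0.
  apply: le_trans (_ : X * (X * Y) <= _); last by rewrite ler_pM2l.
  by rewrite mulrA -[leLHS]mul1r ler_pM2r// -[leLHS]mulr1 ler_pM.
have h4 : X * Z * q13 <= C12 * C23 * Y13v.
  apply: le_trans (_ : X * Y * C23 * q13 <= _).
    rewrite ler_pM2r// -!mulrA ler_pM2l//.
    apply: le_trans (_ : Y * (Y * Z) <= _); last by rewrite ler_pM2l.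
    by rewrite mulrA -[leLHS]mul1r ler_pM2r// -[leLHS]mulr1 ler_pM.
  rewrite -(ler_pM2r q12p).
  have e1 := ler_wpM2l (ltW (mulr_gt0 C23p q13p)) h3.
  have e2 := ler_wpM2l (ltW (mulr_gt0 C12p C23p)) h2.
  lra.
(* The terms other than the one bounded by [h4] are positive. *)
have e : X * Z * (- q13 * p32 * p12 + q12 * C23 * p32 * p13 + q23 * C12 * p12 * p31)
  = p12 * p32 * (C12 * C23 * Y13v - X * Z * q13)
    + (Z * C23 * p32 * p13 * p21 + X * C12 * p12 * p31 * p23).
  rewrite /Y13v -s12 -s32; ring.
rewrite -(pmulr_rgt0 _ (mulr_gt0 X0 Z0)) e ltr_wpDl//.
  by rewrite mulr_ge0 ?(mulr_ge0 (ltW p12p) (ltW p32p)) ?subr_ge0.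
by rewrite addr_gt0// !mulr_gt0.
Qed.



(** Divided by the square root of [gram], this is the derivative of the angle at p in the coordinate
    u of q. *)
Definition wgt a b c p q r := nwgt a b c p q r / qlen k c p q.

Lemma wgtC a b c p q r : wgt a b c p q r = wgt b a c q p r.
Proof. by rewrite /wgt nwgtC qlenC. Qed.

Lemma wgtE a b c p q r : 0 <= c -> onk k p -> onk k q -> onk k r ->
  wgt a b c p q r
  = pder b p r - ncos k a b c p q r * pder c p q / qlen k c p q.
Proof.
move=> c0 hp hq hr; have q12 := qlen_gt0 c0 hp hq.
by rewrite /wgt (nwgtE _ _ _ hp hq hr); field; rewrite gt_eqF.
Qed.

(** The right-hand side is minus the diagonal entry of the Jacobian at p, times the square root of
    [gram]. In Euclidean geometry, where [ccosh] is 1, the rows of the Jacobian thus sum to 0: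
    scaling does not change the angles. *)
Lemma wgt_diag a b c p q r : 0 <= b -> 0 <= c ->
  onk k p -> onk k q -> onk k r ->
  wgt a b c p q r * ccosh k c p q + wgt a c b p r q * ccosh k b p r
  = ncos k c a b r p q * pder b p r / qlen k b p r
    + ncos k b a c q p r * pder c p q / qlen k c p q.
Proof.
move=> b0 c0 hp hq hr.
have := qlen_gt0 c0 hp hq; have := qlen_gt0 b0 hp hr.
rewrite !wgtE// (ncosC k a c b).
have e1 := ncos_ccosh a b c hp hq hr; have e2 := ncos_ccosh a c b hp hr hq.
rewrite (ncosC k a c b) in e2 => q13 q12.
have -> : ncos k b a c q p r
    = qlen k c p q * ccosh k b p r - ccosh k c p q * ncos k a b c p q r by lra.
have -> : ncos k c a b r p q
    = qlen k b p r * ccosh k c p q - ccosh k b p r * ncos k a b c p q r by lra.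
by field; rewrite !gt_eqF.
Qed.

Let minor_identity (q12 q13 q23 N1 N2 N3 p12 p13 p31 p32 C12 C23 D : R) :
  0 < q12 -> 0 < q13 -> 0 < q23 ->
  q12 * q23 - N2 ^+ 2 = D ->
  N3 * q12 + N1 * N2 = D * C12 ->
  N1 * q23 + N2 * N3 = D * C23 ->
  (N3 * p13 / q13 + N2 * p12 / q12) * (N2 * p32 / q23 + N1 * p31 / q13)
  - (p12 - N1 * p13 / q13) * (p32 - N3 * p31 / q13)
  = D / (q12 * q13 * q23) * (- q13 * p32 * p12 + q12 * C23 * p32 * p13
                             + q23 * C12 * p12 * p31).
Proof.
move=> q12p q13p q23p D2 D12 D23.
have -> : D / (q12 * q13 * q23) * (- q13 * p32 * p12 + q12 * C23 * p32 * p13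
                             + q23 * C12 * p12 * p31)
  = (- q13 * D * p32 * p12 + q12 * (D * C23) * p32 * p13
                             + q23 * (D * C12) * p12 * p31) / (q12 * q13 * q23).
  by ring.
by rewrite -D12 -D23 -D2; field; rewrite !gt_eqF.
Qed.

(** Up to a positive factor, the principal minor at p and r is [gram] times the expression of
    [minor_factor_gt0]. *)
Lemma minorE a b c p q r : 0 <= a -> 0 <= b -> 0 <= c ->
  onk k p -> onk k q -> onk k r ->
  (wgt a b c p q r * ccosh k c p q + wgt a c b p r q * ccosh k b p r)
    * (wgt b c a q r p * ccosh k a q r + wgt a c b p r q * ccosh k b p r)
    - wgt a c b p r q ^+ 2
  = gram k a b c p q r / (qlen k c p q * qlen k b p r * qlen k a q r)
    * (- qlen k b p r * pder a r q * pder c p q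
       + qlen k c p q * ccosh k a q r * pder a r q * pder b p r
       + qlen k a q r * ccosh k c p q * pder c p q * pder b r p).
Proof.
move=> a0 b0 c0 hp hq hr.
have D1 := gram_vertex a b c hp hq hr.
have L12 := dual_cosine_law a b c hp hq hr.
have L23 := dual_cosine_law b c a hq hr hp.
rewrite (gramC k b c a) -D1 in L23.
have [[q12 q13] q23] := (qlen_gt0 c0 hp hq, qlen_gt0 b0 hp hr, qlen_gt0 a0 hq hr).
have -> : wgt b c a q r p * ccosh k a q r + wgt a c b p r q * ccosh k b p r
  = ncos k b a c q p r * pder a r q / qlen k a q r
    + ncos k a b c p q r * pder b r p / qlen k b p r.
  have := wgt_diag c a0 b0 hr hp hq.
  rewrite (wgtC c a b) (wgtC c b a) !(ccoshC k _ r) !(qlenC k _ r).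
  by rewrite (ncosC k b c a) (ncosC k a c b) => <-; rewrite addrC.
have e : wgt a c b p r q ^+ 2
  = (pder c p q - ncos k a b c p q r * pder b p r / qlen k b p r)
    * (pder a r q - ncos k c a b r p q * pder b r p / qlen k b p r).
  rewrite expr2 {1}(wgtE _ _ b0 hp hr hq) (wgtC a c b) (wgtE _ _ b0 hr hp hq).
  by rewrite (ncosC k a c b) (qlenC k b r p).
rewrite e wgt_diag//; apply: minor_identity => //.
- by rewrite D1 /gram (qlenC k c q p).
- by rewrite -L23 (ncosC k b c a) (ncosC k c b a).
Qed.

(* Determinant of the full Jacobian, as the one of a product of two matrices. *)
Lemma det_identity (q12 q13 q23 N1 N2 N3 p12 p13 p21 p23 p31 p32 C12 D : R) :
  0 < q12 -> 0 < q13 -> 0 < q23 ->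
  q12 * q13 - N1 ^+ 2 = D -> q12 * q23 - N2 ^+ 2 = D -> q13 * q23 - N3 ^+ 2 = D ->
  N3 * q12 + N1 * N2 = D * C12 ->
  2 * C12 * N3 + q12 - q13 - q23 = k * D ->
  let w12 := p13 - N1 * p12 / q12 in let w12' := p23 - N2 * p21 / q12 in
  let w13 := p12 - N1 * p13 / q13 in let w13' := p32 - N3 * p31 / q13 in
  let w23 := p21 - N2 * p23 / q23 in let w23' := p31 - N3 * p32 / q23 in
  let m1 := N3 * p13 / q13 + N2 * p12 / q12 in
  let m2 := N3 * p23 / q23 + N1 * p21 / q12 in
  let m3 := N2 * p32 / q23 + N1 * p31 / q13 in
  m1 * (m2 * m3 - w23 * w23') - w12' * (w12 * m3 + w13 * w23')
  - w13' * (w12 * w23 + m2 * w13)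
  = k * D ^+ 2 / (q12 * q13 * q23) * (p12 * p23 * p31 + p21 * p32 * p13).
Proof.
move=> q12p q13p q23p D1 D2 D3 D12 Dk /=.
pose f1 := N1 / q12; pose f1' := N1 / q13; pose f2 := N2 / q12.
pose f2' := N2 / q23; pose f3 := N3 / q13; pose f3' := N3 / q23.
(* Up to sign, the determinant of the matrix that expresses the differentials of the angles,
   normalized, in those of the sides. The other factor, [p12 * p23 * p31 + p21 * p32 * p13], is the
   determinant of the sides in the coordinates u. *)
have e : -1 + f1 * f2' * f3 + f1' * f2 * f3' + f3 * f3' + f2 * f2' + f1 * f1'
   = k * D ^+ 2 / (q12 * q13 * q23).
  rewrite [k * _]mulrA -Dk.
  have -> : (2 * C12 * N3 + q12 - q13 - q23) * D
    = 2 * N3 * (D * C12) + (q12 - q13 - q23) * D by ring.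
  have N1E : N1 ^+ 2 = q12 * q13 - D by lra.
  have N2E : N2 ^+ 2 = q12 * q23 - D by lra.
  have N3E : N3 ^+ 2 = q13 * q23 - D by lra.
  transitivity ((- (q12 * q13 * q23) + 2 * N1 * N2 * N3 + N3 ^+ 2 * q12
                 + N2 ^+ 2 * q13 + N1 ^+ 2 * q23) / (q12 * q13 * q23)).
    by rewrite /f1 /f1' /f2 /f2' /f3 /f3'; field; rewrite !gt_eqF.
  have -> : 2 * N3 * (D * C12) = 2 * (N3 ^+ 2 * q12 + N1 * N2 * N3).
    by rewrite -D12; ring.
  by rewrite N1E N2E N3E; congr (_ / _); ring.
rewrite -e /f1 /f1' /f2 /f2' /f3 /f3'; ring.
Qed.

End PositiveForm.

(** * Coercivity of the Jacobian *)

Lemma coercive_shear {R : realFieldType} (m al be A : R) : 0 < m -> 0 < A ->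
  exists2 e, 0 < e & forall s1 s2 t,
    e * (s1 ^+ 2 + s2 ^+ 2 + t ^+ 2)
    <= (A * t - al * s1 - be * s2) ^+ 2 + m * (s1 ^+ 2 + s2 ^+ 2).
Proof.
move=> m0 A0; pose K := al ^+ 2 + be ^+ 2.
have K0 : 0 <= K by rewrite addr_ge0 ?sqr_ge0.
have d0 : 0 < m + 4 * K by rewrite ltr_pwDl// mulr_ge0.
(* The square is kept with a weight [la <= 1] so small that the price [la * K * S] of the cross
   terms stays below half of [m * S]. *)
pose la := m / (m + 4 * K).
have la0 : 0 < la by rewrite divr_gt0.
have la1 : la <= 1 by rewrite ler_pdivrMr// mul1r lerDl mulr_ge0.
have laK : la * (2 * K) <= m / 2.
  by rewrite /la mulrAC ler_pdivrMr//; have := mulr_gt0 m0 m0; lra.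
exists (Num.min (la * A ^+ 2 / 2) (m / 2)).
  have := mulr_gt0 la0 (exprn_gt0 2 A0); rewrite lt_min => h.
  by apply/andP; split; lra.
move=> s1 s2 t; set e := Num.min _ _.
have e1 : e <= la * A ^+ 2 / 2 by rewrite ge_min lexx.
have e2 : e <= m / 2 by rewrite ge_min lexx orbT.
set u := A * t - al * s1 - be * s2; set S := s1 ^+ 2 + s2 ^+ 2.
have S0 : 0 <= S by rewrite addr_ge0 ?sqr_ge0.
have cs : (al * s1 + be * s2) ^+ 2 <= K * S.
  rewrite -subr_ge0.
  have -> : K * S - (al * s1 + be * s2) ^+ 2 = (al * s2 - be * s1) ^+ 2.
    by rewrite /K /S; ring.
  exact: sqr_ge0.
have h1 : A ^+ 2 * t ^+ 2 / 2 <= u ^+ 2 + K * S.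
  have -> : A ^+ 2 * t ^+ 2 = (u + (al * s1 + be * s2)) ^+ 2 by rewrite /u; ring.
  have := sqr_ge0 (u - (al * s1 + be * s2)).
  lra.
have h2 : la * (A ^+ 2 * t ^+ 2 / 2) <= la * (u ^+ 2 + K * S) by rewrite ler_pM2l.
have h3 : la * u ^+ 2 <= u ^+ 2 by rewrite ler_piMl ?sqr_ge0.
have h4 : la * (2 * K) * S <= m / 2 * S by rewrite ler_wpM2r.
have h5 : e * t ^+ 2 <= la * A ^+ 2 / 2 * t ^+ 2 by rewrite ler_wpM2r ?sqr_ge0.
have h6 : e * S <= m / 2 * S by rewrite ler_wpM2r.
have h7 : 0 <= la * K * S by rewrite mulr_ge0 ?(mulr_ge0 (ltW la0) K0).
have h8 := mulr_ge0 (ltW m0) S0.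
rewrite mulrDr; lra.
Qed.

(** The constant is the determinant over the trace, which is at most the smaller eigenvalue. After
    multiplication by the trace the difference of the two sides is a sum of two squares. *)
Lemma coercive_2x2 {R : realFieldType} (al be ga : R) :
  0 < al -> 0 < ga -> 0 < al * ga - be ^+ 2 ->
  exists2 e, 0 < e & forall s t,
    e * (s ^+ 2 + t ^+ 2) <= al * s ^+ 2 + ga * t ^+ 2 - 2 * be * s * t.
Proof.
move=> al0 ga0 d0; have sg : 0 < al + ga by lra.
exists ((al * ga - be ^+ 2) / (al + ga)); first by rewrite divr_gt0.
move=> s t; rewrite -(ler_pM2r sg) mulrAC divfK ?gt_eqF// -subr_ge0.
have -> : (al * s ^+ 2 + ga * t ^+ 2 - 2 * be * s * t) * (al + ga)
          - (al * ga - be ^+ 2) * (s ^+ 2 + t ^+ 2)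
        = (al * s - be * t) ^+ 2 + (ga * t - be * s) ^+ 2 by ring.
by rewrite addr_ge0 ?sqr_ge0.
Qed.

Section QForm.
Context {R : realType}.
Variable k : R.
Hypothesis k0 : 0 <= k.
Implicit Types (a b c : R) (p q r : R * R).

(* When the coordinates u of p, q, r move with speed v1, v2, v3, this is
   - sqrt gram times the sum of the v_i * (derivative of the angle i). *)
Definition qform a b c p q r v1 v2 v3 : R :=
  wgt k a b c p q r * (ccosh k c p q * (v1 ^+ 2 + v2 ^+ 2) - 2 * v1 * v2)
  + wgt k a c b p r q * (ccosh k b p r * (v1 ^+ 2 + v3 ^+ 2) - 2 * v1 * v3)
  + wgt k b c a q r p * (ccosh k a q r * (v2 ^+ 2 + v3 ^+ 2) - 2 * v2 * v3).

(** For k = 0 it vanishes on the diagonal, the direction of scaling, as the Jacobian does. *)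
Definition nform (v1 v2 v3 : R) : R :=
  (v1 - v2) ^+ 2 + (v1 - v3) ^+ 2 + (v2 - v3) ^+ 2
  + k * (v1 ^+ 2 + v2 ^+ 2 + v3 ^+ 2).

Lemma qform_swap12 a b c p q r v1 v2 v3 :
  qform b a c q p r v2 v1 v3 = qform a b c p q r v1 v2 v3.
Proof.
by rewrite /qform (wgtC k b a c) (ccoshC k c q p); ring.
Qed.

Lemma qform_swap23 a b c p q r v1 v2 v3 :
  qform a c b p r q v1 v3 v2 = qform a b c p q r v1 v2 v3.
Proof.
by rewrite /qform (wgtC k c b a) (ccoshC k a r q); ring.
Qed.

Lemma nform_ge0 v1 v2 v3 : 0 <= nform v1 v2 v3.
Proof. by rewrite /nform; nneg. Qed.

Lemma nform_le v1 v2 v3 :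
  nform v1 v2 v3 <= (4 + k) * (v1 ^+ 2 + v2 ^+ 2 + v3 ^+ 2).
Proof.
rewrite /nform.
have := sqr_ge0 (v1 + v2); have := sqr_ge0 (v1 + v3); have := sqr_ge0 (v2 + v3).
have := sqr_ge0 v1; have := sqr_ge0 v2; have := sqr_ge0 v3; lra.
Qed.

Lemma ccosh0 c p q : k = 0 -> onk k p -> onk k q -> ccosh k c p q = 1.
Proof.
move=> -> [p0 p1 pe] [q0 q1 qe]; rewrite /ccosh !mul0r addr0.
have P1 : p.2 = 1 by apply/eqP; move: pe; rewrite mul0r addr0 => /eqP; rewrite sqrf_eq1 => /orP[//|/eqP]; lra.
have Q1 : q.2 = 1 by apply/eqP; move: qe; rewrite mul0r addr0 => /eqP; rewrite sqrf_eq1 => /orP[//|/eqP]; lra.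
by rewrite P1 Q1 mulr1.
Qed.

(** The coefficient [m3] of [v3 ^+ 2] is positive because its two weights are, so v3 is eliminated
    by completing the square. There remains a binary form whose diagonal entries are the two minors
    and whose determinant is [m3] times the full one. For k = 0 the full determinant vanishes and
    the binary form is a multiple of [(v1 - v2) ^+ 2]. *)
Let coercive_form (w12 w13 w23 C12 C13 C23 d : R) :
  0 < w13 -> 0 < w23 -> 1 <= C12 -> 1 <= C13 -> 1 <= C23 ->
  (k = 0 -> C12 = 1 /\ C13 = 1 /\ C23 = 1) ->
  let m1 := w12 * C12 + w13 * C13 in let m2 := w12 * C12 + w23 * C23 in
  let m3 := w13 * C13 + w23 * C23 in
  0 < m1 * m3 - w13 ^+ 2 -> 0 < m2 * m3 - w23 ^+ 2 -> 0 < d ->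
  m1 * (m2 * m3 - w23 ^+ 2) - w12 * (w12 * m3 + w13 * w23)
    - w13 * (w12 * w23 + m2 * w13) = k * d ->
  exists2 e, 0 < e & forall v1 v2 v3, e * nform v1 v2 v3 <=
    w12 * (C12 * (v1 ^+ 2 + v2 ^+ 2) - 2 * v1 * v2)
  + w13 * (C13 * (v1 ^+ 2 + v3 ^+ 2) - 2 * v1 * v3)
  + w23 * (C23 * (v2 ^+ 2 + v3 ^+ 2) - 2 * v2 * v3).
Proof.
move=> w13p w23p C12g C13g C23g CE m1 m2 m3 P13 P23 d0 det.
have m3p : 0 < m3 by rewrite addr_gt0// mulr_gt0//; lra.
pose de := m3 * w12 + w13 * w23.
have id v1 v2 v3 : (w12 * (C12 * (v1 ^+ 2 + v2 ^+ 2) - 2 * v1 * v2)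
    + w13 * (C13 * (v1 ^+ 2 + v3 ^+ 2) - 2 * v1 * v3)
    + w23 * (C23 * (v2 ^+ 2 + v3 ^+ 2) - 2 * v2 * v3)) * m3
  = (m3 * v3 - w13 * v1 - w23 * v2) ^+ 2 + ((m1 * m3 - w13 ^+ 2) * v1 ^+ 2
    + (m2 * m3 - w23 ^+ 2) * v2 ^+ 2 - 2 * de * v1 * v2).
  by rewrite /de /m1 /m2 /m3; ring.
have idd : (m1 * m3 - w13 ^+ 2) * (m2 * m3 - w23 ^+ 2) - de ^+ 2 = m3 * (k * d).
  by rewrite -det /de; ring.
have [kp|kz] : 0 < k \/ k = 0 by move: k0; rewrite le_eqVlt => /orP[/eqP|]; auto.
  have dd : 0 < (m1 * m3 - w13 ^+ 2) * (m2 * m3 - w23 ^+ 2) - de ^+ 2.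
    by rewrite idd; pos.
  have [e1 e10 h1] := coercive_2x2 P13 P23 dd.
  have [e2 e20 h2] := coercive_shear w13 w23 e10 m3p.
  exists (e2 / ((4 + k) * m3)); first by pos.
  move=> v1 v2 v3; rewrite -(ler_pM2r m3p) id.
  apply: le_trans (_ : e2 * (v1 ^+ 2 + v2 ^+ 2 + v3 ^+ 2) <= _).
    have k4 : 0 < 4 + k by lra.
    have -> : e2 / ((4 + k) * m3) * nform v1 v2 v3 * m3
      = e2 * (nform v1 v2 v3 / (4 + k)) by field; rewrite !gt_eqF.
    by rewrite ler_pM2l// ler_pdivrMr// mulrC nform_le.
  by apply: le_trans (h2 v1 v2 v3) _; rewrite lerD2l h1.
have [c12 [c13 c23]] := CE kz.
have de1 : m1 * m3 - w13 ^+ 2 = de by rewrite /de /m1 /m3 c12 c13 c23; ring.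
have de2 : m2 * m3 - w23 ^+ 2 = de by rewrite /de /m2 /m3 c12 c13 c23; ring.
have [e2 e20 h2] := coercive_shear (- w23) 0 P13 m3p.
exists (e2 / (3 * m3)); first by pos.
move=> v1 v2 v3; rewrite -(ler_pM2r m3p) id.
have -> : m3 * v3 - w13 * v1 - w23 * v2
    = m3 * (v3 - v1) - (- w23) * (v1 - v2) - 0 * 0.
  by rewrite /m3 c13 c23; ring.
have := h2 (v1 - v2) 0 (v3 - v1); rewrite -de2 in de1.
rewrite de1 de2 => /(le_trans _); rewrite expr0n addr0 => h.
have -> : de * v1 ^+ 2 + de * v2 ^+ 2 - 2 * de * v1 * v2 = de * (v1 - v2) ^+ 2 by ring.
apply: h.
have -> : e2 / (3 * m3) * nform v1 v2 v3 * m3 = e2 * (nform v1 v2 v3 / 3).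
  by field; rewrite gt_eqF.
rewrite ler_pM2l// ler_pdivrMr// /nform kz mul0r addr0.
have := sqr_ge0 (v1 - v2 + (v3 - v1)); have := sqr_ge0 ((v1 - v2) - (v3 - v1)).
have := sqr_ge0 (v1 - v2); have := sqr_ge0 (v3 - v1); lra.
Qed.

Let coercive (Q : R -> R -> R -> R) :=
  exists2 e, 0 < e & forall v1 v2 v3, e * nform v1 v2 v3 <= Q v1 v2 v3.

Let mdiag a b c p q r :=
  wgt k a b c p q r * ccosh k c p q + wgt k a c b p r q * ccosh k b p r.


Lemma jacobian_det a b c p q r : 0 <= a -> 0 <= b -> 0 <= c ->
  onk k p -> onk k q -> onk k r ->
  let w12 := wgt k a b c p q r in let w13 := wgt k a c b p r q in
  let w23 := wgt k b c a q r p in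
  let m1 := mdiag a b c p q r in let m2 := mdiag b a c q p r in
  let m3 := mdiag c a b r p q in
  0 < gram k a b c p q r -> exists2 d, 0 < d &
  m1 * (m2 * m3 - w23 ^+ 2) - w12 * (w12 * m3 + w13 * w23)
  - w13 * (w12 * w23 + m2 * w13) = k * d.
Proof.
move=> a0 b0 c0 hp hq hr /= D0.
exists (gram k a b c p q r ^+ 2 / (qlen k c p q * qlen k b p r * qlen k a q r)
    * (pder c p q * pder a q r * pder b r p + pder c q p * pder a r q * pder b p r)).
  have [[q12 q13] q23] :=
    (qlen_gt0 k0 c0 hp hq, qlen_gt0 k0 b0 hp hr, qlen_gt0 k0 a0 hq hr).
  have [p12 p21] := (pder_gt0 c0 hp hq, pder_gt0 c0 hq hp).
  have [p13 p31] := (pder_gt0 b0 hp hr, pder_gt0 b0 hr hp).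
  have [p23 p32] := (pder_gt0 a0 hq hr, pder_gt0 a0 hr hq).
  by pos.
rewrite 2!mulrA.
have [[q12 q13] q23] :=
  (qlen_gt0 k0 c0 hp hq, qlen_gt0 k0 b0 hp hr, qlen_gt0 k0 a0 hq hr).
have D1 := gram_vertex a b c hp hq hr.
have D3 := gram_vertex a c b hp hr hq.
have L12 := dual_cosine_law a b c hp hq hr.
have Lk := gram_ccosh a b c hp hq hr.
rewrite (gramC k a c b) in D3.
have E := det_identity (pder c p q) (pder b p r) (pder c q p) (pder a q r)
  (pder b r p) (pder a r q) q12 q13 q23 erefl _ _ L12 Lk.
rewrite -{}E; first last.
- by rewrite -/(gram k a b c p q r) D3 /gram (qlenC k b r p) (qlenC k a r q).
- by rewrite -/(gram k a b c p q r) D1 /gram (qlenC k c q p).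
have f12 := wgtE k0 a b c0 hp hq hr; have f21 := wgtE k0 b a c0 hq hp hr.
have f13 := wgtE k0 a c b0 hp hr hq; have f31 := wgtE k0 c a b0 hr hp hq.
have f23 := wgtE k0 b c a0 hq hr hp; have f32 := wgtE k0 c b a0 hr hq hp.
rewrite (wgtC k b a c) (qlenC k c q p) in f21.
rewrite (wgtC k c a b) (qlenC k b r p) in f31.
rewrite (wgtC k c b a) (qlenC k a r q) in f32.
rewrite (ncosC k a c b) in f13; rewrite (ncosC k b c a) in f23.
rewrite (ncosC k c b a) in f32.
have g1 := wgt_diag k0 a b0 c0 hp hq hr.
have g2 := wgt_diag k0 b a0 c0 hq hp hr.
have g3 := wgt_diag k0 c a0 b0 hr hp hq.
rewrite (qlenC k c q p) (ncosC k c b a) in g2.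
rewrite (ncosC k b c a) (ncosC k a c b) (qlenC k b r p) (qlenC k a r q) in g3.
rewrite /mdiag g1 g2 g3 -f12 -f21 -f13 -f31 -f23 -f32; ring.
Qed.

Let qform_coercive_neg a b c p q r : 0 <= a -> 0 <= b -> 0 <= c ->
  onk k p -> onk k q -> onk k r -> 0 < gram k a b c p q r ->
  nwgt a b c p q r <= 0 -> coercive (qform a b c p q r).
Proof.
move=> a0 b0 c0 hp hq hr D0 n12.
have n13 := nwgt_neg_other a0 b0 c0 hp hq hr n12.
have n23 : 0 < nwgt b c a q r p.
  by apply: (nwgt_neg_other b0 a0 c0 hq hp hr); rewrite nwgtC.
have [[q12 q13] q23] :=
  (qlen_gt0 k0 c0 hp hq, qlen_gt0 k0 b0 hp hr, qlen_gt0 k0 a0 hq hr).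
have D0' : 0 < gram k b a c q p r by rewrite -gram_vertex.
have n12' : nwgt b a c q p r <= 0 by rewrite nwgtC.
have E13 := minor_factor_gt0 k0 a0 b0 c0 hp hq hr D0 n12.
have E23 : _ := minor_factor_gt0 k0 b0 a0 c0 hq hp hr D0' n12'.
have m13 := minorE k0 a0 b0 c0 hp hq hr.
have m23 := minorE k0 b0 a0 c0 hq hp hr.
have [d d0 det] := jacobian_det a0 b0 c0 hp hq hr D0.
have [w13 w23] : 0 < wgt k a c b p r q /\ 0 < wgt k b c a q r p.
  by split; apply: divr_gt0.
have {}m13 := eq_ind_r (fun u => 0 < u) (mulr_gt0 (divr_gt0 D0
   (mulr_gt0 (mulr_gt0 q12 q13) q23)) E13) m13.
rewrite (qlenC k c q p) in m23 E23.
have {}m23 := eq_ind_r (fun u => 0 < u) (mulr_gt0 (divr_gt0 D0'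
   (mulr_gt0 (mulr_gt0 q12 q23) q13)) E23) m23.
have C12 := ccosh_ge1 k0 c0 hp hq; have C13 := ccosh_ge1 k0 b0 hp hr.
have C23 := ccosh_ge1 k0 a0 hq hr.
rewrite /coercive /qform /nform; apply: (coercive_form w13 w23 C12 C13 C23 _ _ _ d0).
- by move=> e; rewrite !ccosh0.
- by move: m13; rewrite [X in _ * X - _]addrC.
- by move: m23; rewrite (wgtC k b a c) (ccoshC k c q p) [X in _ * X - _]addrC.
- rewrite -det /mdiag (wgtC k b a c) (ccoshC k c q p) (wgtC k c a b) (wgtC k c b a).
  by rewrite (ccoshC k b r p) (ccoshC k a r q).
Qed.

Lemma qform_coercive a b c p q r : 0 <= a -> 0 <= b -> 0 <= c ->
  onk k p -> onk k q -> onk k r -> 0 < gram k a b c p q r ->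
  exists2 e, 0 < e & forall v1 v2 v3, e * nform v1 v2 v3 <= qform a b c p q r v1 v2 v3.
Proof.
move=> a0 b0 c0 hp hq hr D0.
have [n12|n12] := leP (nwgt a b c p q r) 0; first exact: qform_coercive_neg.
have [n13|n13] := leP (nwgt a c b p r q) 0.
  have D0' : 0 < gram k a c b p r q by rewrite gramC.
  have [e e0 h] := qform_coercive_neg a0 c0 b0 hp hr hq D0' n13.
  exists e => // v1 v2 v3; rewrite -qform_swap23; apply: le_trans (h _ _ _).
  by rewrite le_eqVlt; apply/orP; left; apply/eqP; rewrite /nform; ring.
have [n23|n23] := leP (nwgt b c a q r p) 0.
  have D0' : 0 < gram k b c a q r p by rewrite gramC -gram_vertex.
  have [e e0 h] := qform_coercive_neg b0 c0 a0 hq hr hp D0' n23.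
  exists e => // v1 v2 v3; rewrite -qform_swap12 -qform_swap23; apply: le_trans (h _ _ _).
  by rewrite le_eqVlt; apply/orP; left; apply/eqP; rewrite /nform; ring.
have [[q12 q13] q23] :=
  (qlen_gt0 k0 c0 hp hq, qlen_gt0 k0 b0 hp hr, qlen_gt0 k0 a0 hq hr).
have C12 := ccosh_ge1 k0 c0 hp hq; have C13 := ccosh_ge1 k0 b0 hp hr.
have C23 := ccosh_ge1 k0 a0 hq hr.
have E12 := qlen_ccosh c hp hq; have E13 := qlen_ccosh b hp hr.
have E23 := qlen_ccosh a hq hr.
have [w12 [w13 w23]] : 0 < wgt k a b c p q r /\ 0 < wgt k a c b p r q /\ 0 < wgt k b c a q r p.
  by split; [|split]; apply: divr_gt0.
rewrite /qform; move: w12 w13 w23 C12 C13 C23 E12 E13 E23 q12 q13 q23.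
move: (wgt k a b c p q r) (wgt k a c b p r q) (wgt k b c a q r p) => w12 w13 w23.
move: (ccosh k c p q) (ccosh k b p r) (ccosh k a q r) => C12 C13 C23.
move: (qlen k c p q) (qlen k b p r) (qlen k a q r) => q12 q13 q23.
move=> w12p w13p w23p C12g C13g C23g E12 E13 E23 q12p q13p q23p.
(* When all three weights are positive, each edge term is coercive by itself, since [C - 1 = k * f]
   with [f = qq / (C + 1)]. *)
have edge (w C qq : R) : 0 < w -> 1 <= C -> k * qq = C ^+ 2 - 1 -> 0 < qq ->
    exists2 e, 0 < e & forall u v, e * ((u - v) ^+ 2 + k * (u ^+ 2 + v ^+ 2))
      <= w * (C * (u ^+ 2 + v ^+ 2) - 2 * u * v).
  move=> w0 C1 E q0; pose f := qq / (C + 1).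
  have f0 : 0 < f by rewrite divr_gt0//; lra.
  have CE : C - 1 = k * f by rewrite /f mulrA E; field; lra.
  exists (w * Num.min 1 f); first by rewrite mulr_gt0// lt_min ltr01.
  move=> u v; rewrite -[leLHS]mulrA ler_pM2l//.
  have -> : C * (u ^+ 2 + v ^+ 2) - 2 * u * v
    = (u - v) ^+ 2 + (C - 1) * (u ^+ 2 + v ^+ 2) by ring.
  rewrite CE mulrDr lerD//.
    by rewrite ler_piMl ?sqr_ge0// ge_min lexx.
  rewrite mulrA ler_wpM2r ?addr_ge0 ?sqr_ge0// mulrC ler_wpM2l//.
  by rewrite ge_min lexx orbT.
have [e1 e10 h1] := edge _ _ _ w12p C12g E12 q12p.
have [e2 e20 h2] := edge _ _ _ w13p C13g E13 q13p.
have [e3 e30 h3] := edge _ _ _ w23p C23g E23 q23p.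
exists (Num.min e1 (Num.min e2 e3)); first by rewrite !lt_min e10 e20 e30.
move=> v1 v2 v3; set e := Num.min _ _.
have l1 : e <= e1 by rewrite ge_min lexx.
have l2 : e <= e2 by rewrite !ge_min lexx orbT.
have l3 : e <= e3 by rewrite !ge_min lexx !orbT.
have e0 : 0 < e by rewrite !lt_min e10 e20 e30.
apply: le_trans (lerD (lerD (h1 v1 v2) (h2 v1 v3)) (h3 v2 v3)).
have m u v : 0 <= (u - v) ^+ 2 + k * (u ^+ 2 + v ^+ 2) by nneg.
have n1 := ler_wpM2r (m v1 v2) l1; have n2 := ler_wpM2r (m v1 v3) l2.
have n3 := ler_wpM2r (m v2 v3) l3.
have n4 : 0 <= e * (k * (v1 ^+ 2 + v2 ^+ 2 + v3 ^+ 2)) by nneg.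
rewrite /nform; lra.
Qed.

End QForm.

(** * Clipped arc cosine and its modulus of continuity *)

Section ArcCosine.
Context {R : realType}.
Implicit Types (x y e : R).

(** Among the subintervals of [0, pi] of length e, the cosine drops least over the two at the ends,
    namely by 1 - cos e. *)
Lemma cos_gap (al be e : R) : 0 <= al -> be <= pi -> 0 <= e -> e <= be - al ->
  1 - cos e <= cos al - cos be.
Proof.
move=> a0 bpi e0 eba.
have inI (t : R) : 0 <= t -> t <= pi -> t \in `[0, pi] by move=> *; rewrite in_itv/=; apply/andP.
have cmono (s t : R) : 0 <= s -> s <= t -> t <= pi -> cos t <= cos s.
  move=> s0 st tpi; rewrite leNgt; apply/negP.
  rewrite ltr_cos ?inI//; try lra.
have h1 : cos be <= cos (al + e) by apply: cmono; lra.
suff : 1 - cos e <= cos al - cos (al + e) by lra.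
have sa : 0 <= sin al by apply: sin_ge0_pi; apply/andP; split; lra.
have se : 0 <= sin e by apply: sin_ge0_pi; apply/andP; split; lra.
have ac : - cos e <= cos al.
  rewrite -[- cos e]cosDpi -cosN; have -> : - (e + pi) = (pi - e) - pi *+ 2 by ring.
  rewrite -(cosD2pi (_ - _)) subrK; apply: cmono; lra.
rewrite cosD.
(* Squared and divided by the left-hand side, this amounts to cos e + cos al >= 0, which is [ac]. *)
suff : (1 - cos e) * (1 - cos al) <= sin al * sin e by lra.
have [ce1 ca1] := (cos_le1 e, cos_le1 al).
rewrite -ler_sqr ?nnegrE ?mulr_ge0 ?subr_ge0// !exprMn !sin2cos2.
have -> : (1 - cos al ^+ 2) * (1 - cos e ^+ 2)
  = ((1 - cos e) * (1 - cos al)) * ((1 + cos e) * (1 + cos al)) by ring.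
rewrite -exprMn expr2 ler_wpM2l ?mulr_ge0 ?subr_ge0//; lra.
Qed.

Definition clip x := Num.max (-1) (Num.min 1 x).
Definition acosc x := acos (clip x).

Lemma clip_in x : -1 <= clip x <= 1.
Proof. by rewrite /clip le_max lexx/= ge_max ge_min lexx andbT; lra. Qed.

Lemma clip_id x : -1 <= x <= 1 -> clip x = x.
Proof. by move=> /andP[x1 x2]; rewrite /clip min_r// max_r. Qed.

Lemma clip_lip x y : `|clip x - clip y| <= `|x - y|.
Proof.
rewrite /clip; have [h1|h1] := leP 1 x; have [h2|h2] := leP 1 y;
  rewrite ?[Num.max (-1) 1]max_r; try lra;
  do ?[have [h3|h3] := leP (-1) x]; do ?[have [h4|h4] := leP (-1) y];
  rewrite ?subrr ?normr0 ?normr_ge0//; rewrite ler_norml; apply/andP; split;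
  have := ler_norm (x - y); have := ler_norm (- (x - y)); rewrite normrN; lra.
Qed.

Lemma acosc_ge0 x : 0 <= acosc x.
Proof. exact: acos_ge0 (clip_in x). Qed.

Lemma acosc_lepi x : acosc x <= pi.
Proof. exact: acos_lepi (clip_in x). Qed.

Lemma acosc_ge1 x : 1 <= x -> acosc x = 0.
Proof. by move=> x1; rewrite /acosc /clip min_l// max_r ?acos1//; lra. Qed.

Lemma acosc_leN1 x : x <= -1 -> acosc x = pi.
Proof. by move=> x1; rewrite /acosc /clip min_r ?max_l ?acosN1//; lra. Qed.

Lemma acosc_unif e : 0 < e ->
  exists2 d, 0 < d & forall x y, `|x - y| < d -> `|acosc x - acosc y| < e.
Proof.
move=> e0; pose h : R := Num.min e pi.
have h0 : 0 < h by rewrite lt_min e0 pi_gt0.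
have hpi : h <= pi by rewrite ge_min lexx orbT.
exists (1 - cos h).
  rewrite subr_gt0 -(cos0 R) ltr_cos// in_itv/= ?lexx ?pi_ge0//.
  by rewrite (ltW h0).
move=> x y xy; rewrite ltNge; apply/negP => eb.
have key u v : h <= acosc v - acosc u -> 1 - cos h <= `|u - v|.
  move=> huv; have := cos_gap (acosc_ge0 u) (acosc_lepi v) (ltW h0) huv.
  rewrite /acosc !acosK ?in_itv/= ?clip_in// => /le_trans; apply.
  exact: le_trans (ler_norm _) (clip_lip _ _).
have he : h <= `|acosc x - acosc y| by apply: le_trans eb; rewrite ge_min lexx.
move: he; case: (ler0P (acosc x - acosc y)) => _ hb.
  by have := key x y; rewrite -opprB => /(_ hb); lra.
by have := key y x hb; rewrite distrC; lra.
Qed.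

Lemma cvg_acosc {T} {F : set_system T} {FF : Filter F} (f : T -> R) l :
  f @ F --> l -> acosc (f x) @[x --> F] --> acosc l.
Proof.
move=> fl; apply/cvgrPdist_lt => e /acosc_unif[d d0 h].
by move/cvgrPdist_lt: fl => /(_ d d0); apply: filterS => t; exact: h.
Qed.

End ArcCosine.

(** * Extended angles and their sum *)

Section TriangleAngles.
Context {R : realType}.
Variable k : R.
Hypothesis k0 : 0 <= k.
Implicit Types (a b c e : R) (p q r : R * R).

(* Clipping the cosine to [-1, 1] gives the extended angle. *)
Definition carg a b c p q r : R :=
  ncos k a b c p q r / (Num.sqrt (qlen k c p q) * Num.sqrt (qlen k b p r)).
Definition tang a b c p q r : R := acosc (carg a b c p q r).

Lemma tangC a b c p q r : tang a b c p q r = tang a c b p r q.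
Proof. by rewrite /tang /carg ncosC [X in _ / X]mulrC. Qed.

Lemma tang_ge0 a b c p q r : 0 <= tang a b c p q r.
Proof. exact: acosc_ge0. Qed.

Lemma tang_lepi a b c p q r : tang a b c p q r <= pi.
Proof. exact: acosc_lepi. Qed.

Section OneTriangle.
Variables (a b c : R) (p q r : R * R).
Hypotheses (a0 : 0 <= a) (b0 : 0 <= b) (c0 : 0 <= c).
Hypotheses (hp : onk k p) (hq : onk k q) (hr : onk k r).

Let q12 := qlen_gt0 k0 c0 hp hq.
Let q13 := qlen_gt0 k0 b0 hp hr.
Let q23 := qlen_gt0 k0 a0 hq hr.
Let s12 : 0 < Num.sqrt (qlen k c p q). Proof. by rewrite sqrtr_gt0. Qed.
Let s13 : 0 < Num.sqrt (qlen k b p r). Proof. by rewrite sqrtr_gt0. Qed.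
Let s23 : 0 < Num.sqrt (qlen k a q r). Proof. by rewrite sqrtr_gt0. Qed.

Lemma carg_sqr :
  carg a b c p q r ^+ 2 = 1 - gram k a b c p q r / (qlen k c p q * qlen k b p r).
Proof.
rewrite /carg expr_div_n exprMn !sqr_sqrtr ?ltW// /gram; field.
by rewrite !gt_eqF.
Qed.

Lemma carg_itv : 0 < gram k a b c p q r -> -1 < carg a b c p q r < 1.
Proof.
move=> D0; rewrite -ltr_norml -(@ltr_pXn2r _ 2)// ?nnegrE//.
rewrite expr1n real_normK ?num_real// carg_sqr ltrBlDr ltrDl.
by rewrite divr_gt0// mulr_gt0.
Qed.

Lemma carg_itvN : gram k a b c p q r <= 0 -> 1 <= `|carg a b c p q r|.
Proof.
move=> D0; rewrite -(@ler_pXn2r _ 2)// ?nnegrE//.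
rewrite expr1n real_normK ?num_real// carg_sqr lerBrDl gerDr.
by rewrite mulr_le0_ge0// invr_ge0 mulr_ge0// ltW.
Qed.

Lemma cos_tang : 0 < gram k a b c p q r -> cos (tang a b c p q r) = carg a b c p q r.
Proof.
by move=> /carg_itv/andP[h1 h2]; rewrite /tang /acosc clip_id ?acosK ?in_itv/= ?(ltW h1) ?(ltW h2).
Qed.

Lemma sin_tang : 0 < gram k a b c p q r ->
  sin (tang a b c p q r) = Num.sqrt (gram k a b c p q r)
    / (Num.sqrt (qlen k c p q) * Num.sqrt (qlen k b p r)).
Proof.
move=> D0; have /andP[h1 h2] := carg_itv D0.
rewrite /tang /acosc clip_id ?(ltW h1) ?(ltW h2)// sin_acos ?(ltW h1) ?(ltW h2)//.
rewrite carg_sqr opprB addrC subrK sqrtrM ?ltW// sqrtrV ?mulr_ge0 ?ltW//.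
by rewrite sqrtrM// ltW.
Qed.

Lemma tang_lt_pi : 0 < gram k a b c p q r -> 0 < tang a b c p q r < pi.
Proof.
move=> D0; have /andP[h1 h2] := carg_itv D0.
rewrite /tang /acosc clip_id ?(ltW h1) ?(ltW h2)//.
by rewrite acos_gt0 ?acos_ltpi ?h1 ?h2 ?(ltW h1) ?(ltW h2).
Qed.

Lemma ncos_add_gt0 : 0 < ncos k a b c p q r + ncos k b a c q p r.
Proof.
have C12 := ccosh_ge1 k0 c0 hp hq; have C13 := ccosh_ge1 k0 b0 hp hr.
have C23 := ccosh_ge1 k0 a0 hq hr; have C1 : 0 < ccosh k c p q + 1 by lra.
by rewrite -(pmulr_rgt0 _ C1) ncos_add// mulr_gt0//; lra.
Qed.

End OneTriangle.

Lemma carg_ge0 a b c p q r : 0 <= b -> 0 <= c -> onk k p -> onk k q -> onk k r ->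
  (0 <= carg a b c p q r) = (0 <= ncos k a b c p q r).
Proof.
move=> b0 c0 hp hq hr; rewrite /carg pmulr_lge0// invr_gt0 mulr_gt0// sqrtr_gt0.
  exact: (qlen_gt0 k0 c0 hp hq).
exact: (qlen_gt0 k0 b0 hp hr).
Qed.

Lemma tang_degenerate a b c p q r : 0 <= a -> 0 <= b -> 0 <= c ->
  onk k p -> onk k q -> onk k r -> gram k a b c p q r <= 0 ->
  tang a b c p q r = if 0 <= ncos k a b c p q r then 0 else pi.
Proof.
move=> a0 b0 c0 hp hq hr D0; rewrite -carg_ge0//.
have := carg_itvN b0 c0 hp hq hr D0; rewrite /tang.
case: (leP 0 (carg a b c p q r)) => h; first by rewrite ger0_norm// => /acosc_ge1.
by rewrite ltr0_norm// => h1; rewrite acosc_leN1//; lra.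
Qed.

Lemma gram3 a b c p q r : onk k p -> onk k q -> onk k r ->
  gram k c a b r p q = gram k a b c p q r.
Proof. by move=> hp hq hr; rewrite (gramC k a b c) (gram_vertex a c b hp hr hq). Qed.

(** The angles are pi, 0 and 0: [ncos_add_gt0] excludes two negative numerators, and the dual cosine
    law, whose right-hand side is nonpositive here, excludes three nonnegative ones. *)
Lemma tang_sum_degenerate a b c p q r : 0 <= a -> 0 <= b -> 0 <= c ->
  onk k p -> onk k q -> onk k r -> gram k a b c p q r <= 0 ->
  tang a b c p q r + tang b a c q p r + tang c a b r p q = pi.
Proof.
move=> a0 b0 c0 hp hq hr D0.
have D2 : gram k b a c q p r <= 0 by rewrite -(gram_vertex a b c hp hq hr).
have D3 : gram k c a b r p q <= 0 by rewrite gram3.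
rewrite !tang_degenerate//.
have n12 := ncos_add_gt0 a0 b0 c0 hp hq hr.
have n13 := ncos_add_gt0 a0 c0 b0 hp hr hq.
have n23 := ncos_add_gt0 b0 c0 a0 hq hr hp.
rewrite (ncosC k a c b) in n13; rewrite (ncosC k b c a) (ncosC k c b a) in n23.
have L := dual_cosine_law a b c hp hq hr.
have q12 := qlen_gt0 k0 c0 hp hq.
have C12 := ccosh_ge1 k0 c0 hp hq.
have {}L : ncos k c a b r p q * qlen k c p q + ncos k a b c p q r * ncos k b a c q p r <= 0.
  by rewrite L mulr_le0_ge0//; lra.
case: (leP 0 (ncos k a b c p q r)) => h1; case: (leP 0 (ncos k b a c q p r)) => h2;
  case: (leP 0 (ncos k c a b r p q)) => h3; rewrite ?addr0 ?add0r//; try lra.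
exfalso.
have e1 := mulr_ge0 h1 h2; have e2 := mulr_ge0 h3 (ltW q12).
have z1 : ncos k c a b r p q * qlen k c p q = 0 by lra.
have z2 : ncos k a b c p q r * ncos k b a c q p r = 0 by lra.
move/eqP: z1; rewrite mulf_eq0 [qlen _ _ _ _ == 0]gt_eqF// orbF => /eqP z1.
move/eqP: z2; rewrite mulf_eq0 => /orP[] /eqP z2; lra.
Qed.

Lemma cos_tangD a b c p q r : 0 <= a -> 0 <= b -> 0 <= c ->
  onk k p -> onk k q -> onk k r -> 0 < gram k a b c p q r ->
  cos (tang a b c p q r + tang b a c q p r)
  = cos (pi - tang c a b r p q)
    + sin (tang a b c p q r) * sin (tang b a c q p r) * (ccosh k c p q - 1).
Proof.
move=> a0 b0 c0 hp hq hr D0.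
have D2 : 0 < gram k b a c q p r by rewrite -(gram_vertex a b c hp hq hr).
have D3 : 0 < gram k c a b r p q by rewrite gram3.
have -> : cos (pi - tang c a b r p q) = - carg c a b r p q.
  by rewrite -cosN opprB cosB cospi sinpi mulr0 addr0 mulrN1 cos_tang.
rewrite cosD !cos_tang// !sin_tang// -(gram_vertex a b c hp hq hr).
have L := dual_cosine_law a b c hp hq hr.
have q12 := qlen_gt0 k0 c0 hp hq.
have s12 : 0 < Num.sqrt (qlen k c p q) by rewrite sqrtr_gt0.
have s13 : 0 < Num.sqrt (qlen k b p r) by rewrite sqrtr_gt0 (qlen_gt0 k0 b0).
have s23 : 0 < Num.sqrt (qlen k a q r) by rewrite sqrtr_gt0 (qlen_gt0 k0 a0).
have e12 : qlen k c p q = Num.sqrt (qlen k c p q) ^+ 2 by rewrite sqr_sqrtr// ltW.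
have eD : gram k a b c p q r = Num.sqrt (gram k a b c p q r) ^+ 2.
  by rewrite sqr_sqrtr// ltW.
rewrite /carg (qlenC k c q p) (qlenC k b r p) (qlenC k a r q).
rewrite {1}eD {1}e12 in L.
move: s12 s13 s23 L; set s := Num.sqrt (qlen k c p q).
move: (Num.sqrt (qlen k b p r)) (Num.sqrt (qlen k a q r)) => s1 s2.
move: (Num.sqrt (gram k a b c p q r)) (ncos k a b c p q r) (ncos k b a c q p r).
move: (ncos k c a b r p q) (ccosh k c p q) => N3 C d N1 N2 sp s1p s2p L.
have -> : N1 / (s * s1) * (N2 / (s * s2)) = (N1 * N2) / (s ^+ 2 * s1 * s2).
  by field; rewrite !gt_eqF.
have -> : N1 * N2 = d ^+ 2 * C - N3 * s ^+ 2 by lra.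
by field; rewrite !gt_eqF.
Qed.

(** The sine of the sum has the sign of the sum of the two numerators, positive by [ncos_add_gt0].
    The bound allows the cosine to be inverted on [0, pi]. *)
Lemma tangD_le_pi a b c p q r : 0 <= a -> 0 <= b -> 0 <= c ->
  onk k p -> onk k q -> onk k r -> 0 < gram k a b c p q r ->
  tang a b c p q r + tang b a c q p r <= pi.
Proof.
move=> a0 b0 c0 hp hq hr D0.
have D2 : 0 < gram k b a c q p r by rewrite -(gram_vertex a b c hp hq hr).
have /andP[t1 t1'] := tang_lt_pi b0 c0 hp hq hr D0.
have /andP[t2 t2'] := tang_lt_pi a0 c0 hq hp hr D2.
rewrite leNgt; apply/negP => h.
have : 0 < sin (tang a b c p q r + tang b a c q p r - pi).
  by apply: sin_gt0_pi; apply/andP; split; lra.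
rewrite sinB cospi sinpi mulr0 subr0 mulrN1 oppr_gt0; apply/negP; rewrite -leNgt.
rewrite sinD !cos_tang// !sin_tang// -(gram_vertex a b c hp hq hr).
have n := ncos_add_gt0 a0 b0 c0 hp hq hr.
rewrite /carg (qlenC k c q p).
set s := Num.sqrt (qlen k c p q); set s1 := Num.sqrt (qlen k b p r).
set s2 := Num.sqrt (qlen k a q r); set d := Num.sqrt (gram k a b c p q r).
set N1 := ncos k a b c p q r; set N2 := ncos k b a c q p r.
have -> : d / (s * s1) * (N2 / (s * s2)) + N1 / (s * s1) * (d / (s * s2))
  = (d * (N1 + N2)) * ((s * s1)^-1 * (s * s2)^-1) by ring.
have n' := ltW n; rewrite mulr_ge0//.
  by rewrite mulr_ge0 ?sqrtr_ge0.
by rewrite mulr_ge0// invr_ge0 mulr_ge0// sqrtr_ge0.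
Qed.

(** By the dual cosine law, cos (A + B) exceeds cos (pi - C) by a nonnegative multiple of
    [ccosh - 1]. *)
Lemma tang_sum_le_pi a b c p q r : 0 <= a -> 0 <= b -> 0 <= c ->
  onk k p -> onk k q -> onk k r ->
  tang a b c p q r + tang b a c q p r + tang c a b r p q <= pi.
Proof.
move=> a0 b0 c0 hp hq hr.
have [D0|D0] := leP (gram k a b c p q r) 0; first by rewrite tang_sum_degenerate.
have h := cos_tangD a0 b0 c0 hp hq hr D0.
have D2 : 0 < gram k b a c q p r by rewrite -(gram_vertex a b c hp hq hr).
have /andP[t1 t1'] := tang_lt_pi b0 c0 hp hq hr D0.
have /andP[t2 t2'] := tang_lt_pi a0 c0 hq hp hr D2.
have t3 := tang_ge0 c a b r p q; have t3' := tang_lepi c a b r p q.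
have s12 := tangD_le_pi a0 b0 c0 hp hq hr D0.
rewrite -lerBrDr leNgt; apply/negP => lt.
have : cos (tang a b c p q r + tang b a c q p r) < cos (pi - tang c a b r p q).
  by rewrite ltr_cos// in_itv/=; apply/andP; split; lra.
rewrite h gtrDl; apply/negP; rewrite -leNgt.
have C12 := ccosh_ge1 k0 c0 hp hq.
rewrite !mulr_ge0// ?subr_ge0//; apply: sin_ge0_pi; apply/andP; split; lra.
Qed.

(** The same excess is at most [ccosh - 1]: the defect is small once one side is short, uniformly in
    the opposite vertex. In Euclidean geometry [ccosh] is 1, so that the condition holds for every e
    and the sum is pi. *)
Lemma tang_sum_ge e : 0 < e -> exists2 d, 0 < d & forall a b c p q r,
  0 <= a -> 0 <= b -> 0 <= c -> onk k p -> onk k q -> onk k r ->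
  ccosh k c p q - 1 < d ->
  pi - e <= tang a b c p q r + tang b a c q p r + tang c a b r p q.
Proof.
move=> e0; pose h : R := Num.min e pi.
have h0 : 0 < h by rewrite lt_min e0 pi_gt0.
have hpi : h <= pi by rewrite ge_min lexx orbT.
have he : h <= e by rewrite ge_min lexx.
exists (1 - cos h).
  rewrite subr_gt0 -(cos0 R) ltr_cos// in_itv/= ?lexx ?pi_ge0//.
  by rewrite (ltW h0).
move=> a b c p q r a0 b0 c0 hp hq hr hC.
have [D0|D0] := leP (gram k a b c p q r) 0.
  by rewrite tang_sum_degenerate//; lra.
have E := cos_tangD a0 b0 c0 hp hq hr D0.
rewrite leNgt; apply/negP => lt.
have t3 := tang_ge0 c a b r p q.
have t1 := tang_ge0 a b c p q r; have t2 := tang_ge0 b a c q p r.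
have t1' := tang_lepi a b c p q r; have t2' := tang_lepi b a c q p r.
have : 1 - cos h <= cos (tang a b c p q r + tang b a c q p r)
                     - cos (pi - tang c a b r p q) by apply: cos_gap; lra.
rewrite E addrAC subrr add0r => h1.
have C12 := ccosh_ge1 k0 c0 hp hq.
have sg a1 b1 c1 p1 q1 r1 : 0 <= sin (tang a1 b1 c1 p1 q1 r1).
  by apply: sin_ge0_pi; rewrite tang_ge0 tang_lepi.
have : sin (tang a b c p q r) * sin (tang b a c q p r) * (ccosh k c p q - 1)
    <= ccosh k c p q - 1.
  rewrite ler_piMl//; first by lra.
lra.
Qed.

End TriangleAngles.

(** * Derivatives of the angles *)

Section TangDerivative.
Context {R : realType}.
Variable k : R.
Hypothesis k0 : 0 <= k.
Implicit Types (a b c e : R) (p q r : R * R).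

Lemma is_derive1_acosc (y : R) : -1 < y < 1 ->
  is_derive y 1 (@acosc R) (- (Num.sqrt (1 - y ^+ 2))^-1).
Proof.
move=> y1; apply: (@near_eq_is_derive _ _ _ (@acos R)).
have /near_in_itvoo : y \in `]-1, 1[ by rewrite in_itv.
apply: filterS => z; rewrite in_itv/= => /andP[z1 z2].
by rewrite /acosc clip_id// (ltW z1) (ltW z2).
Qed.

Lemma is_derive_sqrt_quotient (N A B : R -> R) (s N' A' B' : R) :
  0 < A s -> 0 < B s ->
  is_derive s 1 N N' -> is_derive s 1 A (2 * A') -> is_derive s 1 B (2 * B') ->
  is_derive s 1 (fun t => N t / (Num.sqrt (A t) * Num.sqrt (B t)))
    ((N' - N s * (A' / A s + B' / B s)) / (Num.sqrt (A s) * Num.sqrt (B s))).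
Proof.
move=> A0 B0 dN dA dB.
have sA : 0 < Num.sqrt (A s) by rewrite sqrtr_gt0.
have sB : 0 < Num.sqrt (B s) by rewrite sqrtr_gt0.
have dsA : is_derive s 1 (fun t => Num.sqrt (A t)) ((2 * Num.sqrt (A s))^-1 * (2 * A')).
  by apply: is_derive1_comp; exact: is_derive1_sqrt.
have dsB : is_derive s 1 (fun t => Num.sqrt (B t)) ((2 * Num.sqrt (B s))^-1 * (2 * B')).
  by apply: is_derive1_comp; exact: is_derive1_sqrt.
have dM : is_derive s 1 (fun t => Num.sqrt (A t) * Num.sqrt (B t))
    (Num.sqrt (A s) * ((2 * Num.sqrt (B s))^-1 * (2 * B'))
     + Num.sqrt (B s) * ((2 * Num.sqrt (A s))^-1 * (2 * A'))).
  by apply: is_derive_eq.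
have M0 : Num.sqrt (A s) * Num.sqrt (B s) != 0 by rewrite gt_eqF// mulr_gt0.
have dV := @is_deriveV R (fun t => Num.sqrt (A t) * Num.sqrt (B t)) s _ 1 M0 dM.
apply: is_derive_eq; rewrite /GRing.scale/=.
have eA : A s = Num.sqrt (A s) ^+ 2 by rewrite sqr_sqrtr// ltW.
have eB : B s = Num.sqrt (B s) ^+ 2 by rewrite sqr_sqrtr// ltW.
rewrite [in RHS]eA [in RHS]eB !sqrtr_sqr !ger0_norm ?sqrtr_ge0//.
by field; rewrite !gt_eqF.
Qed.

(* The coordinate u of the circle moves with speed v. *)
Definition moves (v : R) (P : R -> R * R) (s : R) : Prop :=
  is_derive s 1 (fun t => (P t).1) (v * (P s).1 * (P s).2) /\
  is_derive s 1 (fun t => (P t).2) (v * k * (P s).1 ^+ 2).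

Definition dcc c p q u v : R := pder c p q * u + pder c q p * v.

Lemma is_derive_qlen c u v (P Q : R -> R * R) s :
  onk k (P s) -> onk k (Q s) -> moves u P s -> moves v Q s ->
  is_derive s 1 (fun t => qlen k c (P t) (Q t))
    (2 * ccosh k c (P s) (Q s) * dcc c (P s) (Q s) u v).
Proof.
move=> [_ _ eP] [_ _ eQ] [dx dX] [dy dY]; rewrite /qlen /dcc /pder /ccosh.
apply: is_derive_eq; rewrite /GRing.scale/=; move: eP eQ.
move: (P s) (Q s) => [x X] [y Y] /= eP eQ; ring: eP eQ.
Qed.

(** For k = 1, [ncos] is [ccosh b * ccosh c - ccosh a] and [dcc] is the derivative of [ccosh], which
    explains the formula. As a polynomial identity it persists for k = 0, where [ccosh] is
    constant. *)
Lemma is_derive_ncos a b c u v w (P Q S : R -> R * R) s :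
  onk k (P s) -> onk k (Q s) -> onk k (S s) ->
  moves u P s -> moves v Q s -> moves w S s ->
  is_derive s 1 (fun t => ncos k a b c (P t) (Q t) (S t))
    (dcc c (P s) (Q s) u v * ccosh k b (P s) (S s)
     + ccosh k c (P s) (Q s) * dcc b (P s) (S s) u w - dcc a (Q s) (S s) v w).
Proof.
move=> [_ _ eP] [_ _ eQ] [_ _ eS] [dx dX] [dy dY] [dz dZ].
rewrite /ncos /dcc /pder /ccosh.
apply: is_derive_eq; rewrite /GRing.scale/=; move: eP eQ eS.
move: (P s) (Q s) (S s) => [x X] [y Y] [z Z] /= eP eQ eS; ring: eP eQ eS.
Qed.


Lemma is_derive_tang a b c u v w (P Q S : R -> R * R) s :
  0 <= b -> 0 <= c ->
  onk k (P s) -> onk k (Q s) -> onk k (S s) ->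
  moves u P s -> moves v Q s -> moves w S s -> 0 < gram k a b c (P s) (Q s) (S s) ->
  is_derive s 1 (fun t => tang k a b c (P t) (Q t) (S t))
    ((dcc a (Q s) (S s) v w
      - ncos k b a c (Q s) (P s) (S s) * dcc c (P s) (Q s) u v / qlen k c (P s) (Q s)
      - ncos k c a b (S s) (P s) (Q s) * dcc b (P s) (S s) u w / qlen k b (P s) (S s))
     / Num.sqrt (gram k a b c (P s) (Q s) (S s))).
Proof.
move=> b0 c0 hP hQ hS mP mQ mS D0.
have q12 := qlen_gt0 k0 c0 hP hQ; have q13 := qlen_gt0 k0 b0 hP hS.
have s12 : 0 < Num.sqrt (qlen k c (P s) (Q s)) by rewrite sqrtr_gt0.
have s13 : 0 < Num.sqrt (qlen k b (P s) (S s)) by rewrite sqrtr_gt0.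
have sD : 0 < Num.sqrt (gram k a b c (P s) (Q s) (S s)) by rewrite sqrtr_gt0.
have dN := is_derive_ncos a b c hP hQ hS mP mQ mS.
have dA := is_derive_qlen c hP hQ mP mQ; have dB := is_derive_qlen b hP hS mP mS.
rewrite -[2 * _ * _]mulrA in dA; rewrite -[2 * _ * _]mulrA in dB.
have dc := @is_derive_sqrt_quotient (fun t => ncos k a b c (P t) (Q t) (S t))
  (fun t => qlen k c (P t) (Q t)) (fun t => qlen k b (P t) (S t)) s _ _ _ q12 q13 dN dA dB.
have yI := carg_itv k0 b0 c0 hP hQ hS D0.
have da := is_derive1_acosc yI.
have d := @is_derive1_comp R _ (fun t => carg k a b c (P t) (Q t) (S t)) s _ _ da dc; rewrite /comp in d; apply: (is_derive_eq d).
rewrite carg_sqr// opprB addrC subrK sqrtrM ?ltW// sqrtrV ?mulr_ge0 ?ltW//.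
rewrite sqrtrM ?ltW//.
have I9 := ncos_ccosh a b c hP hQ hS.
have I9' := ncos_ccosh a c b hP hS hQ; rewrite (ncosC k a c b) in I9'.
have -> : ncos k b a c (Q s) (P s) (S s) = qlen k c (P s) (Q s) * ccosh k b (P s) (S s)
  - ccosh k c (P s) (Q s) * ncos k a b c (P s) (Q s) (S s) by lra.
have -> : ncos k c a b (S s) (P s) (Q s) = qlen k b (P s) (S s) * ccosh k c (P s) (Q s)
  - ccosh k b (P s) (S s) * ncos k a b c (P s) (Q s) (S s) by lra.
by field; rewrite !gt_eqF.
Qed.

Lemma qform_tang a b c u v w p q r :
  0 <= a -> 0 <= b -> 0 <= c -> onk k p -> onk k q -> onk k r ->
  u * (dcc a q r v w - ncos k b a c q p r * dcc c p q u v / qlen k c p q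
       - ncos k c a b r p q * dcc b p r u w / qlen k b p r)
  + v * (dcc b p r u w - ncos k a b c p q r * dcc c q p v u / qlen k c q p
       - ncos k c b a r q p * dcc a q r v w / qlen k a q r)
  + w * (dcc c p q u v - ncos k a c b p r q * dcc b r p w u / qlen k b r p
       - ncos k b c a q r p * dcc a r q w v / qlen k a r q)
  = - qform k a b c p q r u v w.
Proof.
move=> a0 b0 c0 hp hq hr.
have [[q12 q13] q23] :=
  (qlen_gt0 k0 c0 hp hq, qlen_gt0 k0 b0 hp hr, qlen_gt0 k0 a0 hq hr).
have f12 := wgtE k0 a b c0 hp hq hr; have f21 := wgtE k0 b a c0 hq hp hr.
have f13 := wgtE k0 a c b0 hp hr hq; have f31 := wgtE k0 c a b0 hr hp hq.
have f23 := wgtE k0 b c a0 hq hr hp; have f32 := wgtE k0 c b a0 hr hq hp.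
rewrite (wgtC k b a c) (qlenC k c q p) in f21.
rewrite (wgtC k c a b) (qlenC k b r p) in f31.
rewrite (wgtC k c b a) (qlenC k a r q) in f32.
have g1 := wgt_diag k0 a b0 c0 hp hq hr.
have g2 := wgt_diag k0 b a0 c0 hq hp hr.
have g3 := wgt_diag k0 c a0 b0 hr hp hq.
rewrite (wgtC k b a c) (ccoshC k c q p) in g2.
rewrite (wgtC k c a b) (wgtC k c b a) (ccoshC k b r p) (ccoshC k a r q) in g3.
rewrite (ncosC k a c b) in f13; rewrite (ncosC k b c a) in f23 g3.
rewrite (ncosC k c b a) in f32 g2; rewrite (ncosC k a c b) in g3.
rewrite (qlenC k c q p) in g2; rewrite (qlenC k b r p) (qlenC k a r q) in g3.
have -> : qform k a b c p q r u v w
  = u ^+ 2 * (wgt k a b c p q r * ccosh k c p q + wgt k a c b p r q * ccosh k b p r)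
  + v ^+ 2 * (wgt k a b c p q r * ccosh k c p q + wgt k b c a q r p * ccosh k a q r)
  + w ^+ 2 * (wgt k a c b p r q * ccosh k b p r + wgt k b c a q r p * ccosh k a q r)
  - u * v * (wgt k a b c p q r + wgt k a b c p q r)
  - u * w * (wgt k a c b p r q + wgt k a c b p r q)
  - v * w * (wgt k b c a q r p + wgt k b c a q r p).
  by rewrite /qform; ring.
rewrite g1 g2 g3 {1}f12 f21 {1}f13 f31 {1}f23 f32 /dcc.
rewrite (qlenC k c q p) (qlenC k b r p) (qlenC k a r q) (ncosC k c b a) (ncosC k a c b) (ncosC k b c a).
by field; rewrite !gt_eqF.
Qed.

End TangDerivative.

(** * Decrease of a function that is differentiable off finitely many values *)

Section PiecewiseMonotone.
Context {R : realType}.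

Lemma avoid_finite (vs : seq R) (l h : R) : l < h ->
  exists2 y, l < y < h & y \notin vs.
Proof.
elim: vs l h => [|v vs ih] l h lh; first by exists ((l + h) / 2) => //; lra.
have [vm|vm] := leP v ((l + h) / 2).
  have [|y yI yv] := ih ((l + h) / 2) h.
    by lra.
  exists y; first by move: yI; lra.
  by rewrite inE negb_or yv andbT gt_eqF//; move: yI; lra.
have [|y yI yv] := ih l ((l + h) / 2).
  by lra.
exists y; first by move: yI; lra.
by rewrite inE negb_or yv andbT lt_eqF//; move: yI; lra.
Qed.

Lemma le_of_derive_le0 (f f' : R -> R) (a b : R) : a <= b ->
  {within `[a, b], continuous f} ->
  (forall s, a < s < b -> is_derive s 1 f (f' s)) ->
  (forall s, a < s < b -> f' s <= 0) -> f b <= f a.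
Proof.
rewrite le_eqVlt => /predU1P[->//|ab] cf df f0.
have df' s : s \in `]a, b[ -> is_derive s 1 f (f' s) by rewrite in_itv; exact: df.
have [s + E] := MVT ab df' cf; rewrite in_itv/= => /f0 f's.
by rewrite -subr_le0 E mulr_le0_ge0// subr_ge0 ltW.
Qed.

Lemma nonincreasing_of_derive (f f' : R -> R) (a b : R) : a <= b ->
  (forall s, a <= s <= b -> is_derive s 1 f (f' s)) ->
  (forall s, a <= s <= b -> f' s <= 0) -> f b <= f a.
Proof.
move=> ab df f0; apply: (@le_of_derive_le0 f f') => //.
- apply: derivable_within_continuous => x; rewrite in_itv/= => xI.
  by have [] := df x xI.
- by move=> s /andP[sa sb]; apply: df; rewrite !ltW.
- by move=> s /andP[sa sb]; apply: f0; rewrite !ltW.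
Qed.

(* A point where [f] last takes a value [y] outside the finite set lies in the
   region where [f] does not increase. *)
Lemma nonincreasing_off_finite (f f' : R -> R) (U : set R) (vs : seq R) (a b : R) :
  a <= b ->
  (forall s, a <= s <= b -> {for s, continuous f}) ->
  (forall s, a <= s <= b -> U s \/ f s \in vs) ->
  (forall s, a <= s <= b -> U s -> \forall t \near s, U t) ->
  (forall s, U s -> is_derive s 1 f (f' s)) -> (forall s, U s -> f' s <= 0) ->
  f b <= f a.
Proof.
move=> ab cf fU oU df f0; rewrite leNgt; apply/negP => /(avoid_finite vs)[y /andP[ay yb] yvs].
pose S := [set x | a <= x <= b /\ f x <= y].
have Sa : S a by split; [rewrite lexx|exact: ltW].
have ubS : ubound S b by move=> x [/andP[]].
have hS : has_sup S by split; [exists a|exists b].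
have x0a : a <= sup S by apply: sup_upper_bound.
have x0b : sup S <= b by apply: ge_sup => //; exists a.
set x0 := sup S in x0a x0b.
have x0I : a <= x0 <= b by rewrite x0a.
have fx0 : f x0 <= y.
  rewrite leNgt; apply/negP => lt.
  have := cf x0 x0I => /(@cvgr_gt R R _ _ f (f x0)) /(_ y lt) [e /= e0 he].
  have [x [Sx xS]] : exists x, S x /\ x0 - e < x.
    by have [x Sx xS] := sup_adherent e0 hS; exists x.
  have xx0 : x <= x0 by apply: sup_upper_bound.
  have : y < f x by apply: he; rewrite /= ger0_norm; lra.
  by case: Sx => _; lra.
have x0b' : x0 < b by rewrite lt_neqAle x0b andbT; apply/eqP => E; move: fx0; rewrite E; lra.
have out x : x0 < x -> x <= b -> y < f x.
  move=> xx xb; rewrite ltNge; apply/negP => fy.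
  have : x <= x0 by apply: sup_upper_bound => //; split=> //; lra.
  lra.
have yx0 : y <= f x0.
  rewrite leNgt; apply/negP => lt.
  have := cf x0 x0I => /(@cvgr_lt R R _ _ f (f x0)) /(_ y lt) [e /= e0 he].
  pose x := Num.min b (x0 + e / 2).
  have xb : x <= b by rewrite ge_min lexx.
  have xe : x <= x0 + e / 2 by rewrite ge_min lexx orbT.
  have xx : x0 < x by rewrite lt_min x0b'; lra.
  have : f x < y by apply: he; rewrite /= ler0_norm; lra.
  by have := out x xx xb; lra.
have Ux0 : U x0.
  case: (fU x0 x0I) => // fin; exfalso; move/negP: yvs; apply.
  by have -> : y = f x0 by apply/eqP; rewrite eq_le yx0.
have [e /= e0 he] := oU x0 x0I Ux0.
pose x := Num.min b (x0 + e / 2).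
have xb : x <= b by rewrite ge_min lexx.
have xe : x <= x0 + e / 2 by rewrite ge_min lexx orbT.
have xx : x0 < x by rewrite lt_min x0b'; lra.
have Us s : x0 <= s <= x -> U s.
  by move=> sI; apply: he; rewrite /= ler0_norm; lra.
have : f x <= f x0.
  by apply: (@nonincreasing_of_derive f f'); [exact: ltW|move=> s /Us; exact: df|move=> s /Us; exact: f0].
by have := out x xx xb; lra.
Qed.

End PiecewiseMonotone.

(** * Logarithmic coordinates common to both geometries *)

Section Coordinates.
Context {R : realType}.
Variable bg : background.
Implicit Types s t u v w : R.

Definition kap : R := if bg is Hyperbolic then 1 else 0.

(* In terms of s = scale r = exp u, a radius is any s with [dom s], and
   [pt s] is the pair encoding the circle. *)
Definition pt s : R * R :=
  if bg is Hyperbolic then (2 * s / (1 - s ^+ 2), (1 + s ^+ 2) / (1 - s ^+ 2))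
  else (s, 1).

Definition dom s := (0 < s) && (kap * s < 1).

Lemma kap_ge0 : 0 <= kap. Proof. by rewrite /kap; case: bg. Qed.

Lemma dom_gt0 s : dom s -> 0 < s. Proof. by case/andP. Qed.

Lemma dom_den s : 0 <= s -> kap * s < 1 -> bg = Hyperbolic -> 0 < 1 - s ^+ 2.
Proof.
by rewrite /kap => s0 + E; rewrite E mul1r subr_gt0 expr_lt1.
Qed.

Lemma onk_pt s : dom s -> onk kap (pt s).
Proof.
case/andP=> s0 s1; have h := dom_den (ltW s0) s1.
rewrite /pt /onk; move: h s1; rewrite /kap; case: bg => [_ _|/(_ erefl) d0 s1] /=.
  by split=> //; rewrite mul0r addr0 expr1n.
split; first by rewrite divr_gt0// mulr_gt0.
  by rewrite ler_pdivlMr// mul1r; have := sqr_ge0 s; lra.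
by rewrite mul1r; field; rewrite gt_eqF.
Qed.

Lemma moves_pt s v (t : R) : dom (s * expR (t * v)) ->
  moves kap v (fun t => pt (s * expR (t * v))) t.
Proof.
case/andP=> s0 s1; have h := dom_den (ltW s0) s1.
rewrite /moves /pt; move: h s1; rewrite /kap; case: bg => [_ _|/(_ erefl) d0 s1] /=.
  by split; apply: is_derive_eq; rewrite /GRing.scale/=; ring.
have de : is_derive t 1 (fun t => s * expR (t * v)) (v * (s * expR (t * v))).
  by apply: is_derive_eq; rewrite /GRing.scale/=; ring.
set f := (fun t => s * expR (t * v)) in de.
have dd : is_derive t 1 (fun t => 1 - f t ^+ 2) (- (2 * v * f t ^+ 2)).
  by apply: is_derive_eq; rewrite /GRing.scale/= /f; ring.
have dV := @is_deriveV R (fun t => 1 - f t ^+ 2) t _ 1 (lt0r_neq0 d0) dd.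
split.
  rewrite -[fun t => _]/(fun t => 2 * f t * (1 - f t ^+ 2)^-1).
  apply: is_derive_eq; rewrite /GRing.scale/= -/(f t).
  by field; rewrite gt_eqF.
rewrite -[fun t => _]/(fun t => (1 + f t ^+ 2) * (1 - f t ^+ 2)^-1).
apply: is_derive_eq; rewrite /GRing.scale/= -/(f t).
by field; rewrite gt_eqF.
Qed.

(** [s * expR (t * v)] is monotone in t, hence bounded by its value at one of the two ends. *)
Lemma dom_ray s v (t l : R) : dom s -> dom (s * expR (l * v)) -> 0 <= t <= l ->
  dom (s * expR (t * v)).
Proof.
case/andP=> s0 s1 /andP[_ sl] /andP[t0 tl].
rewrite /dom mulr_gt0 ?expR_gt0//=.
have k0 := kap_ge0; have ks : 0 <= kap * s by rewrite mulr_ge0// ltW.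
have [v0|v0] := leP 0 v.
  apply: le_lt_trans sl; rewrite !mulrA ler_wpM2l// ler_expR.
  by rewrite ler_wpM2r.
apply: le_lt_trans s1; rewrite mulrA ler_piMr// -expR0 ler_expR.
by rewrite mulr_ge0_le0// ltW.
Qed.

Lemma near_dom {T} {F : set_system T} {FF : Filter F} (f : T -> R) s :
  dom s -> f @ F --> s -> \forall t \near F, dom (f t).
Proof.
case/andP=> s0 s1 fs.
have f0 : \forall t \near F, 0 < f t by exact: cvgr_gt fs _ s0.
have [k0|kp] := eqVneq kap 0.
  by apply: filterS f0 => t ft; rewrite /dom ft k0 mul0r ltr01.
have k0 : 0 < kap by rewrite lt_neqAle eq_sym kp kap_ge0.
have : \forall t \near F, f t < kap^-1.
  by apply: cvgr_lt fs _ _; rewrite -(ltr_pM2l k0) divff.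
by apply: filterS2 f0 => t f1 f2; rewrite /dom f1 -(divff kp) ltr_pM2l.
Qed.

End Coordinates.

Section ArithmeticLimits.
Context {R : realType} {T : Type} {F : set_system T} {FF : Filter F}.
Lemma cvgDf (f g : T -> R) (a b : R) :
  f @ F --> a -> g @ F --> b -> f t + g t @[t --> F] --> a + b.
Proof. exact: cvgD. Qed.

Lemma cvgBf (f g : T -> R) (a b : R) :
  f @ F --> a -> g @ F --> b -> f t - g t @[t --> F] --> a - b.
Proof. exact: cvgB. Qed.

Lemma cvgMf (f g : T -> R) (a b : R) :
  f @ F --> a -> g @ F --> b -> f t * g t @[t --> F] --> a * b.
Proof. exact: cvgM. Qed.

Lemma cvgX2f (f : T -> R) (l : R) : f @ F --> l -> f t ^+ 2 @[t --> F] --> l ^+ 2.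
Proof. by move=> fl; rewrite expr2; apply: cvgM. Qed.

Lemma cvgVf (f : T -> R) (l : R) : l != 0 -> f @ F --> l -> (f t)^-1 @[t --> F] --> l^-1.
Proof. exact: cvgV. Qed.

End ArithmeticLimits.

Ltac cvg_arith :=
  lazymatch goal with
  | |- cvg_to _ (nbhs (_ - _)) => apply: cvgBf; cvg_arith
  | |- cvg_to _ (nbhs (_ + _)) => apply: cvgDf; cvg_arith
  | |- cvg_to _ (nbhs (_ * _)) => apply: cvgMf; cvg_arith
  | |- cvg_to _ (nbhs (_ ^+ 2)) => apply: cvgX2f; cvg_arith
  | |- _ => first [ assumption | exact: cvg_cst ]
  end.

Section Limits.
Context {R : realType} {T : Type} {F : set_system T} {FF : Filter F}.
Implicit Types (P Q S : T -> R * R) (p q r : R * R).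

Definition cvg2 P p := (P t).1 @[t --> F] --> p.1 /\ (P t).2 @[t --> F] --> p.2.

Lemma cvg_qlen k c P Q p q : cvg2 P p -> cvg2 Q q ->
  qlen k c (P t) (Q t) @[t --> F] --> qlen k c p q.
Proof. by move=> [? ?] [? ?]; rewrite /qlen; cvg_arith. Qed.

Lemma cvg_ccosh k c P Q p q : cvg2 P p -> cvg2 Q q ->
  ccosh k c (P t) (Q t) @[t --> F] --> ccosh k c p q.
Proof. by move=> [? ?] [? ?]; rewrite /ccosh; cvg_arith. Qed.

Lemma cvg_ncos k a b c P Q S p q r : cvg2 P p -> cvg2 Q q -> cvg2 S r ->
  ncos k a b c (P t) (Q t) (S t) @[t --> F] --> ncos k a b c p q r.
Proof. by move=> [? ?] [? ?] [? ?]; rewrite /ncos; cvg_arith. Qed.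

Lemma cvg_nwgt a b c P Q S p q r : cvg2 P p -> cvg2 Q q -> cvg2 S r ->
  nwgt a b c (P t) (Q t) (S t) @[t --> F] --> nwgt a b c p q r.
Proof. by move=> [? ?] [? ?] [? ?]; rewrite /nwgt; cvg_arith. Qed.

Lemma cvg_gram k a b c P Q S p q r : cvg2 P p -> cvg2 Q q -> cvg2 S r ->
  gram k a b c (P t) (Q t) (S t) @[t --> F] --> gram k a b c p q r.
Proof.
move=> hP hQ hS; rewrite /gram; apply: cvgB; first by apply: cvgM; exact: cvg_qlen.
exact/cvgX2f/cvg_ncos.
Qed.

Lemma cvg_tang k a b c P Q S p q r :
  0 < qlen k c p q -> 0 < qlen k b p r -> cvg2 P p -> cvg2 Q q -> cvg2 S r ->
  tang k a b c (P t) (Q t) (S t) @[t --> F] --> tang k a b c p q r.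
Proof.
move=> q12 q13 hP hQ hS; apply: cvg_acosc; rewrite /carg.
apply: cvgM; first exact: cvg_ncos.
apply: cvgV; first by rewrite gt_eqF// mulr_gt0// sqrtr_gt0.
by apply: cvgM; (apply: continuous_cvg; [exact: sqrt_continuous|exact: cvg_qlen]).
Qed.

Lemma cvg_pt bg (f : T -> R) s : 0 <= s -> kap bg * s < 1 -> f @ F --> s ->
  cvg2 (fun t => pt bg (f t)) (pt bg s).
Proof.
move=> s0 s1 fs; have := dom_den s0 s1.
rewrite /cvg2 /pt; case: bg {s1} => [_|/(_ erefl) d0]/=; first by split=> //; exact: cvg_cst.
have d : (1 - f t ^+ 2)^-1 @[t --> F] --> (1 - s ^+ 2)^-1.
  by apply: cvgV; [rewrite gt_eqF|cvg_arith].
by split; cvg_arith.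
Qed.

End Limits.

(** * Monotonicity of the angles of a face along a ray *)

Section Ray.
Context {R : realType}.
Variables (bg : background) (a b c : R).
Hypotheses (a0 : 0 <= a) (b0 : 0 <= b) (c0 : 0 <= c).
Let k : R := kap bg.
Let k0 : 0 <= k. Proof. exact: kap_ge0. Qed.

(** Uses [wgt * (ccosh - 1) = k * nwgt / (ccosh + 1)]. The squares that remain are those of [nform],
    so a small change of the coefficients costs a small multiple of [nform]. *)
Lemma qformE p q r (v1 v2 v3 : R) : onk k p -> onk k q -> onk k r ->
  qform k a b c p q r v1 v2 v3 =
    wgt k a b c p q r * (v1 - v2) ^+ 2 + wgt k a c b p r q * (v1 - v3) ^+ 2
    + wgt k b c a q r p * (v2 - v3) ^+ 2
    + k * (nwgt a b c p q r / (ccosh k c p q + 1) * (v1 ^+ 2 + v2 ^+ 2)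
           + nwgt a c b p r q / (ccosh k b p r + 1) * (v1 ^+ 2 + v3 ^+ 2)
           + nwgt b c a q r p / (ccosh k a q r + 1) * (v2 ^+ 2 + v3 ^+ 2)).
Proof.
move=> hp hq hr.
have E (C q' n u v : R) : 0 < q' -> 1 <= C -> k * q' = C ^+ 2 - 1 ->
  n / q' * (C * (u ^+ 2 + v ^+ 2) - 2 * u * v)
  = n / q' * (u - v) ^+ 2 + k * (n / (C + 1) * (u ^+ 2 + v ^+ 2)).
  move=> qp C1 e; have -> : C = 1 + k * q' / (C + 1) by rewrite e; field; lra.
  have h : k * q' / (C + 1) = C - 1 by rewrite e; field; lra.
  rewrite !h; have -> : k * (n / (1 + (C - 1) + 1) * (u ^+ 2 + v ^+ 2))
    = (k * q' / (C + 1)) * (n / q' * (u ^+ 2 + v ^+ 2)).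
    by field; rewrite gt_eqF//=; lra.
  by rewrite h; ring.
rewrite /qform /wgt !E.
all: try exact: qlen_gt0.
all: try exact: ccosh_ge1.
all: try exact: qlen_ccosh.
ring.
Qed.

Variables (x y z : R).
Hypotheses (hx : dom bg x) (hy : dom bg y) (hz : dom bg z).
Hypothesis D0 : 0 < gram k a b c (pt bg x) (pt bg y) (pt bg z).

Lemma cvg_pt_dom {T} {F : set_system T} {FF : Filter F} (f : T -> R) s :
  dom bg s -> f @ F --> s -> cvg2 (F := F) (fun t => pt bg (f t)) (pt bg s).
Proof. by case/andP=> s0 s1; apply: cvg_pt => //; exact: ltW. Qed.

(** Coercivity at one nondegenerate triangle persists on a box around it, by continuity of the
    coefficients of [qformE]. The factor [Num.sqrt (gram ..)] is the one that divides the form in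
    the derivative of [ray_sum]. *)
Lemma local_coercive : exists rho e, [/\ 0 < rho, 0 < e & forall u v w,
  `|u| <= rho -> `|v| <= rho -> `|w| <= rho ->
  let p := pt bg (x * expR u) in let q := pt bg (y * expR v) in
  let r := pt bg (z * expR w) in
  [/\ dom bg (x * expR u), dom bg (y * expR v), dom bg (z * expR w),
      0 < gram k a b c p q r &
      forall v1 v2 v3, e * nform k v1 v2 v3 * Num.sqrt (gram k a b c p q r)
        <= qform k a b c p q r v1 v2 v3]].
Proof.
have [hp [hq hr]] := (onk_pt hx, (onk_pt hy, onk_pt hz)).
have [e0 e00 he0] := qform_coercive k0 a0 b0 c0 hp hq hr D0.
pose F := nbhs ((0, 0, 0) : R * R * R).
have FF : ProperFilter F by apply: nbhs_pfilter.
have FF' : Filter F by exact: filter_filter.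
have cvgexp (s : R) (f : R * R * R -> R) : f @ F --> (0 : R) -> s * expR (f t) @[t --> F] --> s.
  move=> f0; rewrite -[X in _ --> X]mulr1; apply: cvgMf; first exact: cvg_cst.
  by rewrite -expR0; apply: continuous_cvg => //; exact: continuous_expR.
have f1 : (fun t : R * R * R => t.1.1) @ F --> (0 : R).
  apply: (@cvg_comp _ _ _ (@fst (R*R) R) (@fst R R)); exact: cvg_fst.
have f2 : (fun t : R * R * R => t.1.2) @ F --> (0 : R).
  apply: (@cvg_comp _ _ _ (@fst (R*R) R) (@snd R R)); [exact: cvg_fst|exact: cvg_snd].
have f3 : (fun t : R * R * R => t.2) @ F --> (0 : R) by exact: cvg_snd.
pose P (t : R * R * R) := pt bg (x * expR t.1.1).
pose Q (t : R * R * R) := pt bg (y * expR t.1.2).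
pose S (t : R * R * R) := pt bg (z * expR t.2).
have cP : cvg2 (F := F) P (pt bg x) by apply: cvg_pt_dom; rewrite //; exact: cvgexp.
have cQ : cvg2 (F := F) Q (pt bg y) by apply: cvg_pt_dom; rewrite //; exact: cvgexp.
have cS : cvg2 (F := F) S (pt bg z) by apply: cvg_pt_dom; rewrite //; exact: cvgexp.
have dx : \forall t \near F, dom bg (x * expR t.1.1).
  by apply: (near_dom hx); exact: cvgexp.
have dy : \forall t \near F, dom bg (y * expR t.1.2).
  by apply: (near_dom hy); exact: cvgexp.
have dz : \forall t \near F, dom bg (z * expR t.2).
  by apply: (near_dom hz); exact: cvgexp.
have cg : gram k a b c (P t) (Q t) (S t) @[t --> F] --> gram k a b c (pt bg x) (pt bg y) (pt bg z).
  exact: cvg_gram.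
have gp : \forall t \near F, 0 < gram k a b c (P t) (Q t) (S t) by exact: cvgr_gt cg _ D0.
have gs : \forall t \near F, gram k a b c (P t) (Q t) (S t)
    < gram k a b c (pt bg x) (pt bg y) (pt bg z) + 1.
  by apply: cvgr_lt cg _ _; rewrite ltrDl.
(* A tolerance of [e0 / 4] on each coefficient costs at most half of [e0]: the square of each
   coordinate occurs in two edge terms. *)
have wnear A B C P1 Q1 S1 p1 q1 r1 : 0 <= C -> onk k p1 -> onk k q1 ->
    cvg2 (F := F) P1 p1 -> cvg2 (F := F) Q1 q1 -> cvg2 (F := F) S1 r1 ->
    \forall t \near F, `|wgt k A B C (P1 t) (Q1 t) (S1 t) - wgt k A B C p1 q1 r1| < e0 / 4
      /\ `|nwgt A B C (P1 t) (Q1 t) (S1 t) / (ccosh k C (P1 t) (Q1 t) + 1)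
          - nwgt A B C p1 q1 r1 / (ccosh k C p1 q1 + 1)| < e0 / 4.
  move=> C0 hp1 hq1 c1 c2 c3; have e4 : 0 < e0 / 4 by lra.
  have cw : wgt k A B C (P1 t) (Q1 t) (S1 t) @[t --> F] --> wgt k A B C p1 q1 r1.
    apply: cvgMf; first exact: cvg_nwgt.
    by apply: cvgVf; [rewrite gt_eqF// qlen_gt0|exact: cvg_qlen].
  have cb : nwgt A B C (P1 t) (Q1 t) (S1 t) / (ccosh k C (P1 t) (Q1 t) + 1) @[t --> F]
      --> nwgt A B C p1 q1 r1 / (ccosh k C p1 q1 + 1).
    apply: cvgMf; first exact: cvg_nwgt.
    apply: cvgVf; first by have := ccosh_ge1 k0 C0 hp1 hq1 => h; rewrite gt_eqF//; lra.
    by apply: cvgDf; [exact: cvg_ccosh|exact: cvg_cst].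
  move/cvgrPdist_lt: cw => /(_ _ e4); move/cvgrPdist_lt: cb => /(_ _ e4).
  by apply: filterS2 => t h1 h2; rewrite !(distrC _ (_ p1 _ _)) distrC; split; rewrite // distrC.
have w12 := wnear a b c P Q S _ _ _ c0 hp hq cP cQ cS.
have w13 := wnear a c b P S Q _ _ _ b0 hp hr cP cS cQ.
have w23 := wnear b c a Q S P _ _ _ a0 hq hr cQ cS cP.
have FI := @filterI _ F FF'.
have near_all := FI _ _ dx (FI _ _ dy (FI _ _ dz (FI _ _ gp (FI _ _ gs (FI _ _ w12 (FI _ _ w13 w23)))))).
have /nbhs_ballP[d /= d0 hd] : nbhs ((0, 0, 0) : R * R * R) _ := near_all.
have D0' := D0; set G := gram k a b c (pt bg x) (pt bg y) (pt bg z) in D0' gs hd.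
have S0 : 0 < Num.sqrt (G + 1) by rewrite sqrtr_gt0; lra.
exists (d / 2), (e0 / 2 / Num.sqrt (G + 1)); split; [lra|by pos|move=> u v w hu hv hw].
set p := pt bg (x * _); set q := pt bg (y * _); set r := pt bg (z * _).
have [|hdx [hdy [hdz [hg [hG [[h1 h1'] [[h2 h2'] [h3 h3']]]]]]]] := hd (u, v, w).
  by split; first split; rewrite /ball/= sub0r normrN; lra.
rewrite /= in hdx hdy hdz; split=> // v1 v2 v3.
have sG : Num.sqrt (gram k a b c p q r) <= Num.sqrt (G + 1) by rewrite ler_wsqrtr// ltW.
have n0 := nform_ge0 k0 v1 v2 v3.
apply: le_trans (_ : e0 / 2 * nform k v1 v2 v3 <= _).
  set n := nform _ _ _ _ in n0 *; set g := Num.sqrt _ in sG *.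
  have -> : e0 / 2 / Num.sqrt (G + 1) * n * g = e0 / 2 * n * (g / Num.sqrt (G + 1)).
    by ring.
  rewrite ler_piMr ?mulr_ge0 ?divr_ge0 ?(ltW e00)//.
  by rewrite ler_pdivrMr// mul1r.
have H := he0 v1 v2 v3; move: H.
rewrite !qformE//; [|exact: onk_pt..].
move: h1 h1' h2 h2' h3 h3'; rewrite /P /Q /S /= -/p -/q -/r.
move: (wgt k a b c p q r) (wgt k a c b p r q) (wgt k b c a q r p).
move: (nwgt a b c p q r / _) (nwgt a c b p r q / _) (nwgt b c a q r p / _).
move: (wgt k a b c _ _ _) (wgt k a c b _ _ _) (wgt k b c a _ _ _).
move: (nwgt a b c _ _ _ / _) (nwgt a c b _ _ _ / _) (nwgt b c a _ _ _ / _).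
move=> B12 B13 B23 A12 A13 A23 b12 b13 b23 a12 a13 a23.
have lo (A' A'' X : R) : `|A'' - A'| < e0 / 4 -> 0 <= X -> A' * X - e0 / 4 * X <= A'' * X.
  rewrite ltr_norml => /andP[h _] X0; rewrite -mulrBl ler_wpM2r//; lra.
move=> /lo h1 /lo h1' /lo h2 /lo h2' /lo h3 /lo h3'.
have s12 := sqr_ge0 (v1 - v2); have s13 := sqr_ge0 (v1 - v3).
have s23 := sqr_ge0 (v2 - v3).
have t12 := addr_ge0 (sqr_ge0 v1) (sqr_ge0 v2).
have t13 := addr_ge0 (sqr_ge0 v1) (sqr_ge0 v3).
have t23 := addr_ge0 (sqr_ge0 v2) (sqr_ge0 v3).
have {}h1 := h1 _ s12; have {}h2 := h2 _ s13; have {}h3 := h3 _ s23.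
have {}h1' := ler_wpM2l k0 (h1' _ t12); have {}h2' := ler_wpM2l k0 (h2' _ t13).
have {}h3' := ler_wpM2l k0 (h3' _ t23).
move: n0 => /(ler_wpM2l (ltW e00)); rewrite mulr0.
rewrite /nform => n0 H.
have := mulr_ge0 (ltW e00) s12; have := mulr_ge0 (ltW e00) s13.
have := mulr_ge0 (ltW e00) s23.
lra.
Qed.

End Ray.

Definition sang {R : realType} (bg : background) (a b c x y z : R) : R :=
  tang (kap bg) a b c (pt bg x) (pt bg y) (pt bg z).

Section RayMonotone.
Context {R : realType}.
Variables (bg : background) (a b c : R).
Hypotheses (a0 : 0 <= a) (b0 : 0 <= b) (c0 : 0 <= c).
Let k : R := kap bg.
Let k0 : 0 <= k. Proof. exact: kap_ge0. Qed.

Variables (x y z : R).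
Hypotheses (hx : dom bg x) (hy : dom bg y) (hz : dom bg z).

Section Direction.
Variables (u v w : R).

Let P (s : R) := pt bg (x * expR (s * u)).
Let Q (s : R) := pt bg (y * expR (s * v)).
Let S (s : R) := pt bg (z * expR (s * w)).

(** The pairing of the velocity with the extended angles; its derivative is minus the quadratic form
    of the Jacobian. *)
Definition ray_sum (s : R) : R :=
  u * sang bg a b c (x * expR (s * u)) (y * expR (s * v)) (z * expR (s * w))
  + v * sang bg b a c (y * expR (s * v)) (x * expR (s * u)) (z * expR (s * w))
  + w * sang bg c a b (z * expR (s * w)) (x * expR (s * u)) (y * expR (s * v)).

Definition ray_dom (s : R) : Prop :=
  [/\ dom bg (x * expR (s * u)), dom bg (y * expR (s * v)) & dom bg (z * expR (s * w))].

Let cvg_exp (t m : R) (s : R) : t * expR (s' * m) @[s' --> s] --> t * expR (s * m).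
Proof.
apply: cvgMf; first exact: cvg_cst.
apply: continuous_cvg; first exact: continuous_expR.
by apply: cvgMf; [exact: cvg_id|exact: cvg_cst].
Qed.

Let cP s : ray_dom s -> cvg2 (F := nbhs s) P (P s).
Proof. by move=> [d1 _ _]; apply: cvg_pt_dom => //; exact: cvg_exp. Qed.
Let cQ s : ray_dom s -> cvg2 (F := nbhs s) Q (Q s).
Proof. by move=> [_ d2 _]; apply: cvg_pt_dom => //; exact: cvg_exp. Qed.
Let cS s : ray_dom s -> cvg2 (F := nbhs s) S (S s).
Proof. by move=> [_ _ d3]; apply: cvg_pt_dom => //; exact: cvg_exp. Qed.

Lemma ray_sum_continuous s : ray_dom s -> {for s, continuous ray_sum}.
Proof.
move=> ds; have [d1 d2 d3] := ds.
have [hP [hQ hS]] := (onk_pt d1, (onk_pt d2, onk_pt d3)).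
have q12 := qlen_gt0 k0 c0 hP hQ; have q13 := qlen_gt0 k0 b0 hP hS.
have q23 := qlen_gt0 k0 a0 hQ hS.
rewrite /continuous_at /ray_sum /sang.
apply: cvgDf; first apply: cvgDf.
- apply: cvgMf; first exact: cvg_cst.
  by apply: (cvg_tang q12 q13); [exact: cP|exact: cQ|exact: cS].
- apply: cvgMf; first exact: cvg_cst.
  by apply: cvg_tang; rewrite // ?(qlenC _ _ (pt bg (y * _)) (pt bg (x * _)))//; [exact: cQ|exact: cP|exact: cS].
- apply: cvgMf; first exact: cvg_cst.
  by apply: cvg_tang; rewrite // ?(qlenC _ _ (pt bg (z * _)))//; [exact: cS|exact: cP|exact: cQ].
Qed.

Lemma ray_gram_open s : ray_dom s -> 0 < gram k a b c (P s) (Q s) (S s) ->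
  \forall t \near s, ray_dom t /\ 0 < gram k a b c (P t) (Q t) (S t).
Proof.
move=> ds g0; have [d1 d2 d3] := ds.
have n1 : \forall t \near s, dom bg (x * expR (t * u)).
  exact: near_dom d1 (@cvg_exp x u s).
have n2 : \forall t \near s, dom bg (y * expR (t * v)).
  exact: near_dom d2 (@cvg_exp y v s).
have n3 : \forall t \near s, dom bg (z * expR (t * w)).
  exact: near_dom d3 (@cvg_exp z w s).
have cg : gram k a b c (P t) (Q t) (S t) @[t --> s] --> gram k a b c (P s) (Q s) (S s).
  by apply: cvg_gram; [exact: cP|exact: cQ|exact: cS].
have n4 : \forall t \near s, 0 < gram k a b c (P t) (Q t) (S t) by exact: cvgr_gt cg _ g0.
by near=> t; split; [split|]; near: t.
Unshelve. all: by end_near. Qed.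

Lemma is_derive_ray_sum s : ray_dom s -> 0 < gram k a b c (P s) (Q s) (S s) ->
  is_derive s 1 ray_sum
    (- qform k a b c (P s) (Q s) (S s) u v w / Num.sqrt (gram k a b c (P s) (Q s) (S s))).
Proof.
move=> [d1 d2 d3] g0.
have [hP [hQ hS]] := (onk_pt d1, (onk_pt d2, onk_pt d3)).
have [mP [mQ mS]] := (moves_pt d1, (moves_pt d2, moves_pt d3)).
have e2 := gram_vertex a b c hP hQ hS.
have e3 := gram3 a b c hP hQ hS.
have g2 : 0 < gram k b a c (Q s) (P s) (S s) by rewrite -e2.
have g3 : 0 < gram k c a b (S s) (P s) (Q s) by rewrite e3.
have t1 := is_derive_tang (P := P) (Q := Q) (S := S) k0 b0 c0 hP hQ hS mP mQ mS g0.
have t2 := is_derive_tang (P := Q) (Q := P) (S := S) k0 a0 c0 hQ hP hS mQ mP mS g2.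
have t3 := is_derive_tang (P := S) (Q := P) (S := Q) k0 a0 b0 hS hP hQ mS mP mQ g3.
rewrite /ray_sum; apply: is_derive_eq; rewrite /GRing.scale/=.
rewrite -(qform_tang k0 u v w a0 b0 c0 hP hQ hS).
rewrite -e2 e3.
ring.
Qed.

End Direction.

(** The decrease is gained for s in [0, 1], where the ray stays in the box of [local_coercive].
    Beyond, possibly through degenerate triangles, nothing is lost. Hence the velocity is bounded by
    rho while the length l is not. *)
Lemma ray_coercive :
  0 < gram k a b c (pt bg x) (pt bg y) (pt bg z) ->
  exists rho e, [/\ 0 < rho, 0 < e & forall u v w l,
    `|u| <= rho -> `|v| <= rho -> `|w| <= rho -> 1 <= l -> ray_dom u v w l ->
    e * nform k u v w <= ray_sum u v w 0 - ray_sum u v w l].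
Proof.
move=> D0; have [rho [e [rho0 e0 loc]]] := local_coercive a0 b0 c0 hx hy hz D0.
exists rho, e; split=> // u v w l hu hv hw l1 dl.
have small t s : 0 <= s <= 1 -> `|t| <= rho -> `|s * t| <= rho.
  move=> /andP[s0 s1] ht; rewrite normrM (ger0_norm s0) (le_trans _ ht)//.
  by rewrite ler_piMl.
have step1 : e * nform k u v w <= ray_sum u v w 0 - ray_sum u v w 1.
  suff : ray_sum u v w 1 + 1 * (e * nform k u v w) <= ray_sum u v w 0 + 0 * (e * nform k u v w).
    by rewrite mul1r mul0r; lra.
  apply: (@nonincreasing_of_derive R (fun s => ray_sum u v w s + s * (e * nform k u v w))
    (fun s => - qform k a b c (pt bg (x * expR (s * u))) (pt bg (y * expR (s * v)))
       (pt bg (z * expR (s * w))) u v w / Num.sqrt (gram k a b c (pt bg (x * expR (s * u)))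
       (pt bg (y * expR (s * v))) (pt bg (z * expR (s * w)))) + e * nform k u v w)) => //.
    move=> s sI; have [d1 d2 d3 g _] := loc _ _ _ (small _ _ sI hu) (small _ _ sI hv) (small _ _ sI hw).
    have ds : ray_dom u v w s by [].
    have dr := is_derive_ray_sum ds g.
    by apply: is_derive_eq; rewrite /GRing.scale/=; ring.
  move=> s sI; have [d1 d2 d3 g q] := loc _ _ _ (small _ _ sI hu) (small _ _ sI hv) (small _ _ sI hw).
  rewrite mulNr addrC subr_le0 ler_pdivlMr ?sqrtr_gt0//; exact: q.
have step2 : ray_sum u v w l <= ray_sum u v w 1.
  have drs s : 0 <= s <= l -> ray_dom u v w s.
    by case: dl => e1 e2 e3 sI; split; [exact: dom_ray sI|exact: dom_ray sI|exact: dom_ray sI].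
  (* The finite list contains the at most eight values of the sum when every angle is 0 or pi, as in
     a degenerate triangle. *)
  refine (@nonincreasing_off_finite R (ray_sum u v w)
    (fun s => - qform k a b c (pt bg (x * expR (s * u))) (pt bg (y * expR (s * v)))
       (pt bg (z * expR (s * w))) u v w / Num.sqrt (gram k a b c (pt bg (x * expR (s * u)))
       (pt bg (y * expR (s * v))) (pt bg (z * expR (s * w)))))
    (fun s => ray_dom u v w s /\ 0 < gram k a b c (pt bg (x * expR (s * u)))
       (pt bg (y * expR (s * v))) (pt bg (z * expR (s * w))))
    ([seq u * p12.1 + p12.2 | p12 <- [seq (t1, t2) | t1 <- [:: 0; pi], t2 <-
       [seq v * t2 + w * t3 | t2 <- [:: 0; pi], t3 <- [:: 0; pi]]]]) 1 l _ _ _ _ _ _).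
  - exact: l1.
  - by move=> s sI; apply: ray_sum_continuous; apply: drs; lra.
  - move=> s sI; have ds : ray_dom u v w s by apply: drs; lra.
    have [g|g] := leP (gram k a b c (pt bg (x * expR (s * u)))
       (pt bg (y * expR (s * v))) (pt bg (z * expR (s * w)))) 0; last by left.
    right; have [d1 d2 d3] := ds.
    have [hP [hQ hS]] := (onk_pt d1, (onk_pt d2, onk_pt d3)).
    have g2 := g; rewrite (gram_vertex a b c hP hQ hS) in g2.
    have g3 := g; rewrite -(gram3 a b c hP hQ hS) in g3.
    rewrite /ray_sum /sang (tang_degenerate k0 a0 b0 c0 hP hQ hS g).
    rewrite (tang_degenerate k0 b0 a0 c0 hQ hP hS g2) (tang_degenerate k0 c0 a0 b0 hS hP hQ g3).
    rewrite -addrA; apply/mapP.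
    set t1 := if _ then _ else _; set t2 := if _ then _ else _; set t3 := if _ then _ else _.
    have m (B : bool) : (if B then 0 else pi) \in [:: 0; pi : R] by case: B; rewrite !inE eqxx ?orbT.
    exists (t1, v * t2 + w * t3) => //; apply: allpairs_f; first exact: m.
    by apply: (@allpairs_f _ _ _ (fun t2 t3 => v * t2 + w * t3)); exact: m.
  - by move=> s sI [ds g]; exact: ray_gram_open.
  - by move=> s [ds g]; exact: is_derive_ray_sum.
  - move=> s [[d1 d2 d3] g].
    rewrite mulNr oppr_le0 divr_ge0 ?sqrtr_ge0//.
    have [e' e'0 h] := qform_coercive k0 a0 b0 c0 (onk_pt d1) (onk_pt d2) (onk_pt d3) g.
    by apply: le_trans (h _ _ _); rewrite mulr_ge0 ?(ltW e'0) ?nform_ge0.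
lra.
Qed.

End RayMonotone.

(** * From radii and side lengths to scaled radii and extended angles *)

Section HyperbolicFunctions.
Context {R : realType}.
Implicit Types x y : R.

Lemma cosh_sinhD x y : cosh (x + y) = cosh x * cosh y + sinh x * sinh y.
Proof. by rewrite /cosh /sinh opprD !expRD; field. Qed.

Lemma cosh_sinhB x y : cosh (x - y) = cosh x * cosh y - sinh x * sinh y.
Proof. by rewrite /cosh /sinh opprB [y - x]addrC !expRD; field. Qed.

Lemma cosh2_sinh2 x : sinh x ^+ 2 = cosh x ^+ 2 - 1.
Proof. by rewrite /cosh /sinh expRN; field; rewrite gt_eqF// expR_gt0. Qed.

Lemma coshN x : cosh (- x) = cosh x.
Proof. by rewrite /cosh opprK addrC. Qed.

Lemma cosh_norm x : cosh `|x| = cosh x.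
Proof. by case: (ler0P x) => _; rewrite ?coshN. Qed.

Lemma sinh_gt0 x : 0 < x -> 0 < sinh x.
Proof. by move=> x0; rewrite /sinh divr_gt0// subr_gt0 ltr_expR; lra. Qed.

Lemma cosh_gt0 x : 0 < cosh x.
Proof. by rewrite /cosh; pos. Qed.

Lemma cosh_ge1 x : 1 <= cosh x.
Proof.
have c0 := cosh_gt0 x; have s2 := sqr_ge0 (sinh x); rewrite cosh2_sinh2 in s2.
by rewrite -(@ler_pXn2r _ 2)// ?nnegrE ?(ltW c0)// expr1n; lra.
Qed.

Lemma ltr_cosh x y : 0 <= x -> 0 <= y -> (cosh x < cosh y) = (x < y).
Proof.
suff key (s t : R) : 0 <= s -> s < t -> cosh s < cosh t.
  move=> x0 y0; apply/idP/idP; last exact: key.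
  by apply: contraTT; rewrite -!leNgt le_eqVlt => /predU1P[->//|/(key _ _ y0)/ltW].
move=> s0 st; rewrite -subr_gt0.
have E0 := expR_gt0 s; have E1 := expR_gt0 t.
have -> : cosh t - cosh s = (expR t - expR s) * (1 - expR (- s - t)) / 2.
  by rewrite /cosh expRD !expRN; field; rewrite !gt_eqF.
rewrite divr_gt0// mulr_gt0// subr_gt0 ?ltr_expR//.
by rewrite -expR0 ltr_expR; lra.
Qed.

Lemma tanh_half x : tanh (x / 2) = (expR x - 1) / (expR x + 1).
Proof.
have -> : expR x = expR (x / 2) ^+ 2.
  by rewrite expr2 -expRD; congr expR; field.
rewrite /tanh /sinh /cosh expRN; have := expR_gt0 (x / 2); set E := expR _ => E0.
have h : 0 < E ^+ 2 + 1 by rewrite addr_gt0// exprn_gt0.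
by field; rewrite !gt_eqF// ?mulrn_wgt0//; pos.
Qed.

End HyperbolicFunctions.

Section Radii.
Context {R : realType}.
Variable bg : background.
Implicit Types r s : R.

(** Half-angle formulas: tanh (r / 2) parametrizes (sinh r, cosh r) rationally. *)
Lemma pt_scale r : pt bg (scale bg r) = if bg is Hyperbolic then (sinh r, cosh r) else (r, 1).
Proof.
rewrite /pt /scale; case: bg => //; rewrite tanh_half.
have := expR_gt0 r; rewrite /sinh /cosh expRN; set E := expR r => E0.
have h : 0 < E + 1 by lra.
have -> : 1 - ((E - 1) / (E + 1)) ^+ 2 = 4 * E / (E + 1) ^+ 2.
  by field; rewrite gt_eqF.
by congr (_, _); field; rewrite !gt_eqF.
Qed.

Lemma dom_scale r : 0 < r -> dom bg (scale bg r).
Proof.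
rewrite /dom /scale /kap; case: bg => r0; first by rewrite r0 mul0r ltr01.
have E1 : 1 < expR r by rewrite -expR0 ltr_expR.
rewrite tanh_half mul1r divr_gt0 ?ltr_pdivrMr ?mul1r//; lra.
Qed.

(** In hyperbolic geometry, twice the inverse hyperbolic tangent. *)
Definition unscale s : R := if bg is Hyperbolic then ln ((1 + s) / (1 - s)) else s.

Lemma unscaleK s : dom bg s -> scale bg (unscale s) = s.
Proof.
rewrite /dom /scale /unscale /kap; case: bg => //; rewrite mul1r => /andP[s0 s1].
have d : 0 < 1 - s by lra.
rewrite tanh_half lnK ?posrE ?divr_gt0//; last by lra.
by field; rewrite gt_eqF//=; apply/eqP; lra.
Qed.

Lemma unscale_gt0 s : dom bg s -> 0 < unscale s.
Proof.
rewrite /dom /scale /unscale /kap; case: bg => [/andP[]//|].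
rewrite mul1r => /andP[s0 s1]; apply: ln_gt0; rewrite ltr_pdivlMr; lra.
Qed.

Lemma scaleK r : 0 < r -> unscale (scale bg r) = r.
Proof.
rewrite /scale /unscale; case: bg => // r0.
rewrite tanh_half; have := expR_gt0 r => E0.
have -> : (1 + (expR r - 1) / (expR r + 1)) / (1 - (expR r - 1) / (expR r + 1)) = expR r.
  by field; apply/andP; split; rewrite gt_eqF//; lra.
exact: expRK.
Qed.

End Radii.

Section ExtendedAngle.
Context {R : realType}.

(** The position of t separates the cases of [ext_angle]: t <= -1 when [la] is too long, t >= 1 when
    [lb] or [lc] is; clipping returns pi and 0 accordingly. *)
Lemma ext_angle_acosc bg (la lb lc t : R) :
  angle bg la lb lc = acos t ->
  (-1 < t) = (la < lb + lc) -> (t < 1) = (`|lb - lc| < la) ->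
  ext_angle bg la lb lc = acosc t.
Proof.
move=> eA h1 h2; rewrite /ext_angle.
have -> : (lb < la + lc) && (lc < la + lb) = (t < 1).
  by rewrite h2 ltr_norml; apply/andP/andP => -[]; lra.
rewrite -h1; have [t1|t1] := ltP (-1) t; have [t2|t2] := ltP t 1 => /=.
- by rewrite eA /acosc clip_id// !ltW.
- by rewrite leNgt -h1 t1 /= acosc_ge1.
- by rewrite leNgt -h1 ltNge t1 acosc_leN1.
- by lra.
Qed.

Variables (bg : background) (a b c x y z : R).
Hypotheses (a0 : 0 <= a) (b0 : 0 <= b) (c0 : 0 <= c).
Hypotheses (x0 : 0 < x) (y0 : 0 < y) (z0 : 0 < z).

Let la := edge_length bg a y z.
Let lb := edge_length bg b x z.
Let lc := edge_length bg c x y.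
Let p := pt bg (scale bg x).
Let q := pt bg (scale bg y).
Let r := pt bg (scale bg z).
Let t := carg (kap bg) a b c p q r.

Lemma sqrt_qlen (w u v : R) : 0 <= w -> 0 < u -> 0 < v ->
  Num.sqrt (qlen (kap bg) w (pt bg (scale bg u)) (pt bg (scale bg v)))
  = if bg is Hyperbolic then sinh (edge_length bg w u v) else edge_length bg w u v.
Proof.
move=> w0 u0 v0; rewrite !pt_scale /edge_length /kap /qlen; case: bg => /=.
  by congr Num.sqrt; ring.
have C1 : 1 <= cosh u * cosh v + w * sinh u * sinh v.
  have h : 0 <= w * sinh u * sinh v.
    by have [su sv] := (sinh_gt0 u0, sinh_gt0 v0); nneg.
  have h2 : 1 <= cosh u * cosh v by rewrite -[leLHS]mulr1 ler_pM ?cosh_ge1.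
  lra.
have s0 : 0 <= sinh (acosh (cosh u * cosh v + w * sinh u * sinh v)).
  have := acosh_ge0 C1; rewrite le_eqVlt => /predU1P[<-|/sinh_gt0/ltW//].
  by rewrite /sinh oppr0 subrr mul0r.
rewrite -[RHS]ger0_norm// -sqrtr_sqr [in RHS]cosh2_sinh2 acoshK//; congr Num.sqrt.
have := cosh2_sinh2 u; have := cosh2_sinh2 v.
move: (cosh u) (sinh u) (cosh v) (sinh v) => X xx Y yy e1 e2.
have e3 : X ^+ 2 = 1 + xx ^+ 2 by rewrite e2; ring.
have e4 : Y ^+ 2 = 1 + yy ^+ 2 by rewrite e1; ring.
ring: e3 e4.
Qed.

Lemma ccosh_length (w u v : R) : 0 <= w -> 0 < u -> 0 < v -> bg = Hyperbolic ->
  cosh (edge_length bg w u v) = ccosh (kap bg) w (pt bg (scale bg u)) (pt bg (scale bg v)).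
Proof.
move=> w0 u0 v0 E; rewrite !pt_scale /edge_length /kap /ccosh E /=.
rewrite mul1r acoshK//.
have h : 0 <= w * sinh u * sinh v.
  by have [su sv] := (sinh_gt0 u0, sinh_gt0 v0); nneg.
have h2 : 1 <= cosh u * cosh v by rewrite -[leLHS]mulr1 ler_pM ?cosh_ge1.
lra.
Qed.

Lemma edge_length_gt0 (w u v : R) : 0 <= w -> 0 < u -> 0 < v -> 0 < edge_length bg w u v.
Proof.
move=> w0 u0 v0.
have : 0 < Num.sqrt (qlen (kap bg) w (pt bg (scale bg u)) (pt bg (scale bg v))).
  by rewrite sqrtr_gt0 qlen_gt0// ?kap_ge0//; apply: onk_pt; exact: dom_scale.
rewrite sqrt_qlen//; case: bg => // h.
rewrite ltNge; apply/negP => le0; move: h; apply/negP; rewrite -leNgt.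
by rewrite /sinh mulr_le0_ge0// subr_le0 ler_expR; lra.
Qed.

Lemma angle_carg : angle bg la lb lc = acos t.
Proof.
have la0 := edge_length_gt0 a0 y0 z0; have lb0 := edge_length_gt0 b0 x0 z0.
have lc0 := edge_length_gt0 c0 x0 y0.
have ha := sqrt_qlen a0 y0 z0; have hb := sqrt_qlen b0 x0 z0.
have hc := sqrt_qlen c0 x0 y0.
rewrite -/la -/lb -/lc -/p -/q -/r in ha hb hc la0 lb0 lc0.
have [hp [hq hr]] : onk (kap bg) p /\ onk (kap bg) q /\ onk (kap bg) r.
  by split; [|split]; apply: onk_pt; exact: dom_scale.
have k0 := @kap_ge0 R bg.
have qa := sqr_sqrtr (ltW (qlen_gt0 k0 a0 hq hr)).
have qb := sqr_sqrtr (ltW (qlen_gt0 k0 b0 hp hr)).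
have qc := sqr_sqrtr (ltW (qlen_gt0 k0 c0 hp hq)).
have Ha := ccosh_length a0 y0 z0; have Hb := ccosh_length b0 x0 z0.
have Hc := ccosh_length c0 x0 y0.
rewrite -/la -/lb -/lc -/p -/q -/r in Ha Hb Hc.
have L := ncos_cosine_law a b c hp hq hr.
rewrite /angle /t /carg hb hc.
move: la lb lc la0 lb0 lc0 ha hb hc qa qb qc Ha Hb Hc L => A B C la0 lb0 lc0.
rewrite /p /q /r !pt_scale /kap; case: bg => /=.
- move=> ha hb hc qa qb qc _ _ _ _; congr acos.
  have -> : B ^+ 2 + C ^+ 2 - A ^+ 2
      = 2 * ncos 0 a b c (x, 1) (y, 1) (z, 1).
    by rewrite -ha -hb -hc qa qb qc /qlen /ncos /=; ring.
  by field; rewrite !gt_eqF.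
- move=> ha hb hc _ _ _ /(_ erefl)-> /(_ erefl)-> /(_ erefl)->; rewrite mul1r => ->.
  by rewrite (mulrC (sinh C) (sinh B)).
Qed.

Lemma gram_gt0_carg (k a1 b1 c1 : R) p1 q1 r1 : 0 <= k -> 0 <= b1 -> 0 <= c1 ->
  onk k p1 -> onk k q1 -> onk k r1 ->
  -1 < carg k a1 b1 c1 p1 q1 r1 < 1 -> 0 < gram k a1 b1 c1 p1 q1 r1.
Proof.
move=> k0 b10 c10 hp hq hr /andP[h1 h2]; rewrite ltNge; apply/negP => D0.
have := carg_itvN k0 b10 c10 hp hq hr D0; rewrite leNgt ltr_norml h1 h2 //.
Qed.

Let euclid_cmp1 (A B C n : R) : B ^+ 2 + C ^+ 2 - A ^+ 2 = 2 * n ->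
  (-1 * (C * B) < n) = (A ^+ 2 < (B + C) ^+ 2).
Proof. by move=> E; apply/idP/idP; lra. Qed.

Let euclid_cmp2 (A B C n : R) : B ^+ 2 + C ^+ 2 - A ^+ 2 = 2 * n ->
  (n < 1 * (C * B)) = ((B - C) ^+ 2 < A ^+ 2).
Proof. by move=> E; apply/idP/idP; lra. Qed.

Let hyp_cmp1 (A B C S S' : R) :
  (-1 * (S * S') < B * C - A) = (A < B * C + S' * S).
Proof. by apply/idP/idP; lra. Qed.

Let hyp_cmp2 (A B C S S' : R) :
  (B * C - A < 1 * (S * S')) = (B * C - S' * S < A).
Proof. by apply/idP/idP; lra. Qed.

(** By the law of cosines this compares la^2 with (lb + lc)^2 and (lb - lc)^2 in Euclidean geometry,
    and cosh la with cosh (lb + lc) and cosh (lb - lc) in hyperbolic geometry. *)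
Lemma carg_triangle : (-1 < t) = (la < lb + lc) /\ (t < 1) = (`|lb - lc| < la).
Proof.
have la0 := edge_length_gt0 a0 y0 z0; have lb0 := edge_length_gt0 b0 x0 z0.
have lc0 := edge_length_gt0 c0 x0 y0.
have hb := sqrt_qlen b0 x0 z0; have hc := sqrt_qlen c0 x0 y0.
have ha := sqrt_qlen a0 y0 z0.
rewrite -/la -/lb -/lc -/p -/q -/r in ha hb hc la0 lb0 lc0.
have [hp [hq hr]] : onk (kap bg) p /\ onk (kap bg) q /\ onk (kap bg) r.
  by split; [|split]; apply: onk_pt; exact: dom_scale.
have k0 := @kap_ge0 R bg.
have qa := sqr_sqrtr (ltW (qlen_gt0 k0 a0 hq hr)).
have qb := sqr_sqrtr (ltW (qlen_gt0 k0 b0 hp hr)).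
have qc := sqr_sqrtr (ltW (qlen_gt0 k0 c0 hp hq)).
have Ha := ccosh_length a0 y0 z0; have Hb := ccosh_length b0 x0 z0.
have Hc := ccosh_length c0 x0 y0.
rewrite -/la -/lb -/lc -/p -/q -/r in Ha Hb Hc.
have L := ncos_cosine_law a b c hp hq hr.
have habs : 0 <= `|lb - lc| by [].
rewrite /t /carg hb hc.
move: la lb lc la0 lb0 lc0 habs ha hb hc qa qb qc Ha Hb Hc L => A B C la0 lb0 lc0 habs.
rewrite /p /q /r !pt_scale /kap; case: bg => /=.
- move=> ha hb hc qa qb qc _ _ _ _.
  have E : B ^+ 2 + C ^+ 2 - A ^+ 2
      = 2 * ncos 0 a b c (x, 1) (y, 1) (z, 1).
    by rewrite -ha -hb -hc qa qb qc /qlen /ncos /=; ring.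
  have l0 : 0 < C * B by rewrite mulr_gt0.
  rewrite ltr_pdivlMr// ltr_pdivrMr//; split.
    have -> : (A < B + C) = (A ^+ 2 < (B + C) ^+ 2).
      by rewrite ltr_pXn2r// nnegrE ltW// addr_gt0.
    by apply: euclid_cmp1.
  have -> : (`|B - C| < A) = ((B - C) ^+ 2 < A ^+ 2).
    by rewrite -(real_normK (num_real (B - C))) ltr_pXn2r// nnegrE ltW.
  by apply: euclid_cmp2.
- move=> ha hb hc _ _ _ /(_ erefl) Ca /(_ erefl) Cb /(_ erefl) Cc.
  rewrite mul1r -Ca -Cb -Cc => ->.
  have l0 : 0 < sinh C * sinh B by rewrite mulr_gt0// sinh_gt0.
  rewrite ltr_pdivlMr// ltr_pdivrMr//; split.
    rewrite -[RHS]ltr_cosh ?ltW ?addr_gt0// cosh_sinhD.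
    exact: hyp_cmp1.
  rewrite -[RHS]ltr_cosh ?(ltW la0)// cosh_norm cosh_sinhB.
  exact: hyp_cmp2.
Qed.

Lemma ext_angleE : ext_angle bg la lb lc
  = sang bg a b c (scale bg x) (scale bg y) (scale bg z).
Proof.
have [h1 h2] := carg_triangle; exact: ext_angle_acosc angle_carg h1 h2.
Qed.

Lemma gram_gt0_triangle : la < lb + lc -> lb < la + lc -> lc < la + lb ->
  0 < gram (kap bg) a b c p q r.
Proof.
have [h1 h2] := carg_triangle; rewrite -h1 => t1 hb hc.
have t2 : t < 1 by rewrite h2 ltr_norml; lra.
apply: gram_gt0_carg; rewrite ?kap_ge0// ?t1 ?t2//; apply: onk_pt; exact: dom_scale.
Qed.

End ExtendedAngle.

(** * Limits of the angles of a face when radii shrink to 0 *)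

Section FaceLimits.
Context {R : realType}.
Variable bg : background.
Context {T : Type} {F : set_system T} {FF : ProperFilter F}.

Lemma sangC (a b c x y z : R) : sang bg a b c x y z = sang bg a c b x z y.
Proof. exact: tangC. Qed.

Lemma sang_ge0 (a b c x y z : R) : 0 <= sang bg a b c x y z.
Proof. exact: tang_ge0. Qed.

Lemma sang_lepi (a b c x y z : R) : sang bg a b c x y z <= pi.
Proof. exact: tang_lepi. Qed.

Lemma sang_sum_le_pi (a b c x y z : R) : 0 <= a -> 0 <= b -> 0 <= c ->
  dom bg x -> dom bg y -> dom bg z ->
  sang bg a b c x y z + sang bg b a c y x z + sang bg c a b z x y <= pi.
Proof.
by move=> a0 b0 c0 dx dy dz; apply: tang_sum_le_pi => //; [exact: kap_ge0|exact: onk_pt..].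
Qed.

Lemma pt0 : pt bg (0 : R) = (0, 1).
Proof. by rewrite /pt; case: bg => //; rewrite expr0n/= mulr0 mul0r subr0 addr0 divr1. Qed.

Lemma cvg_pt0 (f : T -> R) : f @ F --> (0 : R) -> cvg2 (F := F) (fun t => pt bg (f t)) (0, 1).
Proof. by move=> f0; rewrite -pt0; apply: cvg_pt => //; rewrite mulr0 ltr01. Qed.

Lemma qlen0l k (c : R) p : qlen k c (0, 1) p = p.1 ^+ 2.
Proof. by rewrite /qlen /=; ring. Qed.

(** In the limit the two sides at the vanishing circle are radii of the other two circles, whose
    inversive distance a is minus the cosine of the angle between them, up to clipping when a >
    1. *)
Lemma cvg_sang_vanishing1 (a b c s2 s3 : R) (f1 f2 f3 : T -> R) :
  f1 @ F --> (0 : R) -> f2 @ F --> s2 -> f3 @ F --> s3 -> dom bg s2 -> dom bg s3 ->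
  sang bg a b c (f1 t) (f2 t) (f3 t) @[t --> F] --> acosc (- a).
Proof.
move=> c1 c2 c3 d2 d3.
have [p2 _ _] := onk_pt d2; have [p3 _ _] := onk_pt d3.
have -> : acosc (- a) = tang (kap bg) a b c (0, 1) (pt bg s2) (pt bg s3).
  rewrite /tang /carg !qlen0l !sqrtr_sqr !gtr0_norm// /ncos/=; congr acosc.
  by field; rewrite !gt_eqF.
apply: cvg_tang; rewrite ?qlen0l ?exprn_gt0//.
- exact: cvg_pt0.
- exact: cvg_pt_dom.
- exact: cvg_pt_dom.
Qed.

Lemma sang_sum_ge_near (a b c : R) (f1 f2 f3 : T -> R) e : 0 <= a -> 0 <= b -> 0 <= c ->
  (forall t, dom bg (f1 t)) -> (forall t, dom bg (f2 t)) -> (forall t, dom bg (f3 t)) ->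
  f1 @ F --> (0 : R) -> f2 @ F --> (0 : R) -> 0 < e ->
  \forall t \near F, pi - e <= sang bg a b c (f1 t) (f2 t) (f3 t)
    + sang bg b a c (f2 t) (f1 t) (f3 t) + sang bg c a b (f3 t) (f1 t) (f2 t).
Proof.
move=> a0 b0 c0 d1 d2 d3 c1 c2 e0.
have [d d0 H] := tang_sum_ge (@kap_ge0 R bg) e0.
have cC : ccosh (kap bg) c (pt bg (f1 t)) (pt bg (f2 t)) @[t --> F] --> (1 : R).
  have -> : (1 : R) = ccosh (kap bg) c (0, 1) (0, 1) by rewrite /ccosh /=; ring.
  by apply: cvg_ccosh; exact: cvg_pt0.
have : \forall t \near F, ccosh (kap bg) c (pt bg (f1 t)) (pt bg (f2 t)) < 1 + d.
  by apply: cvgr_lt cC _ _; rewrite ltrDl.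
apply: filterS => t h; apply: H => //; [exact: onk_pt..|lra].
Qed.

(** Two shrinking radii make one side short, and then the defect vanishes by [tang_sum_ge], wherever
    the third radius goes. *)
Lemma cvg_sang_vanishing3 (a b c : R) (f1 f2 f3 : T -> R) : 0 <= a -> 0 <= b -> 0 <= c ->
  (forall t, dom bg (f1 t)) -> (forall t, dom bg (f2 t)) -> (forall t, dom bg (f3 t)) ->
  f1 @ F --> (0 : R) -> f2 @ F --> (0 : R) ->
  sang bg a b c (f1 t) (f2 t) (f3 t) + sang bg b a c (f2 t) (f1 t) (f3 t)
    + sang bg c a b (f3 t) (f1 t) (f2 t) @[t --> F] --> (pi : R).
Proof.
move=> a0 b0 c0 d1 d2 d3 c1 c2; apply/cvgrPdist_le => e e0.
apply: filterS (sang_sum_ge_near a0 b0 c0 d1 d2 d3 c1 c2 e0) => t h.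
have := sang_sum_le_pi a0 b0 c0 (d1 t) (d2 t) (d3 t).
by move=> ?; rewrite ger0_norm; lra.
Qed.

Lemma cvg_sang_vanishing2 (a b c s3 : R) (f1 f2 f3 : T -> R) : 0 <= a -> 0 <= b -> 0 <= c ->
  (forall t, dom bg (f1 t)) -> (forall t, dom bg (f2 t)) -> (forall t, dom bg (f3 t)) ->
  f1 @ F --> (0 : R) -> f2 @ F --> (0 : R) -> f3 @ F --> s3 -> dom bg s3 ->
  sang bg a b c (f1 t) (f2 t) (f3 t) + sang bg b a c (f2 t) (f1 t) (f3 t)
    @[t --> F] --> (pi : R).
Proof.
move=> a0 b0 c0 d1 d2 d3 c1 c2 c3 ds; have [p3 _ _] := onk_pt ds.
(* The centres of the two shrinking circles merge, so the angle at the third vertex tends to 0. *)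
have t3 : sang bg c a b (f3 t) (f1 t) (f2 t) @[t --> F] --> (0 : R).
  have -> : (0 : R) = tang (kap bg) c a b (pt bg s3) (0, 1) (0, 1).
    rewrite /tang /carg !(qlenC _ _ (pt bg s3)) !qlen0l !sqrtr_sqr !gtr0_norm// /ncos/=.
    rewrite acosc_ge1// ler_pdivlMr ?mulr_gt0//; lra.
  apply: cvg_tang; rewrite ?(qlenC _ _ (pt bg s3)) ?qlen0l ?exprn_gt0//.
  - exact: cvg_pt_dom.
  - exact: cvg_pt0.
  - exact: cvg_pt0.
have := cvgBf (cvg_sang_vanishing3 a0 b0 c0 d1 d2 d3 c1 c2) t3.
rewrite subr0 => H.
rewrite (_ : (fun t => _) = (fun t => sang bg a b c (f1 t) (f2 t) (f3 t)
  + sang bg b a c (f2 t) (f1 t) (f3 t) + sang bg c a b (f3 t) (f1 t) (f2 t)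
  - sang bg c a b (f3 t) (f1 t) (f2 t))); first exact: H.
by apply/funext => t; rewrite addrK.
Qed.

Definition vanishing_or (e : bool) (f : T -> R) : Prop :=
  if e then f @ F --> (0 : R) else exists2 s, dom bg s & f @ F --> s.

End FaceLimits.

(* The limit does not depend on the radii that do not shrink. *)
Lemma face_limit {R : realType} bg (a b c : R) (e1 e2 e3 : bool) :
  0 <= a -> 0 <= b -> 0 <= c -> exists L : R,
  forall (T : Type) (F : set_system T) (FF : ProperFilter F) (f1 f2 f3 : T -> R),
  (forall t, dom bg (f1 t)) -> (forall t, dom bg (f2 t)) -> (forall t, dom bg (f3 t)) ->
  vanishing_or bg (F := F) e1 f1 -> vanishing_or bg (F := F) e2 f2 ->
  vanishing_or bg (F := F) e3 f3 ->
  e1%:R * sang bg a b c (f1 t) (f2 t) (f3 t) + e2%:R * sang bg b a c (f2 t) (f1 t) (f3 t)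
    + e3%:R * sang bg c a b (f3 t) (f1 t) (f2 t) @[t --> F] --> L.
Proof.
move=> a0 b0 c0.
exists (if e1 then if e2 then pi else if e3 then pi else acosc (- a)
        else if e2 then if e3 then pi else acosc (- b) else if e3 then acosc (- c) else 0).
move=> T F FF f1 f2 f3 d1 d2 d3.
rewrite /vanishing_or; case: e1; case: e2; case: e3 => v1 v2 v3;
  rewrite /= in v1 v2 v3 *;
  under eq_fun do rewrite ?mulr1n ?mulr0n ?mul1r ?mul0r ?addr0 ?add0r.
- exact: cvg_sang_vanishing3.
- by case: v3 => s ds v3; exact: (cvg_sang_vanishing2 a0 b0 c0 d1 d2 d3 v1 v2 v3 ds).
- case: v2 => s ds v2; under eq_fun do rewrite sangC.
  exact: (cvg_sang_vanishing2 a0 c0 b0 d1 d3 d2 v1 v3 v2 ds).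
- case: v2 v3 => s2 ds2 v2 [s3 ds3 v3]; exact: (cvg_sang_vanishing1 b c v1 v2 v3 ds2 ds3).
- case: v1 => s ds v1; under eq_fun do rewrite sangC [X in _ + X]sangC.
  exact: (cvg_sang_vanishing2 b0 c0 a0 d2 d3 d1 v2 v3 v1 ds).
- case: v1 v3 => s2 ds2 v1 [s3 ds3 v3]; exact: (cvg_sang_vanishing1 a c v2 v1 v3 ds2 ds3).
- case: v1 v2 => s2 ds2 v1 [s3 ds3 v2]; exact: (cvg_sang_vanishing1 a b v3 v1 v2 ds2 ds3).
- exact: cvg_cst.
Qed.

(** * Curvature as a function of the scaled radii *)

Section Faces.
Context {N : nat}.
Variable T : triangulation N.
Implicit Types i j k : 'I_N.

Definition face i j k := ([set i; j; k]%SET \in faces T).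

Lemma faceC i j k : face i j k = face j i k.
Proof. by rewrite /face [X in finset.setU X _]finset.setUC. Qed.

Lemma faceAC i j k : face i j k = face i k j.
Proof. by rewrite /face finset.setUAC. Qed.

Lemma face_neq i j k : face i j k -> i != j.
Proof.
move=> /card_face; apply: contra_eq_neq => ->.
by rewrite finset.setUid cards2; case: (j != k).
Qed.

Lemma face_edge i j k : face i j k -> [set i; j]%SET \in edges T.
Proof.
move=> f; rewrite /edges /edges_of finset.in_set cards2 (face_neq f) /=.
by apply/existsP; exists [set i; j; k]%SET; rewrite -/(face i j k) f finset.subsetUl.
Qed.

Lemma edge_face i j : [set i; j]%SET \in edges T -> exists k, face i j k.
Proof.
rewrite /edges /edges_of finset.in_set cards2 => /andP[ij' /existsP[f /andP[fF sub]]].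
have {ij'} ij : i != j by move: ij'; case: (i != j).
have c3 := card_face fF.
have /card_gt0P[k] : (0 < #|f :\: [set i; j]%SET|)%N.
  by rewrite cardsD (finset.setIidPr sub) c3 cards2 ij.
rewrite finset.in_setD => /andP[kij kf]; exists k; rewrite /face.
have -> // : [set i; j; k]%SET = f.
apply/eqP; rewrite eqEcard finset.subUset sub finset.sub1set kf /= c3.
rewrite cardsU cards1 cards2.
have -> : ([set i; j] :&: [set k])%SET = finset.set0.
  by apply/finset.setP => l; rewrite !inE; apply/negP => /andP[h /eqP E]; move: kij h; rewrite E !inE => /negP.
by rewrite cards0 ij.
Qed.

Lemma vertex_face i : exists j k, face i j k.
Proof.
have [f fF fi] := vertex_in_face T i.
have c3 := card_face fF.
have /card_gt0P[j] : (0 < #|f :\ i|)%N.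
  by have := cardsD1 i f; rewrite fi c3 add1n => -[<-].
rewrite !inE => /andP[ji jf].
have : [set i; j]%SET \in edges T.
  rewrite /edges /edges_of finset.in_set cards2 [i == j]eq_sym ji /=.
  apply/existsP; exists f; rewrite fF /=; apply/fintype.subsetP => l.
  by rewrite !inE => /orP[]/eqP->.
by move=> /edge_face[k fk]; exists j, k.
Qed.

(** Otherwise A would be closed under adjacency, while the surface is connected. *)
Lemma boundary_face (A : {set 'I_N}) : A != finset.set0 -> A != [set: 'I_N]%SET ->
  exists i j k, [/\ i \in A, j \notin A & face i j k].
Proof.
move=> /set0Pn[i iA] AT.
have /existsP[j jA] : [exists j, j \notin A].
  apply: contraNT AT; rewrite negb_exists => /forallP h.
  by apply/eqP/finset.setP => j; rewrite inE; apply/negPn/h.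
have [|nex] := pselect (exists i' j', [/\ i' \in A, j' \notin A & [set i'; j']%SET \in edges T]).
  by move=> [i' [j' [hi hj /edge_face[k fk]]]]; exists i', j', k.
exfalso; move/negP: jA; apply.
have cl : fingraph.closed (fun a b => [set a; b]%SET \in edges_of (faces T)) (mem A).
  move=> x y xy; apply/idP/idP => h.
    by apply/negPn/negP => hy; apply: nex; exists x, y.
  apply/negPn/negP => hx; apply: nex; exists y, x; split=> //.
  by rewrite finset.setUC.
by rewrite -(closed_connect cl (surface_connected T i j)).
Qed.


End Faces.

(** The passage from one face or vertex to all of them: positive constants that may be decreased
    have a common value over a finite type. *)
Lemma uniform_pos {R : realFieldType} (X : finType) (P : X -> R -> Prop) :
  (forall x, exists2 r, 0 < r & P x r) ->
  (forall x r r', P x r -> 0 < r' -> r' <= r -> P x r') ->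
  exists2 r, 0 < r & forall x, P x r.
Proof.
move=> ex mono.
have H (s : seq X) : exists2 r, 0 < r & forall x, x \in s -> P x r.
  elim: s => [|x s [r r0 hr]]; first by exists 1.
  have [r' r'0 hr'] := ex x; exists (Num.min r r'); first by rewrite lt_min r0.
  move=> y; rewrite inE => /predU1P[->|ys].
    by apply: mono hr' _ _; rewrite ?lt_min ?r0// ge_min lexx orbT.
  by apply: mono (hr _ ys) _ _; rewrite ?lt_min ?r0// ge_min lexx.
have [r r0 hr] := H (enum X); exists r => // x; apply: hr; exact: mem_enum.
Qed.

Section Curvature.
Context {R : realType} {N : nat}.
Variables (T : triangulation N) (I : {set 'I_N} -> R) (bg : background).
Hypothesis I_ge0 : forall e, e \in edges T -> 0 <= I e.
Implicit Types (i j k : 'I_N) (s : 'I_N -> R).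

Definition vang s i j k : R :=
  sang bg (I [set j; k]%SET) (I [set i; k]%SET) (I [set i; j]%SET) (s i) (s j) (s k).

Definition curv s i : R :=
  2 * pi - \sum_(p : 'I_N * 'I_N | (p.1 < p.2)%N && face T i p.1 p.2) vang s i p.1 p.2.

Lemma vangC s i j k : vang s i j k = vang s i k j.
Proof. by rewrite /vang sangC [[set j; k]%SET]finset.setUC. Qed.

Lemma face_I i j k : face T i j k ->
  [/\ 0 <= I [set j; k]%SET, 0 <= I [set i; k]%SET & 0 <= I [set i; j]%SET].
Proof.
move=> f; split; apply: I_ge0.
- by apply: (@face_edge _ _ j k i); rewrite faceAC faceC.
- by apply: (@face_edge _ _ i k j); rewrite faceAC.
- exact: face_edge f.
Qed.

(** Ordered pairs count each face at i twice, but make the sums over vertices symmetric under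
    exchange of the summation indices. *)
Lemma curv_half s i :
  curv s i = 2 * pi - (\sum_j \sum_(k | face T i j k) vang s i j k) / 2.
Proof.
rewrite /curv; congr (_ - _).
rewrite pair_big_dep /=.
rewrite [in RHS](bigID (fun p : 'I_N * 'I_N => (p.1 < p.2)%N)) /=.
rewrite [X in (_ + X) / 2](_ : _ = \sum_(p : 'I_N * 'I_N | (p.1 < p.2)%N && face T i p.1 p.2)
    vang s i p.1 p.2); last first.
  rewrite (reindex_inj (h := fun p : 'I_N * 'I_N => (p.2, p.1))) /=; last first.
    by move=> [a b] [c d] [-> ->].
  apply: eq_big => [[j k]|[j k] _] /=; last exact: vangC.
  rewrite (faceAC T i k j) andbC; case: (ltngtP j k) => //= /ord_inj E.
  by rewrite E; apply/negbTE/negP; rewrite faceC faceAC => /face_neq; rewrite eqxx.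
rewrite [X in (X + _) / 2](_ : _ = \sum_(p : 'I_N * 'I_N | (p.1 < p.2)%N && face T i p.1 p.2)
    vang s i p.1 p.2); last by apply: eq_bigl => p; rewrite andbC.
by field.
Qed.

Definition face_sum (w : 'I_N -> R) s i j k : R :=
  w i * vang s i j k + w j * vang s j i k + w k * vang s k i j.

(** Summation by faces; the ordered triples count each face six times. *)
Lemma curv_weighted (w : 'I_N -> R) s :
  \sum_i w i * curv s i = 2 * pi * \sum_i w i
    - (\sum_i \sum_j \sum_(k | face T i j k) face_sum w s i j k) / 6.
Proof.
pose S := \sum_i \sum_j \sum_k (if face T i j k then w i * vang s i j k else 0).
have E1 : \sum_i \sum_j \sum_(k | face T i j k) w i * vang s i j k = S.
  by apply: eq_bigr => i _; apply: eq_bigr => j _; rewrite big_mkcond.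
have E2 : \sum_i \sum_j \sum_(k | face T i j k) w j * vang s j i k = S.
  rewrite exchange_big /=; apply: eq_bigr => i _; apply: eq_bigr => j _.
  by rewrite big_mkcond; apply: eq_bigr => k _; rewrite faceC.
have E3 : \sum_i \sum_j \sum_(k | face T i j k) w k * vang s k i j = S.
  transitivity (\sum_i \sum_j \sum_k (if face T k i j then w k * vang s k i j else 0)).
    apply: eq_bigr => i _; apply: eq_bigr => j _; rewrite big_mkcond.
    by apply: eq_bigr => k _; rewrite faceAC faceC.
  under eq_bigr do rewrite exchange_big /=.
  by rewrite exchange_big.
have -> : \sum_i \sum_j \sum_(k | face T i j k) face_sum w s i j k = S + S + S.
  rewrite -{1}E1 -{1}E2 -{1}E3 -!big_split /=; apply: eq_bigr => i _.
  by rewrite -!big_split /=; apply: eq_bigr => j _; rewrite -!big_split.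
have -> : (S + S + S) / 6 = S / 2 by field.
rewrite -E1 mulr_sumr mulr_suml -sumrB; apply: eq_bigr => i _.
rewrite curv_half mulrBr [w i * _ in LHS]mulrC; congr (_ - _).
rewrite mulrA mulr_sumr; congr (_ / _); apply: eq_bigr => j _.
by rewrite mulr_sumr.
Qed.

Lemma curv_bounded : exists M : R, forall s i, `|curv s i| <= M.
Proof.
exists (2 * pi + pi *+ #|{: 'I_N * 'I_N}|) => s i; rewrite /curv.
apply: le_trans (ler_normB _ _) _; apply: lerD.
  by rewrite ger0_norm// mulr_ge0// pi_ge0.
apply: le_trans (ler_norm_sum _ _ _) _.
apply: le_trans (_ : \sum_(p : 'I_N * 'I_N) pi <= _); last by rewrite sumr_const.
rewrite big_mkcond /=; apply: ler_sum => p _; case: ifP => _; last exact: pi_ge0.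
by rewrite ger0_norm ?sang_ge0 ?sang_lepi.
Qed.

Lemma cvg_curv {X} {F : set_system X} {FF : Filter F} (f : X -> 'I_N -> R) s i :
  (forall j, dom bg (s j)) -> (forall j, f t j @[t --> F] --> s j) ->
  curv (f t) i @[t --> F] --> curv s i.
Proof.
move=> ds fs; rewrite /curv; apply: cvgBf; first exact: cvg_cst.
have cs : forall q : seq ('I_N * 'I_N),
    \sum_(p <- q | (p.1 < p.2)%N && face T i p.1 p.2) vang (f t) i p.1 p.2 @[t --> F]
    --> \sum_(p <- q | (p.1 < p.2)%N && face T i p.1 p.2) vang s i p.1 p.2.
  elim=> [|p q ih]; first by rewrite big_nil; under eq_fun do rewrite big_nil; exact: cvg_cst.
  rewrite big_cons; under eq_fun do rewrite big_cons.
  case: ifP => // /andP[_ /face_I[A0 B0 C0]]; apply: cvgDf; rewrite //.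
  have [h1 [h2 h3]] := (onk_pt (ds i), (onk_pt (ds p.1), onk_pt (ds p.2))).
  apply: cvg_tang; rewrite ?qlen_gt0 ?kap_ge0//; exact: cvg_pt_dom.
exact: cs.
Qed.

End Curvature.

(** * Coercivity of the curvature around a nondegenerate metric *)

Section Coercivity.
Context {R : realType} {N : nat}.
Variables (T : triangulation N) (I : {set 'I_N} -> R) (bg : background).
Hypothesis I_ge0 : forall e, e \in edges T -> 0 <= I e.
Implicit Types (i j k : 'I_N) (s w : 'I_N -> R).

Definition proper_faces s : Prop := forall i j k, face T i j k ->
  0 < gram (kap bg) (I [set j; k]%SET) (I [set i; k]%SET) (I [set i; j]%SET)
    (pt bg (s i)) (pt bg (s j)) (pt bg (s k)).

Definition nfaces w : R :=
  \sum_i \sum_j \sum_(k | face T i j k) nform (kap bg) (w i) (w j) (w k).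

Variable sb : 'I_N -> R.
Hypotheses (dsb : forall i, dom bg (sb i)) (nd : proper_faces sb).

Definition shifted w i : R := sb i * expR (w i).

(** Sum of [ray_coercive] over the faces. A single constant bounds the velocity and gives the rate,
    which makes the property stable under decreasing it, as [uniform_pos] requires; the factor 6 is
    that of [curv_weighted]. *)
Lemma curv_coercive_ray : exists2 e, 0 < e & forall w l,
  (forall i, `|w i| <= e) -> 1 <= l -> (forall i, dom bg (shifted (fun i => l * w i) i)) ->
  e * nfaces w <= \sum_i w i * (curv T I bg (shifted (fun i => l * w i)) i - curv T I bg sb i).
Proof.
pose P (x : 'I_N * 'I_N * 'I_N) e := face T x.1.1 x.1.2 x.2 -> forall w l,
  (forall i, `|w i| <= e) -> 1 <= l -> (forall i, dom bg (shifted (fun i => l * w i) i)) ->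
  e * nform (kap bg) (w x.1.1) (w x.1.2) (w x.2)
  <= face_sum I bg w sb x.1.1 x.1.2 x.2
     - face_sum I bg w (shifted (fun i => l * w i)) x.1.1 x.1.2 x.2.
have [|x e e' h e'0 ee' f w l hw l1 dw|e e0 he] := @uniform_pos R _ P.
- case=> -[i j] k; rewrite /P /=; have [f|] := boolP (face T i j k); last by exists 1.
  have [a0 b0 c0] := face_I I_ge0 f.
  have [rho [e [rho0 e0 h]]] := ray_coercive a0 b0 c0 (dsb i) (dsb j) (dsb k) (nd f).
  exists (Num.min rho e); first by rewrite lt_min rho0.
  move=> _ w l hw l1 dw.
  have n0 := nform_ge0 (@kap_ge0 R bg) (w i) (w j) (w k).
  apply: le_trans (_ : e * nform (kap bg) (w i) (w j) (w k) <= _).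
    by rewrite ler_wpM2r// ge_min lexx orbT.
  have hr m : `|w m| <= rho by apply: le_trans (hw m) _; rewrite ge_min lexx.
  have := h (w i) (w j) (w k) l (hr i) (hr j) (hr k) l1.
  move=> /(_ _)/le_trans; apply.
    by split; exact: dw.
  rewrite /ray_sum !mul0r expR0 !mulr1 /face_sum /vang /shifted.
  by rewrite ![[set j; i]%SET]finset.setUC ![[set k; j]%SET]finset.setUC ![[set k; i]%SET]finset.setUC.
- apply: le_trans (h f w l _ l1 dw).
    by rewrite ler_wpM2r ?nform_ge0 ?kap_ge0.
  by move=> i; exact: le_trans (hw i) ee'.
exists (e / 6).
  by rewrite divr_gt0.
move=> w l hw l1 dw.
have hw' i : `|w i| <= e by apply: le_trans (hw i) _; rewrite ler_pdivrMr//; lra.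
have -> : \sum_i w i * (curv T I bg (shifted (fun i => l * w i)) i - curv T I bg sb i)
  = (\sum_i \sum_j \sum_(k | face T i j k) (face_sum I bg w sb i j k
     - face_sum I bg w (shifted (fun i => l * w i)) i j k)) / 6.
  under eq_bigr do rewrite mulrBr.
  rewrite sumrB !curv_weighted.
  under [X in _ = X / 6]eq_bigr do (under eq_bigr do rewrite sumrB; rewrite sumrB).
  rewrite sumrB; ring.
rewrite mulrAC ler_pM2r// /nfaces mulr_sumr; apply: ler_sum => i _.
rewrite mulr_sumr; apply: ler_sum => j _; rewrite mulr_sumr; apply: ler_sum => k f.
exact: (he (i, j, k)).
Qed.

Lemma nfaces_ge0 w : 0 <= nfaces w.
Proof. by rewrite /nfaces; do 3 (apply: sumr_ge0 => ? _); exact: nform_ge0 (kap_ge0 _) _ _ _. Qed.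

Lemma nfaces_ge w i j k : face T i j k -> nform (kap bg) (w i) (w j) (w k) <= nfaces w.
Proof.
move=> f; have n0 a b c : 0 <= nform (kap bg) (w a) (w b) (w c) := nform_ge0 (kap_ge0 _) _ _ _.
apply: le_trans (_ : \sum_(k | face T i j k) nform (kap bg) (w i) (w j) (w k) <= _).
  by rewrite (bigD1 k)//= lerDl sumr_ge0.
apply: le_trans (_ : \sum_j \sum_(k | face T i j k) nform (kap bg) (w i) (w j) (w k) <= _).
  by rewrite [leRHS](bigD1 j)//= lerDl; do 2 (apply: sumr_ge0 => ? _).
by rewrite /nfaces [leRHS](bigD1 i)//= lerDl; do 3 (apply: sumr_ge0 => ? _).
Qed.

Lemma nfacesZ (l : R) w : nfaces (fun i => l * w i) = l ^+ 2 * nfaces w.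
Proof.
rewrite /nfaces mulr_sumr; apply: eq_bigr => i _; rewrite mulr_sumr; apply: eq_bigr => j _.
by rewrite mulr_sumr; apply: eq_bigr => k _; rewrite /nform; ring.
Qed.

(** A vector bounded by B is l times a vector in the small box, with l >= 1 depending only on B. The
    left-hand side is quadratic and the weight on the right linear in this dilation, so e becomes
    [e / l]. *)
Lemma curv_coercive (B : R) : exists2 e, 0 < e & forall w,
  (forall i, `|w i| <= B) -> (forall i, dom bg (shifted w i)) ->
  e * nfaces w <= \sum_i w i * (curv T I bg (shifted w) i - curv T I bg sb i).
Proof.
have [e e0 he] := curv_coercive_ray.
pose l := Num.max 1 (B / e).
have l1 : 1 <= l by rewrite le_max lexx.
have lB : B <= l * e by rewrite -ler_pdivrMr// le_max lexx orbT.
have l0 : 0 < l by lra.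
exists (e / l); first by rewrite divr_gt0.
move=> w hw dw; pose w' i := l^-1 * w i.
have ww' : (fun i => l * w' i) = w.
  by apply/funext => i; rewrite /w' mulrA divff ?mul1r// gt_eqF.
have hw' i : `|w' i| <= e.
  rewrite /w' normrM gtr0_norm ?invr_gt0// mulrC ler_pdivrMr// mulrC.
  exact: le_trans (hw i) lB.
have := he w' l hw' l1; rewrite ww' => /(_ dw).
rewrite nfacesZ => /(ler_wpM2l (ltW l0)) h.
apply: le_trans (_ : l * (e * (l^-1 ^+ 2 * nfaces w)) <= _).
  by rewrite le_eqVlt; apply/orP; left; apply/eqP; field; rewrite gt_eqF.
apply: le_trans h _; rewrite mulr_sumr le_eqVlt; apply/orP; left; apply/eqP.
by apply: eq_bigr => i _; rewrite /w'; field; rewrite gt_eqF.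
Qed.

Lemma curv_monotone w : (forall i, dom bg (shifted w i)) ->
  0 <= \sum_i w i * (curv T I bg (shifted w) i - curv T I bg sb i).
Proof.
move=> dw; have [e e0 he] := curv_coercive (\sum_i `|w i|).
apply: le_trans (he w _ dw); first by rewrite mulr_ge0 ?(ltW e0) ?nfaces_ge0.
by move=> i; rewrite (bigD1 i)//= lerDl sumr_ge0.
Qed.

(** Two vertices are joined by a simple path of at most N edges, along each of which w changes by at
    most the square root of [nfaces]. *)
Lemma nfaces_osc w i j : (w i - w j) ^+ 2 <= N%:R ^+ 2 * nfaces w.
Proof.
have edge a b : [set a; b]%SET \in edges T -> `|w a - w b| <= Num.sqrt (nfaces w).
  move=> /edge_face[c f]; rewrite -sqrtr_sqr ler_wsqrtr//.
  apply: le_trans (nfaces_ge w f); rewrite /nform -!addrA lerDl.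
  have k0 := @kap_ge0 R bg; nneg.
have walk p a : path (fun a b => [set a; b]%SET \in edges_of (faces T)) a p ->
    `|w a - w (last a p)| <= (size p)%:R * Num.sqrt (nfaces w).
  elim: p a => [|b p ih] a /=; first by rewrite subrr normr0 mul0r.
  move=> /andP[/edge h1 /ih h2]; rewrite -[(size p).+1]addn1 natrD mulrDl mul1r.
  have := ler_normD (w a - w b) (w b - w (last b p)); rewrite addrA subrK; lra.
have /connectP[p + ->] := surface_connected T i j.
move=> /shortenP[q hq uq _]; have {}hq := walk _ _ hq.
have sq : (size q <= N)%N.
  by have := uniq_leq_size uq (fun x _ => mem_enum 'I_N x); rewrite size_enum_ord => /ltnW.
rewrite -[_ ^+ 2]real_normK ?num_real// -[X in _ <= _ * X]sqr_sqrtr ?nfaces_ge0//.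
rewrite -exprMn ler_pXn2r ?nnegrE ?mulr_ge0 ?ler0n ?sqrtr_ge0//.
by apply: le_trans hq _; rewrite ler_wpM2r ?sqrtr_ge0// ler_nat.
Qed.

Lemma nfaces_hyperbolic w i : bg = Hyperbolic -> w i ^+ 2 <= nfaces w.
Proof.
move=> E; have [j [k f]] := vertex_face T i.
apply: le_trans (nfaces_ge w f); rewrite /nform /kap E mul1r.
have := sqr_ge0 (w i - w j); have := sqr_ge0 (w i - w k); have := sqr_ge0 (w j - w k).
have := sqr_ge0 (w j); have := sqr_ge0 (w k); lra.
Qed.

End Coercivity.

(** * Curvature of a set of vertices whose radii shrink to 0 *)

Section UltraLimits.
Context {R : realType}.

(** Along such an ultrafilter all bounded sequences converge at once, which replaces successive
    extractions of subsequences. *)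
Lemma ultra_nat : exists U : set_system nat, UltraFilter U /\ \oo `<=` U.
Proof. exact: ultraFilterLemma. Qed.

Lemma fmap_ultra {X Y} (U : set_system X) (f : X -> Y) : UltraFilter U -> UltraFilter (f @ U).
Proof.
move=> UU; split; first exact: fmap_proper_filter.
move=> G PG sG; apply/seteqP; split=> [B GB|]; last exact: sG.
have [//|UC] := in_ultra_setVsetC (f @^-1` B) UU.
have GC : G (~` B) by apply: sG.
have G0 : G set0 by rewrite -(setICr B); exact: filterI.
by have := @filter_not_empty _ G PG; case.
Qed.

Lemma ultra_bounded (U : set_system nat) (f : nat -> R) (m M : R) : UltraFilter U ->
  (forall n, m <= f n <= M) -> exists2 l, m <= l <= M & f @ U --> l.
Proof.
move=> UU fmM; have := @segment_compact R m M; rewrite compact_ultra.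
move=> /(_ (f @ U))[||l []].
- exact: fmap_ultra.
- by apply: (@filterE _ U) => n; rewrite /= in_itv/=; exact: fmM.
- by rewrite /= in_itv/= => lI fl; exists l.
Qed.

Lemma ultra_vanish (U : set_system nat) (f : nat -> R) : UltraFilter U -> \oo `<=` U ->
  (forall n, 0 <= f n <= n.+1%:R^-1) -> f @ U --> (0 : R).
Proof.
move=> UU sU fn; apply/cvgrPdist_lt => e e0.
have /sU := near_infty_natSinv_lt (PosNum e0).
apply: filterS => n /= h; have /andP[f0 f1] := fn n.
by rewrite sub0r normrN ger0_norm// (le_lt_trans f1 h).
Qed.

End UltraLimits.
Lemma cvg_sumf {R : realType} {X} {F : set_system X} {FF : Filter F} {J} (q : seq J)
    (P : pred J) (f : J -> X -> R) (l : J -> R) :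
  (forall j, P j -> f j @ F --> l j) ->
  \sum_(j <- q | P j) f j t @[t --> F] --> \sum_(j <- q | P j) l j.
Proof.
move=> fl; elim: q => [|j q ih].
  by rewrite big_nil; under eq_fun do rewrite big_nil; exact: cvg_cst.
rewrite big_cons; under eq_fun do rewrite big_cons.
by case: ifP => // /fl h; exact: cvgDf.
Qed.

Lemma dom_le {R : realType} bg (x y : R) : dom bg x -> 0 < y -> y <= x -> dom bg y.
Proof.
move=> /andP[x0 x1] y0 yx; rewrite /dom y0 /=.
by apply: le_lt_trans x1; rewrite ler_wpM2l ?kap_ge0.
Qed.

Section SubsetCurvature.
Context {R : realType} {N : nat}.
Variables (T : triangulation N) (I : {set 'I_N} -> R) (bg : background).
Hypothesis I_ge0 : forall e, e \in edges T -> 0 <= I e.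
Implicit Types (i j k : 'I_N) (s w : 'I_N -> R).
Variable sb : 'I_N -> R.
Hypotheses (dsb : forall i, dom bg (sb i)) (nd : proper_faces T I bg sb).

Let chi (A : {set 'I_N}) i : R := (i \in A)%:R.

Lemma sum_chi (A : {set 'I_N}) (f : 'I_N -> R) :
  \sum_(i in A) f i = \sum_i chi A i * f i.
Proof.
rewrite big_mkcond /=; apply: eq_bigr => i _; rewrite /chi.
by case: ifP; rewrite ?mul1r ?mul0r.
Qed.

(** Weighted by the indicator of A, each face contributes its angles at the vertices of A, whose sum
    converges by [face_limit]. L is chosen before the filter and the sequence. *)
Lemma cvg_subset_curv (A : {set 'I_N}) : exists L : R,
  forall (U : set_system nat) (PU : ProperFilter U) (s : nat -> 'I_N -> R),
  (forall n i, dom bg (s n i)) ->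
  (forall i, vanishing_or bg (F := U) (i \in A) (fun n => s n i)) ->
  \sum_(i in A) curv T I bg (s n) i @[n --> U] --> L.
Proof.
have exL (x : 'I_N * 'I_N * 'I_N) : exists L : R, face T x.1.1 x.1.2 x.2 ->
  forall (U : set_system nat) (PU : ProperFilter U) (s : nat -> 'I_N -> R),
  (forall n i, dom bg (s n i)) ->
  (forall i, vanishing_or bg (F := U) (i \in A) (fun n => s n i)) ->
  face_sum I bg (chi A) (s n) x.1.1 x.1.2 x.2 @[n --> U] --> L.
  case: x => -[i j] k /=; have [f|] := boolP (face T i j k); last by exists 0.
  have [a0 b0 c0] := face_I I_ge0 f.
  have [L h] := face_limit bg (i \in A) (j \in A) (k \in A) a0 b0 c0.
  exists L => _ U PU s ds vs.
  have := h _ U PU (fun n => s n i) (fun n => s n j) (fun n => s n k)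
    (fun n => ds n i) (fun n => ds n j) (fun n => ds n k) (vs i) (vs j) (vs k).
  rewrite /face_sum /vang.
  by rewrite ![[set j; i]%SET]finset.setUC ![[set k; j]%SET]finset.setUC ![[set k; i]%SET]finset.setUC.
have [L hL] := choice exL.
exists (2 * pi * \sum_i chi A i - (\sum_i \sum_j \sum_(k | face T i j k) L (i, j, k)) / 6).
move=> U PU s ds vs.
under eq_fun do rewrite sum_chi curv_weighted.
apply: cvgBf; first exact: cvg_cst.
apply: cvgMf; last exact: cvg_cst.
apply: cvg_sumf => i _; apply: cvg_sumf => j _; apply: cvg_sumf => k f.
exact: (hL (i, j, k)).
Qed.

(** The limit is not computed. Being common to all ways of shrinking A, it is estimated on the ray
    from [sb] that shrinks A, where [curv_coercive_ray] provides the gap [nfaces w]. The gap is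
    positive because w is not constant, or because [nform] also sees constants in hyperbolic
    geometry. *)
Lemma subset_curvature (A : {set 'I_N}) : A != finset.set0 ->
  A != [set: 'I_N]%SET \/ bg = Hyperbolic ->
  exists2 c, 0 < c & forall m M, 0 < m -> kap bg * M < 1 -> exists2 d, 0 < d &
  forall s, (forall i, dom bg (s i)) -> (forall i, i \in A -> s i <= d) ->
    (forall i, i \notin A -> m <= s i <= M) ->
    \sum_(i in A) curv T I bg s i <= \sum_(i in A) curv T I bg sb i - c.
Proof.
move=> A0 AT; have [e e0 he] := curv_coercive_ray I_ge0 dsb nd.
pose w i : R := if i \in A then - e else 0.
have w0 i : w i <= 0 by rewrite /w; case: ifP => // _; rewrite oppr_le0 ltW.
have we i : `|w i| <= e.
  by rewrite /w; case: ifP => _; rewrite ?normrN ?normr0 ?gtr0_norm// ltW.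
have nw : 0 < nfaces T bg w.
  have [AT'|AT'] := boolP (A != [set: 'I_N]%SET).
    have [i [j [k [iA jA f]]]] := boundary_face T A0 AT'.
    apply: lt_le_trans (nfaces_ge bg w f); rewrite /nform -!addrA ltr_pwDl//.
      by rewrite /w iA (negbTE jA) subr0 sqrrN exprn_gt0.
    have k0 := @kap_ge0 R bg; nneg.
  have E : bg = Hyperbolic by case: AT => //; rewrite (negbTE AT').
  have /set0Pn[i iA] := A0.
  apply: lt_le_trans (nfaces_hyperbolic T w i E).
  by rewrite /w iA sqrrN exprn_gt0.
have sw (f : 'I_N -> R) : \sum_i w i * f i = - e * \sum_(i in A) f i.
  rewrite [in RHS]big_mkcond mulr_sumr; apply: eq_bigr => i _.
  by rewrite /w; case: ifP; rewrite ?mul0r ?mulr0.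
have [L hL] := cvg_subset_curv A.
pose ray n := shifted sb (fun i => n.+1%:R * w i).
have dray n i : dom bg (ray n i).
  apply: dom_le (dsb i) _ _; rewrite /ray /shifted.
    by rewrite mulr_gt0 ?expR_gt0 ?(dom_gt0 (dsb i)).
  rewrite ler_piMr ?(ltW (dom_gt0 (dsb i)))// -expR0 ler_expR.
  by rewrite mulr_ge0_le0.
have hray n : \sum_(i in A) curv T I bg (ray n) i
    <= \sum_(i in A) curv T I bg sb i - nfaces T bg w.
  have := he w n.+1%:R we _ (dray n); rewrite sw => h.
  have {h} := h (ler1n _ _ : 1 <= n.+1%:R :> R).
  rewrite mulNr -mulrN ler_pM2l// sumrB; lra.
have vray (U : set_system nat) : UltraFilter U -> \oo `<=` U -> forall i,
    vanishing_or bg (F := U) (i \in A) (fun n => ray n i).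
  move=> UU sU i; rewrite /vanishing_or /ray /shifted /w; case: ifP => iA; last first.
    exists (sb i) => //; under eq_fun do rewrite iA mulr0 expR0 mulr1.
    exact: cvg_cst.
  have h : e * expR (n.+1%:R * - e) @[n --> U] --> (0 : R).
    apply: ultra_vanish => // n; rewrite mulr_ge0 ?expR_ge0 ?(ltW e0)//=.
    rewrite mulrN expRN ler_pdivrMr ?expR_gt0//.
    rewrite ler_pdivlMl ?ltr0n//.
    by have := expR_ge1Dx (n.+1%:R * e); lra.
  under eq_fun do rewrite iA.
  have -> : (fun n => sb i * expR (n.+1%:R * - e))
      = (fun n => sb i / e * (e * expR (n.+1%:R * - e))).
    by apply/funext => n; field; rewrite gt_eqF.
  have := cvgMf (f := fun=> sb i / e) (cvg_cst _) h; rewrite mulr0; exact.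
(* Half of the gap; the other half absorbs the passage to the limit. This constant is chosen before
   m and M. *)
exists (nfaces T bg w / 2); first by rewrite divr_gt0.
move=> m M m0 M1; apply: contrapT => nex.
(* Counterexamples with d = 1 / (n + 1) form a sequence that shrinks A, hence one with the same
   limit as the ray. *)
have bad n : exists s, [/\ forall i, dom bg (s i), forall i, i \in A -> s i <= n.+1%:R^-1,
    forall i, i \notin A -> m <= s i <= M &
    \sum_(i in A) curv T I bg sb i - nfaces T bg w / 2 < \sum_(i in A) curv T I bg s i].
  apply: contrapT => h; apply: nex; exists n.+1%:R^-1; first by rewrite invr_gt0.
  by move=> s h1 h2 h3; rewrite leNgt; apply/negP => h4; apply: h; exists s.
have [s hs] := choice bad.
have [U [UU sU]] := ultra_nat.
have PU : ProperFilter U by exact: ultra_proper.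
have l1 := hL U PU ray dray (vray U UU sU).
have ds n i : dom bg (s n i) by have [h] := hs n.
have vs i : vanishing_or bg (F := U) (i \in A) (fun n => s n i).
  rewrite /vanishing_or; case: ifP => iA.
    apply: ultra_vanish => // n; have [h1 h2 _ _] := hs n.
    by rewrite h2// andbT ltW// (dom_gt0 (h1 i)).
  have [|l lI sl] := @ultra_bounded R U (fun n => s n i) m M UU.
    by move=> n; have [_ _ h _] := hs n; apply: h; rewrite iA.
  exists l => //; rewrite /dom; case/andP: lI => ml lM.
  by rewrite (lt_le_trans m0)//= (le_lt_trans _ M1)// ler_wpM2l ?kap_ge0.
have l2 := hL U PU s ds vs.
have FU : Filter U by exact: filter_filter.
have l3 := @cvgBf _ _ U FU _ _ _ _ l2 l1; rewrite subrr in l3.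
have n2 : 0 < nfaces T bg w / 2 by rewrite divr_gt0.
move/cvgrPdist_lt: l3 => /(_ _ n2) l4.
have : U set0.
  apply: filterS l4 => n /= h1; have [_ _ _ h2] := hs n; have h3 := hray n.
  move: h1; rewrite sub0r normrN => /(le_lt_trans (ler_norm _)).
  lra.
by have := @filter_not_empty _ U PU; apply.
Qed.

End SubsetCurvature.

(** * Curvature at large hyperbolic radii, and total Euclidean curvature *)

Lemma carg_ge_large {R : realType} (a b c : R) p q r : 0 <= a -> 0 <= b -> 0 <= c ->
  onk 1 p -> onk 1 q -> onk 1 r -> (1 + a) / p.2 ^+ 2 <= 1 ->
  1 - (1 + a) / p.2 ^+ 2 <= carg 1 a b c p q r.
Proof.
move=> a0 b0 c0 hp hq hr h.
have k0 : 0 <= 1 :> R by [].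
have L := ncos_cosine_law a b c hp hq hr; rewrite mul1r in L.
have E12 := qlen_ccosh c hp hq; have E13 := qlen_ccosh b hp hr.
rewrite mul1r in E12; rewrite mul1r in E13.
have C12 := ccosh_ge k0 c0 hp hq; have C13 := ccosh_ge k0 b0 hp hr.
have q12 := qlen_gt0 k0 c0 hp hq; have q13 := qlen_gt0 k0 b0 hp hr.
rewrite /carg ler_pdivlMr ?mulr_gt0 ?sqrtr_gt0// {}L.
have S (q' C : R) : 0 <= C -> q' = C ^+ 2 - 1 -> Num.sqrt q' <= C.
  by move=> C0 ->; rewrite -[leRHS]ger0_norm// -sqrtr_sqr ler_wsqrtr// gerBl.
have C12p := le_trans ler01 (ccosh_ge1 k0 c0 hp hq).
have C13p := le_trans ler01 (ccosh_ge1 k0 b0 hp hr).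
have S12 := S _ _ C12p E12; have S13 := S _ _ C13p E13.
have U12 := sqrtr_ge0 (qlen 1 c p q); have U13 := sqrtr_ge0 (qlen 1 b p r).
(* The cosine misses 1 by at most [C23 / (C12 * C13)], and the denominator is at least
   [p.2 ^+ 2 * q.2 * r.2]; this bound on the numerator removes q and r from the quotient. *)
have C23 : ccosh 1 a q r <= (1 + a) * (q.2 * r.2).
  have le12 p' : onk (1 : R) p' -> p'.1 <= p'.2.
    case=> x0 X0 e; have X0' := le_trans ler01 X0.
    by rewrite -(@ler_pXn2r _ 2)// ?nnegrE ?(ltW x0)// e mul1r lerDr.
  rewrite /ccosh mul1r mulrDl mul1r lerD2l -mulrA ler_wpM2l// ler_pM ?le12//.
    by case: hq => /ltW.
  by case: hr => /ltW.
have P2 : 1 <= p.2 by case: hp.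
have Q2 : 1 <= q.2 by case: hq.
have R2 : 1 <= r.2 by case: hr.
have P1 : (p.2 * q.2) * (p.2 * r.2) <= ccosh 1 c p q * ccosh 1 b p r.
  by rewrite ler_pM// mulr_ge0// (le_trans ler01).
move: h P1 C23 U12 U13 S12 S13 P2 Q2 R2 C12p C13p {S E12 E13 C12 C13 q12 q13 hp hq hr}.
move: (Num.sqrt (qlen 1 c p q)) (Num.sqrt (qlen 1 b p r)) => s12 s13.
move: (ccosh 1 a q r) (ccosh 1 b p r) (ccosh 1 c p q) => C23 C13 C12.
move: p.2 (q.2) (r.2) => X Y Z.
move=> h P1 hC23 U12 U13 S12 S13 X0 Y0 Z0 o12 o13.
have X2 : 0 < X ^+ 2 by rewrite exprn_gt0//; lra.
have h1 : (1 + a) * (Y * Z) <= (1 + a) / X ^+ 2 * (C12 * C13).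
  have a1 : 0 < 1 + a by lra.
  by rewrite -mulrA ler_pM2l// ler_pdivlMl//; lra.
have h3 : s12 * s13 <= C12 * C13 by rewrite ler_pM.
have h' : 0 <= 1 - (1 + a) / X ^+ 2 by lra.
have h4 := ler_wpM2l h' h3.
lra.
Qed.

(** A scaled radius near 1 is a large hyperbolic radius, and the angle at the centre of a large
    circle is small, uniformly in the other two circles. *)
Lemma sang_le_near_one {R : realType} (a e : R) : 0 <= a -> 0 < e ->
  exists2 d, 0 < d & forall b c x y z : R, 0 <= b -> 0 <= c ->
    dom Hyperbolic x -> dom Hyperbolic y -> dom Hyperbolic z ->
    1 - d <= x -> sang Hyperbolic a b c x y z <= e.
Proof.
move=> a0 e0; have [d d0 hd] := acosc_unif e0.
pose d' := Num.min (d / 2) 1.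
have d'0 : 0 < d' by rewrite lt_min ltr01 andbT divr_gt0.
have d'd : d' < d.
  by apply: (@le_lt_trans _ _ (d / 2)); [rewrite ge_min lexx|lra].
have d'1 : d' <= 1 by rewrite ge_min lexx orbT.
have A0 : 0 < 2 * (1 + a) by lra.
(* The inverse of cosh r is (1 - x^2) / (1 + x^2), at most 2 (1 - x). *)
exists (d' / (2 * (1 + a))); first by rewrite divr_gt0.
move=> b c x y z b0 c0 dx dy dz xd.
have X1 : (1 + a) / (pt Hyperbolic x).2 ^+ 2 <= d'.
  case/andP: dx => x0; rewrite /kap mul1r => x1.
  have x2 := sqr_ge0 x.
  rewrite /pt /=; have u0 : 0 < 1 - x ^+ 2 by rewrite subr_gt0 expr_lt1// ltW.
  have hx : (1 - x) * (2 * (1 + a)) <= d' by rewrite -ler_pdivlMr//; lra.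
  have h1 : 1 - x ^+ 2 <= 2 * (1 - x) by have := sqr_ge0 (1 - x); lra.
  have h2 : (1 - x ^+ 2) * (1 + a) <= d'.
    by apply: le_trans hx; rewrite mulrCA mulrA ler_wpM2r//; lra.
  rewrite expr_div_n invf_div mulrA ler_pdivrMr ?exprn_gt0//; last by lra.
  apply: le_trans (_ : (1 + a) * (1 - x ^+ 2) <= _).
    by rewrite ler_wpM2l ?expr2 ?ler_piMl//; lra.
  rewrite mulrC (le_trans h2)// ler_peMr ?(ltW d'0)//.
  by rewrite expr_ge1//; lra.
have [hp [hq hr]] := (onk_pt dx, (onk_pt dy, onk_pt dz)).
have C := carg_ge_large a0 b0 c0 hp hq hr (le_trans X1 d'1).
rewrite /sang /tang /kap; set t := carg _ _ _ _ _ _ _ in C *.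
have {}C : 1 - d' <= t by apply: le_trans C; rewrite lerD2l lerN2.
have [h1|h1] := leP 1 t; first by rewrite acosc_ge1// ltW.
have h2 : `|t - 1| < d by rewrite ltr_norml; apply/andP; split; lra.
have := hd _ _ h2; rewrite (acosc_ge1 (lexx 1)) subr0 => /ltW; apply: le_trans.
exact: ler_norm.
Qed.

Section Extremes.
Context {R : realType} {N : nat}.
Variables (T : triangulation N) (I : {set 'I_N} -> R).
Hypothesis I_ge0 : forall e, e \in edges T -> 0 <= I e.
Implicit Types (i j k : 'I_N) (s : 'I_N -> R).

Lemma curv_gt0_near_one : exists2 d, 0 < d & forall s i,
  (forall i, dom Hyperbolic (s i)) -> 1 - d <= s i -> 0 < curv T I Hyperbolic s i.
Proof.
pose n := #|{: 'I_N * 'I_N}|.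
(* At most n angles meet at a vertex, so angles bounded by e add up to at most pi, half of what
   positivity allows. *)
pose e : R := pi / n.+1%:R.
have e0 : 0 < e by rewrite divr_gt0 ?pi_gt0.
pose P (x : 'I_N * 'I_N * 'I_N) d := face T x.1.1 x.1.2 x.2 -> forall s,
  (forall i, dom Hyperbolic (s i)) -> 1 - d <= s x.1.1 ->
  vang I Hyperbolic s x.1.1 x.1.2 x.2 <= e.
have [|x d d' h d'0 dd' f s ds sd|d d0 hd] := @uniform_pos R _ P.
- case=> -[i j] k; rewrite /P /=; have [f|] := boolP (face T i j k); last by exists 1.
  have [a0 b0 c0] := face_I I_ge0 f.
  have [d d0 hd] := sang_le_near_one a0 e0.
  by exists d => // _ s ds sd; apply: hd.
- by apply: h => //; lra.
exists d => // s i ds sd; rewrite /curv subr_gt0.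
apply: le_lt_trans (_ : pi < _); last by have := pi_gt0 R; lra.
apply: le_trans (_ : \sum_(p : 'I_N * 'I_N) e <= _).
  rewrite big_mkcond /=; apply: ler_sum => -[j k] _ /=; case: ifP => [/andP[_ f]|_].
    exact: (hd (i, j, k)).
  exact: ltW.
rewrite sumr_const -/n -mulr_natr /e mulrAC ler_pdivrMr ?ltr0n//.
by rewrite ler_wpM2l ?pi_ge0// ler_nat.
Qed.

Lemma sang_sum_euclidean (a b c x y z : R) : 0 <= a -> 0 <= b -> 0 <= c ->
  0 < x -> 0 < y -> 0 < z ->
  sang Euclidean a b c x y z + sang Euclidean b a c y x z + sang Euclidean c a b z x y = pi.
Proof.
move=> a0 b0 c0 x0 y0 z0.
have d (t : R) : 0 < t -> dom Euclidean t by move=> t0; rewrite /dom t0 /= mul0r ltr01.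
apply/eqP; rewrite eq_le sang_sum_le_pi ?d//=.
apply/ler_addgt0Pr => e e0.
have [dd dd0 H] := tang_sum_ge (@kap_ge0 R Euclidean) e0.
have := H a b c _ _ _ a0 b0 c0 (onk_pt (d _ x0)) (onk_pt (d _ y0)) (onk_pt (d _ z0)).
rewrite /ccosh /= !mul0r addr0 mulr1 subrr => /(_ dd0).
by rewrite lerBlDr.
Qed.

(** Combinatorial Gauss-Bonnet: with extended angles, every face has angle sum pi, degenerate ones
    included. *)
Lemma curv_total_euclidean s s' : (forall i, 0 < s i) -> (forall i, 0 < s' i) ->
  \sum_i curv T I Euclidean s i = \sum_i curv T I Euclidean s' i.
Proof.
suff E t : (forall i, 0 < t i) -> \sum_i curv T I Euclidean t i
    = 2 * pi * \sum_(i < N) 1 - (\sum_i \sum_j \sum_(k | face T i j k) pi) / 6.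
  by move=> h h'; rewrite (E s)// (E s').
move=> t0; under eq_bigr do rewrite -[curv _ _ _ _ _]mul1r.
rewrite (curv_weighted T I Euclidean (fun=> 1)); congr (_ - _ / _).
apply: eq_bigr => i _; apply: eq_bigr => j _; apply: eq_bigr => k f.
have [a0 b0 c0] := face_I I_ge0 f.
rewrite /face_sum !mul1r -(sang_sum_euclidean a0 b0 c0 (t0 i) (t0 j) (t0 k)) /vang.
by rewrite ![[set j; i]%SET]finset.setUC ![[set k; j]%SET]finset.setUC ![[set k; i]%SET]finset.setUC.
Qed.

End Extremes.

(** * The flow *)

Section Peano.
Context {R : realType} {J : finType}.
Implicit Types (x y : J -> R) (i : J).
Variables (f : (J -> R) -> J -> R) (M : R) (x0 : J -> R).
Hypothesis M0 : 0 < M.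
Hypothesis f_bound : forall x i, `|f x i| <= M.
Hypothesis f_cont : forall x (e : R), 0 < e -> exists2 d : R, 0 < d &
  forall y, (forall i, `|y i - x i| <= d) -> forall i, `|f y i - f x i| <= e.

Let euler (h : R) (n : nat) : J -> R := iter n (fun y i => y i + h * f y i) x0.

Let euler_lip (h : R) n m i : 0 <= h -> (n <= m)%N ->
  `|euler h m i - euler h n i| <= M * h * (m%:R - n%:R).
Proof.
move=> h0 /subnK <-; elim: (m - n)%N => [|d ih].
  by rewrite add0n !subrr normr0 mulr0.
rewrite addSn [euler h _.+1]/euler iterS -/(euler h (d + n)).
rewrite -addrA [h * _ + _]addrC addrA.
apply: le_trans (ler_normD _ _) _.
have := f_bound (euler h (d + n)) i => /(ler_wpM2l h0) hf.
rewrite normrM (ger0_norm h0) -[(d + n).+1]addn1 natrD; lra.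
Qed.

Let euler_step (h : R) n m i (v e : R) : 0 <= h -> (n <= m)%N ->
  (forall l, (n <= l < m)%N -> `|f (euler h l) i - v| <= e) ->
  `|euler h m i - euler h n i - h * (m%:R - n%:R) * v| <= e * h * (m%:R - n%:R).
Proof.
move=> h0 /subnK <-; elim: (m - n)%N => [|d ih] H.
  by rewrite add0n !subrr !(mulr0, mul0r) subr0 normr0.
have {}ih : `|euler h (d + n) i - euler h n i - h * ((d + n)%:R - n%:R) * v|
    <= e * h * ((d + n)%:R - n%:R).
  by apply: ih => l /andP[nl ld]; apply: H; rewrite nl addSn ltnW.
have {}H : `|f (euler h (d + n)) i - v| <= e by apply: H; rewrite leq_addl addSn leqnn.
rewrite addSn [euler h _.+1]/euler iterS -/(euler h (d + n)) -[(d + n).+1]addn1 natrD.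
have -> : euler h (d + n) i + h * f (euler h (d + n)) i - euler h n i
    - h * ((d + n)%:R + 1 - n%:R) * v
  = (euler h (d + n) i - euler h n i - h * ((d + n)%:R - n%:R) * v)
    + h * (f (euler h (d + n)) i - v) by ring.
apply: le_trans (ler_normD _ _) _; rewrite normrM (ger0_norm h0).
have := ler_wpM2l h0 H; lra.
Qed.

Let mesh (n : nat) : R := n.+1%:R^-1.

Let mesh_gt0 n : 0 < mesh n. Proof. by rewrite invr_gt0. Qed.

(** A step function through the nodes of the Euler scheme; its jumps vanish with the mesh, so
    interpolating would not change the limit. *)
Let approx n (t : R) : J -> R := euler (mesh n) (Num.truncn (t / mesh n)).

Let approx_time n (t : R) : 0 <= t ->
  t - mesh n <= mesh n * (Num.truncn (t / mesh n))%:R <= t.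
Proof.
move=> t0; have m0 := mesh_gt0 n.
have /truncn_itv/andP[h1 h2] : 0 <= t / mesh n by rewrite divr_ge0// ltW.
move: h1; rewrite ler_pdivlMr// => h1.
move: h2; rewrite -natr1 ltr_pdivrMr// => h2; lra.
Qed.

Let approx_bound n (t : R) i : 0 <= t -> `|approx n t i - x0 i| <= M * t.
Proof.
move=> t0; have /andP[_ h] := approx_time n t0.
apply: le_trans (euler_lip i (ltW (mesh_gt0 n)) (leq0n _)) _.
by rewrite subr0 -mulrA ler_pM2l.
Qed.

(* The solution is an ultrafilter limit of Euler polygons. The derivative is
   one-sided at 0. *)
Theorem peano : exists x : R -> J -> R, x 0 = x0 /\ forall s, 0 <= s ->
  forall e : R, 0 < e -> exists2 d, 0 < d & forall t, 0 <= t -> `|t - s| <= d ->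
  forall i, `|x t i - x s i - (t - s) * f (x s) i| <= e * `|t - s|.
Proof.
have [U [UU sU]] := ultra_nat.
have PU : ProperFilter U by exact: ultra_proper.
have FU : Filter U by exact: filter_filter.
have lim (p : R * J) : exists l : R, 0 <= p.1 -> approx n p.1 p.2 @[n --> U] --> l.
  case: p => t i /=; have [t0|t0] := leP 0 t; last by exists 0 => ?; lra.
  have [|l _ hl] := @ultra_bounded R U (fun n => approx n t i) (x0 i - M * t) (x0 i + M * t) UU.
    by move=> n; have := approx_bound n i t0; rewrite ler_distl.
  by exists l.
have [g hg] := choice lim.
pose x t i := g (t, i).
have xlim t i : 0 <= t -> approx n t i @[n --> U] --> x t i := fun t0 => hg (t, i) t0.
have near_lim t (e : R) : 0 <= t -> 0 < e -> U [set n | forall i, `|x t i - approx n t i| < e].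
  move=> t0 e0; have : \forall n \near U, forall i, i \in enum J -> `|x t i - approx n t i| < e.
    elim: (enum J) => [|i q ih]; first by apply: filterE.
    move/cvgrPdist_lt: (xlim t i t0) => /(_ e e0); apply: filterS2 ih => n h1 h2 j.
    by rewrite inE => /predU1P[->|/h1].
  by apply: filterS => n h i; apply: h; exact: mem_enum.
have near_mesh (e : R) : 0 < e -> U [set n | mesh n < e].
  by move=> e0; apply: sU; exact: near_infty_natSinv_lt (PosNum e0).
exists x; split.
  apply/funext => i; apply/eqP; rewrite -subr_eq0 -normr_le0; apply/ler_addgt0Pr => e e0.
  have [n /= hn] := filter_ex (near_lim 0 e (lexx 0) e0).
  have := hn i; rewrite add0r /approx mul0r truncn0 /= => /ltW; exact.
move=> s s0 e e0.
have e2 : 0 < e / 2 by rewrite divr_gt0.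
have [d d0 hd] := f_cont (x s) e2.
have d4 : 0 < d / 4 by rewrite divr_gt0.
(* Euler points between s and t stay within d of [x s]: [M * |t - s|], [M * mesh n] and the error of
   approximation at s are each at most d / 4. *)
exists (d / (4 * M)); first by rewrite divr_gt0// mulr_gt0.
move=> t t0 ts i.
have tsM : M * `|t - s| <= d / 4.
  by move: ts; rewrite ler_pdivlMr ?mulr_gt0//; lra.
suff : `|x t i - x s i - (t - s) * f (x s) i| <= e / 2 * `|t - s|.
  by move=> /le_trans; apply; rewrite ler_wpM2r//; lra.
(* The slack c pays for the two approximations and for the mesh; n depends on it, the radius of the
   neighbourhood does not. *)
apply/ler_addgt0Pr => c c0.
have c3 : 0 < c / 3 by rewrite divr_gt0.
have Mh : 0 < c / 3 / (e / 2 + M) by rewrite divr_gt0// addr_gt0.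
have dM : 0 < d / 4 / M by rewrite divr_gt0.
have FI := @filterI _ U FU.
have [n [/= h1 [/= h2 [/= h3 [/= h4 h5]]]]] := filter_ex
  (FI _ _ (near_lim s _ s0 d4) (FI _ _ (near_lim s _ s0 c3) (FI _ _ (near_lim t _ t0 c3)
    (FI _ _ (near_mesh _ Mh) (near_mesh _ dM))))).
have m0 := mesh_gt0 n.
have {}h4 : mesh n * (e / 2 + M) < c / 3 by rewrite -ltr_pdivlMr// addr_gt0.
have {}h5 : M * mesh n < d / 4 by rewrite mulrC -ltr_pdivlMr.
have /andP[s1 s2] := approx_time n s0; have /andP[t1 t2] := approx_time n t0.
set j := Num.truncn (s / mesh n) in s1 s2; set k := Num.truncn (t / mesh n) in t1 t2.
have ts1 := ler_norm (t - s); have ts2 := ler_norm (s - t); rewrite distrC in ts2.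
have step (a b : nat) : (a <= b)%N -> (a <= j <= b)%N ->
    mesh n * (b%:R - a%:R) <= `|t - s| + mesh n ->
    `|euler (mesh n) b i - euler (mesh n) a i - mesh n * (b%:R - a%:R) * f (x s) i|
    <= e / 2 * (`|t - s| + mesh n).
  move=> ab /andP[aj jb] hab.
  apply: le_trans (euler_step (v := f (x s) i) (e := e / 2) (ltW m0) ab _) _; last first.
    by rewrite -mulrA ler_pM2l.
  move=> l /andP[al lb]; apply: hd => i'.
  have : `|euler (mesh n) l i' - euler (mesh n) j i'| <= M * (mesh n * (b%:R - a%:R)).
    have [jl|lj] := leqP j l.
      apply: le_trans (euler_lip i' (ltW m0) jl) _; rewrite -mulrA ler_pM2l// ler_pM2l//.
      by rewrite lerB ?ler_nat// ltnW.
    rewrite distrC; apply: le_trans (euler_lip i' (ltW m0) (ltnW lj)) _.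
    by rewrite -mulrA ler_pM2l// ler_pM2l// lerB ?ler_nat.
  have := ler_wpM2l (ltW M0) hab; rewrite mulrDr => g1 g2.
  have g3 := h1 i'; rewrite distrC in g3.
  have := ler_normD (euler (mesh n) l i' - euler (mesh n) j i') (approx n s i' - x s i').
  rewrite /approx -/j addrA subrK => g4.
  move: g3; rewrite /approx -/j; lra.
have key : `|approx n t i - approx n s i - (t - s) * f (x s) i|
    <= e / 2 * (`|t - s| + mesh n) + mesh n * M.
  rewrite /approx -/j -/k.
  have G : `|euler (mesh n) k i - euler (mesh n) j i - mesh n * (k%:R - j%:R) * f (x s) i|
      <= e / 2 * (`|t - s| + mesh n).
    have [jk|kj] := leqP j k.
      by apply: step; rewrite ?leqnn//; lra.
    have -> : euler (mesh n) k i - euler (mesh n) j i - mesh n * (k%:R - j%:R) * f (x s) i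
      = - (euler (mesh n) j i - euler (mesh n) k i - mesh n * (j%:R - k%:R) * f (x s) i) by ring.
    by rewrite normrN; apply: step; rewrite ?(ltnW kj) ?leqnn//; lra.
  have E : euler (mesh n) k i - euler (mesh n) j i - (t - s) * f (x s) i
    = (euler (mesh n) k i - euler (mesh n) j i - mesh n * (k%:R - j%:R) * f (x s) i)
      + (mesh n * (k%:R - j%:R) - (t - s)) * f (x s) i by ring.
  rewrite E; apply: le_trans (ler_normD _ _) _; apply: lerD => //.
  by rewrite normrM ler_pM// ler_norml; apply/andP; split; lra.
have k2 := h2 i; have k3 := h3 i; rewrite distrC in k2.
have := ler_normD (x t i - approx n t i) (approx n s i - x s i).
have := ler_normD (x t i - approx n t i + (approx n s i - x s i))
  (approx n t i - approx n s i - (t - s) * f (x s) i).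
have -> : x t i - approx n t i + (approx n s i - x s i)
   + (approx n t i - approx n s i - (t - s) * f (x s) i)
  = x t i - x s i - (t - s) * f (x s) i by ring.
lra.
Qed.

End Peano.

(** * Differential inequalities along a path *)

Section Paths.
Context {R : realType}.
Implicit Types (y : R -> R) (tau : \bar R).

Lemma is_derive_eps y (s v : R) :
  (forall e : R, 0 < e -> exists2 d : R, 0 < d & forall t, `|t - s| <= d ->
     `|y t - y s - (t - s) * v| <= e * `|t - s|) -> is_derive s 1 y v.
Proof.
move=> H.
have L : h^-1 *: (y (h *: (1 : R) + s) - y s) @[h --> (0:R)^'] --> v.
  apply/cvgrPdist_le => e e0; have [d d0 hd] := H e e0.
  near=> h.
  have h0 : h != 0 by near: h; exact: nbhs_dnbhs_neq.
  have hl : `|h| <= d.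
    by near: h; exact: dnbhs0_le.
  have := hd (h + s); rewrite addrK => /(_ hl) {}hd.
  rewrite /GRing.scale/= mulr1.
  have -> : v - h^-1 * (y (h + s) - y s) = - (h^-1 * (y (h + s) - y s - h * v)).
    by field => //.
  by rewrite normrN normrM normfV ler_pdivrMl ?normr_gt0// (mulrC _ e).
apply: DeriveDef; first by apply/cvg_ex; exists v; exact: L.
exact: cvg_lim L.
Unshelve. all: by end_near.
Qed.

Lemma is_derive_max0_sqr (x : R) : is_derive x 1 (fun z => Num.max 0 z ^+ 2) (2 * Num.max 0 x).
Proof.
apply: is_derive_eps => e e0; exists e => // t te.
apply: (@le_trans _ _ (`|t - x| * `|t - x|)); last by rewrite ler_wpM2r.
have -> : `|t - x| * `|t - x| = (t - x) ^+ 2 by rewrite -normrM -expr2 ger0_norm ?sqr_ge0.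
clear te; have := sqr_ge0 (t - x); have := sqr_ge0 t; have := sqr_ge0 x; rewrite ler_norml => *.
by apply/andP; case: (leP 0 t) => t0; case: (leP 0 x) => x0; (have : 0 <= `|t| * `|x| by nneg);
  rewrite ?(ger0_norm t0) ?(ger0_norm x0) ?(ltr0_norm t0) ?(ltr0_norm x0); split; nra.
Qed.

(** At 0 only right continuity is recorded, as in the definition of a solution of the flow. *)
Definition path_on tau y (y' : R -> R) : Prop :=
  y t @[t --> 0^'+] --> y 0 /\
  forall t, 0 < t -> (t%:E < tau)%E -> is_derive t 1 y (y' t).

Lemma path_cvg tau y y' t : path_on tau y y' -> 0 < t -> (t%:E < tau)%E -> y x @[x --> t] --> y t.
Proof.
move=> [_ h] t0 tt'; have [dy _] := h t t0 tt'.
by apply: differentiable_continuous; apply/derivable1_diffP.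
Qed.

Lemma path_nonincreasing tau y y' a b : path_on tau y y' -> 0 <= a -> a <= b -> (b%:E < tau)%E ->
  (forall t, a < t < b -> y' t <= 0) -> y b <= y a.
Proof.
move=> P a0; rewrite le_eqVlt => /predU1P[->//|ab] bt H.
have lt_tau t : t <= b -> (t%:E < tau)%E by move=> tb; apply: le_lt_trans bt; rewrite lee_fin.
apply: (le_of_derive_le0 (f' := y') (ltW ab)) => //; last first.
  move=> t /andP[ta tb]; apply: P.2; first exact: le_lt_trans ta.
  by apply: lt_tau; exact: ltW.
apply: derivable_oo_LRcontinuous_within; split.
- move=> t; rewrite in_itv/= => /andP[ta tb].
  by have [] := P.2 t (le_lt_trans a0 ta) (lt_tau _ (ltW tb)).
- move: a0; rewrite le_eqVlt => /predU1P[<-|a0]; first exact: P.1.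
  apply: cvg_at_right_filter; exact: path_cvg P a0 (lt_tau _ (ltW ab)).
- apply: cvg_at_left_filter; apply: path_cvg P _ bt; exact: le_lt_trans ab.
Qed.

Lemma path_comp tau (phi phi' : R -> R) y y' : path_on tau y y' ->
  (forall t, 0 <= t -> (t%:E < tau)%E -> is_derive (y t) 1 phi (phi' (y t))) -> (0 < tau)%E ->
  path_on tau (phi \o y) (fun t => phi' (y t) * y' t).
Proof.
move=> P dphi tau0; split=> [|t t0 tt'] /=.
  apply: continuous_cvg P.1; have [d _] := dphi 0 (lexx 0) tau0.
  by apply: differentiable_continuous; apply/derivable1_diffP.
have d1 := dphi t (ltW t0) tt'; have d2 := P.2 t t0 tt'.
by apply: is_derive_eq; rewrite mulrC.
Qed.

Lemma path_add tau y z y' z' : path_on tau y y' -> path_on tau z z' ->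
  path_on tau (fun t => y t + z t) (fun t => y' t + z' t).
Proof.
move=> P Q; split; first by apply: cvgD; [exact: P.1|exact: Q.1].
by move=> t t0 tt'; have := P.2 t t0 tt'; have := Q.2 t t0 tt' => *; apply: is_deriveD.
Qed.

Lemma path_sum (J : Type) tau (q : seq J) (p : pred J) (y y' : J -> R -> R) :
  (forall i, p i -> path_on tau (y i) (y' i)) ->
  path_on tau (fun t => \sum_(i <- q | p i) y i t) (fun t => \sum_(i <- q | p i) y' i t).
Proof.
move=> P; elim: q => [|j q ih].
  rewrite (_ : (fun t => _) = cst 0); last by apply/funext => t; rewrite big_nil.
  split; first exact: cvg_cst.
  by move=> t _ _; rewrite big_nil; exact: is_derive_cst.
have E (u : J -> R -> R) : (fun t => \sum_(i <- j :: q | p i) u i t)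
  = if p j then fun t => u j t + \sum_(i <- q | p i) u i t
    else fun t => \sum_(i <- q | p i) u i t.
  by case: ifPn => pj; apply/funext => t; rewrite big_cons ?pj// (negbTE pj).
by rewrite !E; case: ifPn => // pj; apply: path_add => //; exact: P.
Qed.

Lemma path_eq tau y y' z' : path_on tau y y' ->
  (forall t, 0 < t -> (t%:E < tau)%E -> y' t = z' t) -> path_on tau y z'.
Proof.
by move=> P E; split=> [|t t0 tt']; [exact: P.1|rewrite -E//; exact: P.2].
Qed.

Lemma path_opp tau y y' : path_on tau y y' -> path_on tau (fun t => - y t) (fun t => - y' t).
Proof.
move=> P; split; first by apply: cvgN; exact: P.1.
by move=> t t0 tt'; have := P.2 t t0 tt' => *; apply: is_deriveN.
Qed.

(* The function [max(0, m - y)^2] is continuously differentiable along the path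
   and does not increase. *)
Lemma path_barrier tau y y' (m : R) : path_on tau y y' -> m <= y 0 ->
  (forall t, 0 < t -> (t%:E < tau)%E -> y t < m -> 0 <= y' t) ->
  forall t, 0 <= t -> (t%:E < tau)%E -> m <= y t.
Proof.
move=> P y0 H t t0 tt'.
have tau0 : (0 < tau)%E by apply: le_lt_trans tt'; rewrite lee_fin.
have Q : path_on tau (fun t => m - y t) (fun t => 0 - y' t).
  apply: path_add (path_opp P); split; first exact: cvg_cst.
  by move=> *; exact: is_derive_cst.
have G := path_comp (phi' := fun x => 2 * Num.max 0 x) Q (fun t _ _ => is_derive_max0_sqr _) tau0.
have {G} := path_nonincreasing G (lexx 0) t0 tt'.
have -> : ((fun x : R => Num.max 0 x ^+ 2) \o (fun t => m - y t)) 0 = 0.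
  by rewrite /= (max_idPl _) ?expr0n//; lra.
move=> G; have {G} : ((fun x : R => Num.max 0 x ^+ 2) \o (fun t => m - y t)) t <= 0.
  apply: G => s /andP[s0 st].
  have [ys|ys] := leP m (y s); first by rewrite (max_idPl _) ?mulr0 ?mul0r//; lra.
  rewrite sub0r mulrN oppr_le0; apply: mulr_ge0.
    by apply: mulr_ge0 => //; rewrite le_max lexx.
  apply: H => //; apply: lt_trans tt'; by rewrite lte_fin.
by rewrite /=; case: (leP 0 (m - y t)) => ?; nra.
Qed.

End Paths.

(** * Entropy and its dissipation *)

Section Entropy.
Context {R : realType}.
Implicit Types b x y s : R.

(* Summed over the vertices, with x = g_i and b the value of g_i at the limit
   metric, this is the Lyapunov function of the flow. *)
Definition ent b x : R := x * ln (x / b) - x + b.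

Lemma is_derive_ent b x : 0 < b -> 0 < x -> is_derive x 1 (ent b) (ln (x / b)).
Proof.
move=> b0 x0; have xb : 0 < x / b by rewrite divr_gt0.
have d1 : is_derive x 1 (fun z : R => z / b) (b^-1).
  by apply: is_derive_eq; rewrite /GRing.scale/=; ring.
have d2 : is_derive (x / b) 1 (@ln R) ((x / b)^-1) by exact: is_derive1_ln.
have d3 : is_derive x 1 ((@ln R) \o (fun z : R => z / b)) ((x / b)^-1 * b^-1)
  by exact: (@is_derive1_comp _ _ (fun z : R => z / b) _ _ _ d2 d1).
have d4 : is_derive x 1 (fun z : R => z * ((@ln R) \o (fun z : R => z / b)) z) 
  (ln (x / b) + x * ((x / b)^-1 * b^-1)).
  apply: is_derive_eq; rewrite /GRing.scale/=; ring.
rewrite /ent; apply: is_derive_eq; rewrite /GRing.scale/=; field.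
by rewrite !lt0r_neq0.
Qed.

Lemma ln_ge_1BV x : 0 < x -> 1 - x^-1 <= ln x.
Proof.
move=> x0; have xv : 0 < x^-1 by rewrite invr_gt0.
have : -1 < x^-1 - 1 by lra.
by move=> /le_ln1Dx; rewrite addrC subrK lnV ?posrE//; lra.
Qed.

Lemma ln_sqr_div s b : 0 < s -> 0 < b -> ln (s ^+ 2 / b ^+ 2) = 2 * ln (s / b).
Proof.
by move=> s0 b0; rewrite -expr_div_n lnXn ?divr_gt0// mulr_natl.
Qed.

(** The inequality ln x >= 1 - 1 / x at x = s / b. *)
Lemma ent_ge s b : 0 < s -> 0 < b -> (s - b) ^+ 2 <= ent (b ^+ 2) (s ^+ 2).
Proof.
move=> s0 b0; rewrite /ent ln_sqr_div//.
have /ln_ge_1BV : 0 < s / b by rewrite divr_gt0.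
rewrite invf_div => h.
have : s ^+ 2 * (1 - b / s) <= s ^+ 2 * ln (s / b) by rewrite ler_wpM2l// sqr_ge0.
have -> : s ^+ 2 * (1 - b / s) = s ^+ 2 - s * b by field; rewrite lt0r_neq0.
lra.
Qed.

(** The inequality ln x >= 1 - 1 / x at x = b^2 / s^2. *)
Lemma ent_le s b : 0 < s -> 0 < b ->
  ent (b ^+ 2) (s ^+ 2) <= 2 * (ln (s / b) * (s ^+ 2 - b ^+ 2)).
Proof.
move=> s0 b0; rewrite /ent ln_sqr_div//.
have /ln_ge_1BV : 0 < b ^+ 2 / s ^+ 2 by rewrite divr_gt0// exprn_gt0.
rewrite ln_sqr_div// invf_div -[b / s]invf_div lnV ?posrE ?divr_gt0// => h.
have : b ^+ 2 * (1 - s ^+ 2 / b ^+ 2) <= b ^+ 2 * (2 * - ln (s / b)) by rewrite ler_wpM2l// sqr_ge0.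
have -> : b ^+ 2 * (1 - s ^+ 2 / b ^+ 2) = b ^+ 2 - s ^+ 2 by field; rewrite lt0r_neq0.
lra.
Qed.

(** Applied with y = 2 ln (s / b), where y (e^y - 1) is a multiple of ln (s / b) (s^2 - b^2): on
    bounded sets this is comparable to the square of the logarithm. *)
Lemma expm1_mul_bounds y : y ^+ 2 * expR (- `|y|) <= y * (expR y - 1) <= y ^+ 2 * expR `|y|.
Proof.
have e1 := expR_ge1Dx y; have e2 := expR_ge1Dx (- y).
have e3 := expR_gt0 y.
have e4 : (1 - y) * expR y <= 1.
  by rewrite -ler_pdivlMr// div1r -expRN; exact: e2.
have [y0|y0] := leP 0 y; rewrite ?(ger0_norm y0) ?(ltr0_norm y0).
  have : expR (- y) <= 1 by rewrite expR_le1; lra.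
  move: (expR (- y)) e2 (expR y) e1 e3 e4 => u e2 v e1 e3 e4 u1.
  apply/andP; split.
    apply: (@le_trans _ _ (y ^+ 2 * 1)); first by rewrite ler_wpM2l// sqr_ge0.
    by rewrite mulr1 expr2 ler_wpM2l//; lra.
  by rewrite expr2 -mulrA ler_wpM2l//; lra.
rewrite opprK; have : 1 <= expR (- y) by lra.
move: (expR (- y)) e2 (expR y) e1 e3 e4 => u e2 v e1 e3 e4 u1.
have y1 : 0 <= - y by lra.
apply/andP; split.
  have : - y * (y * v) >= - y * (v - 1) by rewrite ler_wpM2l//; lra.
  lra.
apply: (@le_trans _ _ (y ^+ 2 * 1)); last by rewrite ler_wpM2l// sqr_ge0.
have : - y * y <= - y * (v - 1) by rewrite ler_wpM2l//; lra.
lra.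
Qed.

End Entropy.

Section Dissipation.
Context {R : realType} {N : nat}.
Variables (T : triangulation N) (I : {set 'I_N} -> R) (bg : background).
Hypothesis I_ge0 : forall e, e \in edges T -> 0 <= I e.
Variables (sb : 'I_N -> R) (Rbar : 'I_N -> R).
Hypotheses (dsb : forall i, dom bg (sb i)) (nd : proper_faces T I bg sb).
Hypotheses (Rbar_le0 : forall i, Rbar i <= 0)
  (curv_sb : forall i, curv T I bg sb i = Rbar i * sb i ^+ 2).
Implicit Types (s w : 'I_N -> R) (i j : 'I_N).

Let sb0 i : 0 < sb i := dom_gt0 (dsb i).

Let lr s i : R := ln (s i / sb i).

Let shifted_lr s : (forall i, dom bg (s i)) -> shifted sb (lr s) = s.
Proof.
move=> ds; apply/funext => i; rewrite /shifted /lr lnK ?posrE ?divr_gt0 ?(dom_gt0 (ds i))//.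
by field; rewrite lt0r_neq0.
Qed.

(** Minus half the derivative of [total_entropy] along the flow. *)
Definition diss s : R := \sum_i lr s i * (curv T I bg s i - Rbar i * s i ^+ 2).

(** Subtracting the equation of the target metric leaves two nonnegative parts: the first by
    monotonicity of the curvature, the second because Rbar <= 0 and the logarithm is increasing. *)
Let diss_split s : diss s = \sum_i lr s i * (curv T I bg s i - curv T I bg sb i)
  + \sum_i - Rbar i * (lr s i * (s i ^+ 2 - sb i ^+ 2)).
Proof.
by rewrite -big_split /=; apply: eq_bigr => i _; rewrite curv_sb; ring.
Qed.

Let sqr_gap s i : dom bg (s i) ->
  lr s i * (s i ^+ 2 - sb i ^+ 2) = sb i ^+ 2 / 2 * (2 * lr s i * (expR (2 * lr s i) - 1)).
Proof.
move=> ds; have s0 := dom_gt0 ds.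
have -> : expR (2 * lr s i) = s i ^+ 2 / sb i ^+ 2.
  by rewrite -ln_sqr_div// lnK// posrE divr_gt0// exprn_gt0.
by field; rewrite lt0r_neq0.
Qed.

Let sqr_gap_ge0 s i : dom bg (s i) -> 0 <= lr s i * (s i ^+ 2 - sb i ^+ 2).
Proof.
move=> ds; rewrite sqr_gap//; have /andP[h _] := expm1_mul_bounds (2 * lr s i).
by apply: mulr_ge0; [nneg|apply: le_trans h; nneg].
Qed.

Lemma diss_ge0 s : (forall i, dom bg (s i)) -> 0 <= diss s.
Proof.
move=> ds; rewrite diss_split addr_ge0//; last first.
  by apply: sumr_ge0 => i _; rewrite mulr_ge0 ?oppr_ge0// sqr_gap_ge0.
have := @curv_monotone _ _ _ _ _ I_ge0 _ dsb nd (lr s).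
by rewrite shifted_lr//; apply.
Qed.

Definition total_entropy s : R := \sum_i ent (sb i ^+ 2) (s i ^+ 2).

Let entropy_le (B : R) : exists2 C : R, 0 < C & forall s, (forall i, dom bg (s i)) ->
  (forall i, `|lr s i| <= B) -> total_entropy s <= C * \sum_i lr s i ^+ 2.
Proof.
exists ((\sum_i 4 * sb i ^+ 2 * expR (2 * B)) + 1).
  by apply: ltr_pwDr => //; apply: sumr_ge0 => i _; nneg.
move=> s ds hB; rewrite mulr_sumr; apply: ler_sum => i _.
apply: le_trans (ent_le (dom_gt0 (ds i)) (sb0 i)) _.
rewrite -/(lr s i) sqr_gap//; have /andP[_ h] := expm1_mul_bounds (2 * lr s i).
have h2 : expR `|2 * lr s i| <= expR (2 * B).
  by rewrite ler_expR normrM ger0_norm// ler_pM2l.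
apply: (@le_trans _ _ ((4 * sb i ^+ 2 * expR (2 * B)) * lr s i ^+ 2)); last first.
  rewrite ler_wpM2r ?sqr_ge0// (bigD1 i)//= -addrA lerDl addr_ge0//.
  by apply: sumr_ge0 => *; nneg.
have e : (2 * lr s i) ^+ 2 * expR `|2 * lr s i| <= (2 * lr s i) ^+ 2 * expR (2 * B).
  by rewrite ler_wpM2l// sqr_ge0.
have {e}h := le_trans h e.
have : sb i ^+ 2 * (2 * lr s i * (expR (2 * lr s i) - 1)) <= sb i ^+ 2 * ((2 * lr s i) ^+ 2 * expR (2 * B)).
  by rewrite ler_wpM2l// sqr_ge0.
rewrite exprMn; lra.
Qed.

(* Euclidean metrics with zero target curvature are determined up to scaling. *)
Definition normalized s : Prop := bg = Euclidean -> (forall i, Rbar i = 0) ->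
  \sum_i s i ^+ 2 = \sum_i sb i ^+ 2.

Let diss_faces (B : R) : exists2 e : R, 0 < e & forall s, (forall i, dom bg (s i)) ->
  (forall i, `|lr s i| <= B) -> e * nfaces T bg (lr s) <= diss s.
Proof.
have [e e0 he] := @curv_coercive _ _ _ _ _ I_ge0 _ dsb nd B.
exists e => // s ds hB; have := he _ hB; rewrite shifted_lr// => /(_ ds) h.
rewrite diss_split; apply: (le_trans h); rewrite lerDl.
by apply: sumr_ge0 => i _; rewrite mulr_ge0 ?oppr_ge0// sqr_gap_ge0.
Qed.

Let diss_term s i : (forall i, dom bg (s i)) ->
  - Rbar i * (lr s i * (s i ^+ 2 - sb i ^+ 2)) <= diss s.
Proof.
move=> ds; rewrite diss_split [X in _ <= _ + X](bigD1 i)//= addrCA lerDl addr_ge0//; last first.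
  by apply: sumr_ge0 => j _; rewrite mulr_ge0 ?oppr_ge0// sqr_gap_ge0.
have := @curv_monotone _ _ _ _ _ I_ge0 _ dsb nd (lr s).
by rewrite shifted_lr//; apply.
Qed.

(** In Euclidean geometry [nfaces] controls only the differences of the [lr s i]. The common
    constant is controlled by a vertex where Rbar is negative, by [nfaces] itself in hyperbolic
    geometry, and otherwise by the normalization, under which the [lr s j] cannot all be positive or
    all negative. *)
Let diss_vertex (B : R) : exists2 C : R, 0 < C & forall s, (forall i, dom bg (s i)) ->
  (forall i, `|lr s i| <= B) -> normalized s -> forall i, lr s i ^+ 2 <= C * diss s.
Proof.
have [e e0 he] := diss_faces B.
have osc s i j : (forall i, dom bg (s i)) -> (forall i, `|lr s i| <= B) ->
    (lr s i - lr s j) ^+ 2 <= N%:R ^+ 2 / e * diss s.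
  move=> ds hB; have := nfaces_osc T bg (lr s) i j; have := he s ds hB.
  rewrite mulrC -ler_pdivlMr// => h1 /le_trans; apply.
  by rewrite -mulrA ler_wpM2l ?sqr_ge0// mulrC.
case: (boolP [forall i, Rbar i == 0]) => [/forallP R0|]; last first.
  rewrite negb_forall => /existsP[i0 Ri0].
  have Rn : 0 < - Rbar i0 by rewrite oppr_gt0 lt_neqAle Ri0 Rbar_le0.
  pose q := - Rbar i0 * (2 * sb i0 ^+ 2 * expR (- (2 * B))).
  have q0 : 0 < q by have := sb0 i0 => ?; rewrite /q; pos.
  exists (2 * (N%:R ^+ 2 / e) + 2 / q).
    by apply: ltr_wpDl; [nneg|rewrite divr_gt0].
  move=> s ds hB _ i; have h1 := osc s i i0 ds hB.
  have := diss_term i0 ds; rewrite sqr_gap//.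
  have /andP[h _] := expm1_mul_bounds (2 * lr s i0).
  have h2 : expR (- (2 * B)) <= expR (- `|2 * lr s i0|).
    by rewrite ler_expR lerN2 normrM ger0_norm// ler_pM2l.
  have e2 : (2 * lr s i0) ^+ 2 * expR (- (2 * B)) <= (2 * lr s i0) ^+ 2 * expR (- `|2 * lr s i0|).
    by rewrite ler_wpM2l// sqr_ge0.
  have {e2}h := le_trans e2 h; move=> h3.
  have h4 : q * lr s i0 ^+ 2 <= diss s.
    apply: le_trans h3; rewrite /q -!mulrA ler_pM2l//.
    have := ler_wpM2l (sqr_ge0 (sb i0)) h; lra.
  have h5 : lr s i0 ^+ 2 <= q^-1 * diss s by rewrite ler_pdivlMl.
  have h6 := sqr_ge0 (lr s i - 2 * lr s i0).
  have -> : (2 * (N%:R ^+ 2 / e) + 2 / q) * diss s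
    = 2 * (N%:R ^+ 2 / e * diss s) + 2 * (q^-1 * diss s) by ring.
  move: (N%:R ^+ 2 / e * diss s) (q^-1 * diss s) (lr s i) (lr s i0) h1 h5 h6 => a b x y.
  by move=> h1 h5 h6; lra.
have [bgH|bgE] : bg = Hyperbolic \/ bg = Euclidean by case: bg; [right|left].
  exists e^-1 => [|s ds hB _ i]; first by rewrite invr_gt0.
  rewrite ler_pdivlMl//; apply: le_trans (he s ds hB).
  by rewrite ler_pM2l//; exact: nfaces_hyperbolic.
exists (N%:R ^+ 2 / e + 1) => [|s ds hB ns i]; first by apply: ltr_wpDl; nneg.
have Rz j : Rbar j = 0 by apply/eqP.
have gap j : s j ^+ 2 = sb j ^+ 2 * expR (2 * lr s j).
  have := dom_gt0 (ds j) => sj; have := sb0 j => sbj.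
  rewrite -ln_sqr_div// lnK ?posrE ?divr_gt0 ?exprn_gt0//.
  by rewrite mulrC divfK// lt0r_neq0// exprn_gt0.
have mono j : (lr s i - lr s j) ^+ 2 <= (N%:R ^+ 2 / e + 1) * diss s.
  apply: le_trans (osc s i j ds hB) _; rewrite ler_wpM2r ?diss_ge0//.
  by rewrite lerDl.
(* When [lr s i] and [lr s j] have opposite signs, their difference dominates both. *)
suff [j hj] : exists j, lr s i ^+ 2 <= (lr s i - lr s j) ^+ 2 by exact: le_trans hj (mono j).
have E := ns bgE Rz.
have [li|li] := leP 0 (lr s i).
  have [[j hj]|H] := pselect (exists j, lr s j <= 0).
    exists j; move: (lr s i) (lr s j) li hj => x y x0 y0; nra.
  have : \sum_j sb j ^+ 2 < \sum_j s j ^+ 2.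
    apply: ltr_sum; first by apply/hasP; exists i; rewrite ?mem_index_enum.
    move=> j _; rewrite gap ltr_pMr ?exprn_gt0// expR_gt1 mulr_gt0// ltNge.
    by apply/negP => hj; apply: H; exists j.
  by rewrite E ltxx.
have [[j hj]|H] := pselect (exists j, 0 <= lr s j).
  exists j; move: (lr s i) (lr s j) li hj => x y x0 y0; nra.
have : \sum_j s j ^+ 2 < \sum_j sb j ^+ 2.
  apply: ltr_sum; first by apply/hasP; exists i; rewrite ?mem_index_enum.
  move=> j _; rewrite gap gtr_pMr ?exprn_gt0// expR_lt1 pmulr_rlt0// ltNge.
  by apply/negP => hj; apply: H; exists j.
by rewrite E ltxx.
Qed.

Let lr_bounded (m M : R) : 0 < m -> exists B, forall s, (forall i, m <= s i <= M) ->
  forall i, `|lr s i| <= B.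
Proof.
move=> m0; exists (\sum_i (`|ln (m / sb i)| + `|ln (M / sb i)|)) => s hs i.
have /andP[h1 h2] := hs i; have := sb0 i => b0.
have s0 : 0 < s i by lra.
have M0 : 0 < M by lra.
rewrite (bigD1 i)//= -[leLHS]addr0 lerD//; last by apply: sumr_ge0 => *; nneg.
have g1 : ln (m / sb i) <= lr s i by rewrite ler_ln ?posrE ?divr_gt0// ler_pM2r ?invr_gt0.
have g2 : lr s i <= ln (M / sb i) by rewrite ler_ln ?posrE ?divr_gt0// ler_pM2r ?invr_gt0.
have := ler_norm (ln (M / sb i)); have := ler_norm (- ln (m / sb i)); rewrite normrN.
have := normr_ge0 (ln (M / sb i)); have := normr_ge0 (ln (m / sb i)).
rewrite ler_norml => *; apply/andP; split; lra.
Qed.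

Lemma diss_coercive (m M : R) : 0 < m -> exists2 c : R, 0 < c & forall s,
  (forall i, dom bg (s i)) -> (forall i, m <= s i <= M) -> normalized s ->
  c * total_entropy s <= diss s.
Proof.
move=> m0; have [B hB] := lr_bounded M m0.
have [C C0 hC] := entropy_le B; have [D D0 hD] := diss_vertex B.
have P : 0 < C * (N%:R * D + 1) by apply: mulr_gt0 => //; apply: ltr_wpDl => //; nneg.
exists (C * (N%:R * D + 1))^-1 => [|s ds hs ns]; first by rewrite invr_gt0.
rewrite ler_pdivrMl//; apply: le_trans (hC s ds (hB s hs)) _.
rewrite -mulrA ler_pM2l// mulrDl mul1r.
apply: (@le_trans _ _ (\sum_(i < N) D * diss s)).
  by apply: ler_sum => i _; apply: hD => //; exact: hB.
rewrite sumr_const card_ord -[leLHS]mulr_natl mulrA lerDl; exact: diss_ge0.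
Qed.

Lemma total_entropy_ge s i : (forall i, dom bg (s i)) -> (s i - sb i) ^+ 2 <= total_entropy s.
Proof.
move=> ds; rewrite /total_entropy (bigD1 i)//= -[leLHS]addr0 lerD//.
  by apply: ent_ge => //; exact: dom_gt0 (ds i).
apply: sumr_ge0 => j _; apply: le_trans (sqr_ge0 (s j - sb j)) _.
by apply: ent_ge => //; exact: dom_gt0 (ds j).
Qed.

End Dissipation.

(** * Bounds and exponential decay along the flow *)

Section Bounds.
Context {R : realType} {N : nat}.
Variables (T : triangulation N) (I : {set 'I_N} -> R) (bg : background).
Hypothesis I_ge0 : forall e, e \in edges T -> 0 <= I e.
Variables (sb : 'I_N -> R) (Rbar : 'I_N -> R).
Hypotheses (dsb : forall i, dom bg (sb i)) (nd : proper_faces T I bg sb).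
Hypotheses (Rbar_le0 : forall i, Rbar i <= 0)
  (curv_sb : forall i, curv T I bg sb i = Rbar i * sb i ^+ 2).
Implicit Types (s w : 'I_N -> R) (i j : 'I_N) (A : {set 'I_N}).

Let sb0 i : 0 < sb i := dom_gt0 (dsb i).

Let curv_sb_le0 A : \sum_(i in A) curv T I bg sb i <= 0.
Proof.
apply: sumr_le0 => i _; rewrite curv_sb mulr_le0_ge0// exprn_ge0//.
exact: ltW.
Qed.

(** The last sum is the derivative of [\sum_(i in A) s i ^+ 2] along the flow. Near 0 the term with
    Rbar is negligible against the curvature, which is bounded away from 0 by [subset_curvature].
    When A is everything in Euclidean geometry, the total curvature is a constant: either it is
    negative, or Rbar vanishes and so does the derivative. *)
Lemma subset_growth A (m M : R) : A != finset.set0 -> 0 < m -> kap bg * M < 1 ->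
  exists2 d : R, 0 < d & forall s, (forall i, dom bg (s i)) ->
    \sum_(i in A) s i ^+ 2 <= d -> (forall i, i \notin A -> m <= s i <= M) ->
    0 <= \sum_(i in A) (Rbar i * s i ^+ 2 - curv T I bg s i).
Proof.
move=> A0 m0 M1; pose C : R := \sum_i - Rbar i + 1.
have R0 i : 0 <= - Rbar i by rewrite oppr_ge0.
have C0 : 0 < C by apply: ltr_pwDr => //; apply: sumr_ge0 => i _.
have CR i : - Rbar i <= C.
  by rewrite /C (bigD1 i)//= -addrA lerDl addr_ge0// sumr_ge0.
have drift s : \sum_(i in A) Rbar i * s i ^+ 2 >= - (C * \sum_(i in A) s i ^+ 2).
  rewrite mulr_sumr -sumrN; apply: ler_sum => i _.
  rewrite -mulNr ler_wpM2r ?sqr_ge0//; have := CR i; lra.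
have conclude (c d : R) : 0 < c -> 0 < d ->
  (forall s, (forall i, dom bg (s i)) -> (forall i, i \in A -> s i <= d) ->
     (forall i, i \notin A -> m <= s i <= M) -> \sum_(i in A) curv T I bg s i <= - c) ->
  exists2 d : R, 0 < d & forall s, (forall i, dom bg (s i)) ->
    \sum_(i in A) s i ^+ 2 <= d -> (forall i, i \notin A -> m <= s i <= M) ->
    0 <= \sum_(i in A) (Rbar i * s i ^+ 2 - curv T I bg s i).
  move=> c0 d0 H; exists (Num.min (d ^+ 2) (c / C)).
    by rewrite lt_min exprn_gt0// divr_gt0.
  move=> s ds; rewrite le_min => /andP[sd sc] hs.
  have sA i : i \in A -> s i <= d.
    move=> iA; rewrite -(@ler_pXn2r _ 2) ?nnegrE ?(ltW d0) ?(ltW (dom_gt0 (ds i)))//.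
    apply: le_trans sd; rewrite (bigD1 i)//= lerDl; apply: sumr_ge0 => *; nneg.
  rewrite sumrB; have := H s ds sA hs; have := drift s.
  by move: sc; rewrite ler_pdivlMr// mulrC; lra.
have [cond|ncond] := pselect (A != [set: 'I_N]%SET \/ bg = Hyperbolic).
  have [c c0 hc] := @subset_curvature _ _ _ _ _ I_ge0 _ dsb nd A A0 cond.
  have [d d0 hd] := hc m M m0 M1.
  apply: (conclude c d c0 d0) => s ds h1 h2; have := hd s ds h1 h2.
  by have := curv_sb_le0 A; lra.
have AT : A = [set: 'I_N]%SET by apply/eqP/negPn/negP => h; apply: ncond; left.
have bgE : bg = Euclidean by case: (bg) ncond => // h; case: h; right.
have tot s : (forall i, dom bg (s i)) ->
    \sum_(i in A) curv T I bg s i = \sum_(i in A) Rbar i * sb i ^+ 2.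
  move=> ds; under [RHS]eq_bigr do rewrite -curv_sb.
  have sT (f : 'I_N -> R) : \sum_(i in A) f i = \sum_i f i.
    by apply: eq_bigl => i; rewrite AT finset.in_setT.
  by rewrite !sT bgE; apply: curv_total_euclidean => // i; exact: dom_gt0 (ds i).
have : 0 <= - \sum_(i in A) Rbar i * sb i ^+ 2.
  by have := curv_sb_le0 A; under eq_bigr do rewrite curv_sb; lra.
rewrite le_eqVlt => /predU1P[E|c0]; last first.
  by apply: (conclude _ _ c0 ltr01) => s ds _ _; rewrite opprK tot.
have Rz i : Rbar i = 0.
  apply/eqP; have : \sum_(i in A) - Rbar i * sb i ^+ 2 == 0.
    by under eq_bigr do rewrite mulNr; rewrite sumrN -E.
  rewrite psumr_eq0 => [/allP/(_ i)|j _]; last by rewrite mulr_ge0// sqr_ge0.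
  rewrite mem_index_enum AT finset.in_setT /= mulNr oppr_eq0 mulf_eq0 => /(_ isT)/orP[//|].
  by rewrite sqrf_eq0 gt_eqF.
exists 1 => // s ds _ _; rewrite sumrB (tot s ds) !big1 ?subr0// => i _; by rewrite Rz mul0r.
Qed.

(** The extended flow in terms of s: multiplying the R-curvature by s_i^2 gives back the curvature,
    so no division is left. *)
Definition sflow (sigma : R -> 'I_N -> R) (tau : \bar R) : Prop :=
  [/\ (0 < tau)%E,
      forall t, 0 <= t -> (t%:E < tau)%E -> forall i, dom bg (sigma t i)
    & forall i, path_on tau (fun t => sigma t i ^+ 2)
        (fun t => Rbar i * sigma t i ^+ 2 - curv T I bg (sigma t) i)].

Variables (sigma : R -> 'I_N -> R) (tau : \bar R).
Hypothesis flow : sflow sigma tau.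

Lemma sflow_entropy : path_on tau (fun t => total_entropy sb (sigma t))
  (fun t => - (2 * diss T I bg sb Rbar (sigma t))).
Proof.
have [tau0 ds ps] := flow.
have P i := path_comp (phi := ent (sb i ^+ 2)) (phi' := fun x => ln (x / sb i ^+ 2)) (ps i).
have {}P i := P i (fun t t0 tt' => is_derive_ent (exprn_gt0 2 (sb0 i))
   (exprn_gt0 2 (dom_gt0 (ds t t0 tt' i)))) tau0.
apply: path_eq (path_sum (index_enum 'I_N) (p := xpredT) (fun i _ => P i)) _ => t t0 tt'.
rewrite /diss mulr_sumr -sumrN; apply: eq_bigr => i _.
rewrite ln_sqr_div//; first by ring.
exact: dom_gt0 (ds t (ltW t0) tt' i).
Qed.

Lemma sflow_entropy_le t : 0 <= t -> (t%:E < tau)%E ->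
  total_entropy sb (sigma t) <= total_entropy sb (sigma 0).
Proof.
move=> t0 tt'; have [tau0 ds ps] := flow.
have := path_nonincreasing sflow_entropy (lexx 0) t0 tt'; apply=> u /andP[u0 ut].
have ut' : (u%:E < tau)%E by apply: lt_trans tt'; rewrite lte_fin.
rewrite oppr_le0 mulr_ge0//; apply: diss_ge0 => // i; apply: ds => //.
exact: ltW.
Qed.

Lemma sflow_le : exists2 M : R, kap bg * M < 1 &
  forall t, 0 <= t -> (t%:E < tau)%E -> forall i, sigma t i <= M.
Proof.
have [tau0 ds ps] := flow.
have [bgE|bgH] : bg = Euclidean \/ bg = Hyperbolic by case: bg; [left|right].
  pose E := total_entropy sb (sigma 0).
  (* From x - b <= 1 + (x - b)^2, the square being bounded by the entropy. *)
  exists (\sum_i sb i + 1 + E) => [|t t0 tt' i]; first by rewrite bgE mul0r.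
  have h1 := sflow_entropy_le t0 tt'.
  have h2 := le_trans (total_entropy_ge dsb i (ds t t0 tt')) h1.
  have h3 : sb i <= \sum_i sb i.
    by rewrite (bigD1 i)//= lerDl; apply: sumr_ge0 => j _; exact: ltW.
  move: (sigma t i) h2 h3 => x; rewrite -/E; move: (\sum_i sb i) (sb i) => S b h2 h3.
  have := sqr_ge0 (x - b - 1); nra.
have [d d0 hd] := @curv_gt0_near_one _ _ T _ I_ge0.
pose e := Num.min d 1; have e0 : 0 < e by rewrite lt_min d0 ltr01.
have e1 : e <= 1 by rewrite ge_min lexx orbT.
have ed : e <= d by rewrite ge_min lexx.
have up i t : 0 <= t -> (t%:E < tau)%E -> sigma t i <= Num.max (sigma 0 i) (1 - e).
  move=> t0 tt'; have s0 := dom_gt0 (ds 0 (lexx 0) tau0 i); have s1 := dom_gt0 (ds t t0 tt' i).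
  have M0 : 0 < Num.max (sigma 0 i) (1 - e) by rewrite lt_max s0.
  rewrite -(@ler_pXn2r _ 2) ?nnegrE ?(ltW M0) ?(ltW s1)// -lerN2.
  have := path_barrier (path_opp (ps i)) _ _ t0 tt'; apply.
    by rewrite lerN2 ler_pXn2r ?nnegrE ?(ltW M0) ?(ltW s0)// le_max lexx.
  move=> u u0 ut; rewrite ltrN2 => hu.
  have s2 := ds u (ltW u0) ut.
  have : Num.max (sigma 0 i) (1 - e) < sigma u i.
    by move: hu; rewrite ltr_pXn2r ?nnegrE ?(ltW M0) ?(ltW (dom_gt0 (s2 i))).
  rewrite gt_max => /andP[_ h].
  have := hd (sigma u) i; rewrite bgH in s2 * => /(_ s2 _)/ltW K.
  have := Rbar_le0 i; have := sqr_ge0 (sigma u i).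
  have {}K := K ltac:(lra); nra.
have [M [M1 hM]] : exists M : R, M < 1 /\ forall i, Num.max (sigma 0 i) (1 - e) <= M.
  have [i|i r r' h1 _ h3|r r0 hr] := @uniform_pos R 'I_N
      (fun i r => Num.max (sigma 0 i) (1 - e) <= 1 - r).
  - exists (1 - Num.max (sigma 0 i) (1 - e)); last by lra.
    have := ds 0 (lexx 0) tau0 i; rewrite bgH => /andP[_]; rewrite mul1r => h.
    by rewrite subr_gt0 gt_max h; lra.
  - by lra.
  by exists (1 - r); split=> //; lra.
exists M => [|t t0 tt' i]; first by rewrite bgH mul1r.
exact: le_trans (up i t t0 tt') (hM i).
Qed.

(* By downward induction on A: when the sum over A is small, the other radii are
   bounded below, hence [subset_growth] prevents the sum from decreasing. *)
Lemma sflow_sum_ge A : A != finset.set0 -> exists2 d : R, 0 < d &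
  forall t, 0 <= t -> (t%:E < tau)%E -> d <= \sum_(i in A) sigma t i ^+ 2.
Proof.
have [tau0 ds ps] := flow; have [M M1 hM] := sflow_le.
have [n] := ubnP #|(~: A)%SET|; elim: n A => // n ih A cA A0.
have [i|i r r' h1 _ h3 iA t t0 tt'|d' d'0 hd'] := @uniform_pos R 'I_N (fun i r => i \notin A ->
    forall t, 0 <= t -> (t%:E < tau)%E -> r <= \sum_(j in i |: A) sigma t j ^+ 2).
- have [iA|iA] := boolP (i \in A); first by exists 1.
  have [||d d0 hd] := ih (i |: A)%SET.
  + rewrite -ltnS; apply: leq_trans cA; rewrite ltnS; apply: proper_card.
    apply/fintype.properP; split; first by rewrite finset.setCS finset.subsetUr.
    by exists i; rewrite !inE ?iA// eqxx.
  + by apply/finset.set0Pn; exists i; rewrite !inE eqxx.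
  by exists d => // _.
- by apply: le_trans h3 _; exact: h1.
(* If the sum over A is below d' / 2 while the sum over A and i is at least d', then s_i is at least
   m. *)
pose m := Num.sqrt (d' / 2); have m0 : 0 < m by rewrite sqrtr_gt0 divr_gt0.
have m2 : m ^+ 2 = d' / 2 by rewrite sqr_sqrtr// divr_ge0// ltW.
have [d d0 hd] := subset_growth A0 m0 M1.
have S0 : 0 < \sum_(i in A) sigma 0 i ^+ 2.
  have /finset.set0Pn[i iA] := A0; rewrite (bigD1 i)//= ltr_pwDl//.
    by rewrite exprn_gt0//; exact: dom_gt0 (ds 0 (lexx 0) tau0 i).
  by apply: sumr_ge0 => *; nneg.
exists (Num.min (\sum_(i in A) sigma 0 i ^+ 2) (Num.min d (d' / 2))) => [|t t0 tt'].
  by rewrite !lt_min S0 d0 divr_gt0.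
have P := path_sum (index_enum 'I_N) (p := fun i => i \in A) (fun i _ => ps i).
have := path_barrier P _ _ t0 tt'; apply; first by rewrite ge_min lexx.
move=> u u0 ut; rewrite !lt_min => /andP[_ /andP[h1 h2]].
apply: hd; [exact: ds (ltW u0) ut|exact: ltW|].
move=> i iA; rewrite (hM _ (ltW u0) ut) andbT.
rewrite -(@ler_pXn2r _ 2) ?nnegrE ?(ltW m0) ?(ltW (dom_gt0 (ds u (ltW u0) ut i)))// m2.
have := hd' i iA u (ltW u0) ut; rewrite finset.big_setU1//=; lra.
Qed.

Lemma sflow_ge : exists2 m : R, 0 < m &
  forall t, 0 <= t -> (t%:E < tau)%E -> forall i, m <= sigma t i.
Proof.
have [tau0 ds ps] := flow.
have [i|i r r' h1 r0 h3 t t0 tt'|m m0 hm] := @uniform_pos R 'I_N (fun i r =>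
    forall t, 0 <= t -> (t%:E < tau)%E -> r <= sigma t i).
- have [|d d0 hd] := @sflow_sum_ge [set i]%SET.
    by apply/finset.set0Pn; exists i; rewrite !inE eqxx.
  exists (Num.sqrt d); first by rewrite sqrtr_gt0.
  move=> t t0 tt'; have := hd t t0 tt'; rewrite finset.big_set1.
  move=> h; have s0 := dom_gt0 (ds t t0 tt' i).
  by rewrite -(ger0_norm (ltW s0)) -sqrtr_sqr ler_wsqrtr.
- by apply: le_trans h3 _; exact: h1.
by exists m => // t t0 tt' i; exact: hm.
Qed.

(** When Rbar = 0 in Euclidean geometry the total curvature is that of [sb], which is 0, so the sum
    of the squares is constant. *)
Lemma sflow_normalized t : normalized bg sb Rbar (sigma 0) -> 0 <= t -> (t%:E < tau)%E ->
  normalized bg sb Rbar (sigma t).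
Proof.
move=> n0 t0 tt' bgE Rz; rewrite -n0//; have [tau0 ds ps] := flow.
have P := path_sum (index_enum 'I_N) (p := xpredT) (fun i _ => ps i).
have Z u : 0 <= u -> (u%:E < tau)%E ->
    \sum_i (Rbar i * sigma u i ^+ 2 - curv T I bg (sigma u) i) = 0.
  move=> u0 ut; rewrite sumrB big1 ?sub0r => [|i _]; last by rewrite Rz mul0r.
  have := @curv_total_euclidean _ _ T _ I_ge0 (sigma u) sb.
  rewrite -bgE => ->; last 2 first.
  - by move=> i; exact: dom_gt0 (ds u u0 ut i).
  - by [].
  by rewrite big1 ?oppr0// => i _; rewrite curv_sb Rz mul0r.
have lt_tau u : u < t -> (u%:E < tau)%E by move=> ut; apply: lt_trans tt'; rewrite lte_fin.
apply/eqP; rewrite eq_le; apply/andP; split.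
  have := path_nonincreasing P (lexx 0) t0 tt'; apply=> u /andP[u0 ut].
  by rewrite Z// ?ltW//; exact: lt_tau.
rewrite -lerN2; have := path_nonincreasing (path_opp P) (lexx 0) t0 tt'; apply=> u /andP[u0 ut].
by rewrite Z ?oppr0// ?ltW//; exact: lt_tau.
Qed.

(** Gronwall: the entropy times e^(2ct) does not increase. The entropy dominates the squared
    distances, so these decay with exponent 2c and the distances with exponent c. *)
Lemma sflow_exponential : normalized bg sb Rbar (sigma 0) -> exists C c : R, [/\ 0 < C, 0 < c &
  forall t, 0 <= t -> (t%:E < tau)%E -> forall i, `|sigma t i - sb i| <= C * expR (- c * t)].
Proof.
move=> n0; have [tau0 ds ps] := flow; have [M M1 hM] := sflow_le; have [m m0 hm] := sflow_ge.
have [c c0 hc] := @diss_coercive _ _ _ _ _ I_ge0 _ _ dsb nd Rbar_le0 curv_sb m M m0.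
have E0 : 0 <= total_entropy sb (sigma 0).
  apply: sumr_ge0 => i _; apply: le_trans (ent_ge (dom_gt0 (ds 0 (lexx 0) tau0 i)) (sb0 i)).
  exact: sqr_ge0.
(* Adding 1 keeps the constant positive for a flow that starts at its limit. *)
exists (Num.sqrt (total_entropy sb (sigma 0) + 1)), c; split=> // [|t t0 tt' i].
  by rewrite sqrtr_gt0; lra.
have dexp (u : R) : is_derive u 1 (fun x : R => expR (2 * c * x)) (2 * c * expR (2 * c * u)).
  by apply: is_derive_eq; rewrite /GRing.scale/=; ring.
have P : path_on tau (fun t => total_entropy sb (sigma t) * expR (2 * c * t))
    (fun t => - (2 * diss T I bg sb Rbar (sigma t)) * expR (2 * c * t)
       + total_entropy sb (sigma t) * (2 * c * expR (2 * c * t))).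
  have [p1 p2] := sflow_entropy; split.
    apply: cvgM; first exact: p1.
    apply: cvg_at_right_filter; have [de _] := dexp 0.
    have : {for (0 : R), continuous (fun x : R => expR (2 * c * x))}.
      by apply: differentiable_continuous; apply/derivable1_diffP.
    by [].
  move=> u u0 ut; have d1 := p2 u u0 ut; have d2 := dexp u.
  by apply: is_derive_eq; rewrite /GRing.scale/=; ring.
have L : total_entropy sb (sigma t) * expR (2 * c * t) <= total_entropy sb (sigma 0).
  have := path_nonincreasing P (lexx 0) t0 tt'; rewrite mulr0 expR0 mulr1; apply.
  move=> u /andP[u0 ut].
  have ut' : (u%:E < tau)%E by apply: lt_trans tt'; rewrite lte_fin.
  have ns := sflow_normalized n0 (ltW u0) ut'.
  have D : c * total_entropy sb (sigma u) <= diss T I bg sb Rbar (sigma u).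
    apply: hc ns => [|i']; first exact: ds (ltW u0) ut'.
    by rewrite (hm _ (ltW u0) ut') (hM _ (ltW u0) ut').
  have -> : - (2 * diss T I bg sb Rbar (sigma u)) * expR (2 * c * u)
      + total_entropy sb (sigma u) * (2 * c * expR (2 * c * u))
    = (c * total_entropy sb (sigma u) - diss T I bg sb Rbar (sigma u)) * (2 * expR (2 * c * u)) by ring.
  by rewrite mulr_le0_ge0 ?subr_le0// mulr_ge0.
have h := total_entropy_ge dsb i (ds t t0 tt').
rewrite -sqrtr_sqr -(@ler_pXn2r _ 2) ?nnegrE ?sqrtr_ge0 ?mulr_ge0 ?expR_ge0 ?sqrtr_ge0//.
rewrite exprMn !sqr_sqrtr ?sqr_ge0//; last by lra.
rewrite -expRM_natl; apply: le_trans h _.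
have -> : 2%:R * (- c * t) = - (2 * c * t) by ring.
rewrite expRN ler_pdivlMr ?expR_gt0//; apply: le_trans L _; lra.
Qed.

End Bounds.

(** * Local existence and continuation past a finite time *)

Section Extension.
Context {R : realType} {N : nat}.
Variables (T : triangulation N) (I : {set 'I_N} -> R) (bg : background).
Hypothesis I_ge0 : forall e, e \in edges T -> 0 <= I e.
Variables (Rbar : 'I_N -> R).
Implicit Types (s : 'I_N -> R) (i j : 'I_N).

Let field s i : R := Rbar i * s i ^+ 2 - curv T I bg s i.

Let cvg_field {X} {F : set_system X} {FF : Filter F} (f : X -> 'I_N -> R) s i :
  (forall j, dom bg (s j)) -> (forall j, f t j @[t --> F] --> s j) ->
  field (f t) i @[t --> F] --> field s i.
Proof.
by move=> ds fs; apply: cvgBf; [apply: cvgMf; [exact: cvg_cst|exact: cvgX2f]|exact: cvg_curv].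
Qed.

Lemma cvg_sqrtf {X} {F : set_system X} {FF : Filter F} (f : X -> R) (l : R) :
  f @ F --> l -> Num.sqrt (f t) @[t --> F] --> Num.sqrt l.
Proof. by move=> fl; apply: continuous_cvg fl; exact: sqrt_continuous. Qed.

Lemma cvg_clamp {X} {F : set_system X} {FF : Filter F} (f : X -> R) (a b l : R) :
  f @ F --> l -> Num.max a (Num.min b (f t)) @[t --> F] --> Num.max a (Num.min b l).
Proof.
move=> fl.
have fm : Num.min b (f t) @[t --> F] --> Num.min b l.
  under eq_fun do rewrite minr_absE; rewrite minr_absE.
  apply: cvgMf; last exact: cvg_cst.
  by apply: cvgBf; [apply: cvgDf fl|apply: cvg_norm; apply: cvgBf fl]; exact: cvg_cst.
under eq_fun do rewrite maxr_absE; rewrite maxr_absE.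
apply: cvgMf; last exact: cvg_cst.
by apply: cvgDf; [apply: cvgDf fm|apply: cvg_norm; apply: cvgBf fm]; exact: cvg_cst.
Qed.

(** Peano's theorem is applied to the squares. Clamping their roots to intervals around s0 makes the
    field bounded and continuous everywhere, and for a short time the clamp is inactive. The
    equation is stated with epsilon and delta because at the ends of [0, h] the derivative is
    one-sided. *)
Lemma local_flow s0 : (forall i, dom bg (s0 i)) ->
  exists (h : R) (x : R -> 'I_N -> R), [/\ 0 < h, x 0 = s0,
    forall t, 0 <= t -> t <= h -> forall i, dom bg (x t i)
  & forall t, 0 <= t -> t <= h -> forall e : R, 0 < e -> exists2 d : R, 0 < d &
    forall u, 0 <= u -> u <= h -> `|u - t| <= d -> forall i,
      `|x u i ^+ 2 - x t i ^+ 2 - (u - t) * field (x t) i| <= e * `|u - t|].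
Proof.
move=> ds0; have p0 i := dom_gt0 (ds0 i).
(* In hyperbolic geometry b is the midpoint of s0 and 1, in Euclidean geometry s0 + 1/2. *)
pose a i := s0 i / 2; pose b i := s0 i + (1 - kap bg * s0 i) / 2.
have k1 i : 0 < 1 - kap bg * s0 i by have /andP[_] := ds0 i; rewrite subr_gt0.
have ab i : 0 < a i < s0 i /\ s0 i < b i.
  by have := p0 i; have := k1 i; rewrite /a /b; split; lra.
have kb i : kap bg * b i < 1.
  by have := k1 i; rewrite /b /kap; case: (bg); lra.
pose cl (x : 'I_N -> R) i := Num.max (a i) (Num.min (b i) (Num.sqrt (x i))).
have clE x i : a i <= cl x i <= b i.
  by rewrite le_max lexx ge_max ge_min lexx /= andbT; have := ab i; lra.
have dcl x i : dom bg (cl x i).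
  have /andP[h1 h2] := clE x i; have [/andP[h3 _] _] := ab i.
  apply: dom_le h2; last exact: lt_le_trans h1.
  by rewrite /dom kb andbT; have := ab i; lra.
have [M hM] := @curv_bounded R N T I bg.
pose C := \sum_i `|Rbar i| * b i ^+ 2 + `|M| + 1.
have C0 : 0 < C.
  by apply: ltr_pwDr => //; apply: addr_ge0 => //; apply: sumr_ge0 => i _; nneg.
have fC x i : `|field (cl x) i| <= C.
  apply: le_trans (ler_normB _ _) _; have h1 := hM (cl x) i.
  have h2 : `|Rbar i * cl x i ^+ 2| <= \sum_i `|Rbar i| * b i ^+ 2.
    rewrite (bigD1 i)//= normrM -[leLHS]addr0 lerD//; last by apply: sumr_ge0 => *; nneg.
    have c0 := ltW (dom_gt0 (dcl x i)).
    rewrite (ger0_norm (exprn_ge0 2 c0)) ler_wpM2l// lerXn2r ?nnegrE//.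
      by have := ab i; lra.
    by have /andP[] := clE x i.
  have := ler_norm M; rewrite /C; lra.
have fcont x (e : R) : 0 < e -> exists2 d : R, 0 < d &
    forall y, (forall i, `|y i - x i| <= d) -> forall i, `|field (cl y) i - field (cl x) i| <= e.
  move=> e0; apply: contrapT => H.
  have bad n : exists y, (forall i, `|y i - x i| <= n.+1%:R^-1) /\
      exists i, e < `|field (cl y) i - field (cl x) i|.
    apply: contrapT => H'; apply: H; exists n.+1%:R^-1; first by rewrite invr_gt0.
    move=> y hy i; rewrite leNgt; apply/negP => h; apply: H'; exists y; split=> //.
    by exists i.
  have [y hy] := choice bad.
  have yx i : y n i @[n --> \oo] --> x i.
    apply/cvgrPdist_lt => d d0; near=> n; rewrite distrC.
    apply: le_lt_trans ((hy n).1 i) _.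
    by near: n; exact: near_infty_natSinv_lt (PosNum d0).
  have cx i : cl (y n) i @[n --> \oo] --> cl x i.
    by apply: cvg_clamp; exact: cvg_sqrtf.
  have fx : forall i, i \in enum 'I_N -> \forall n \near \oo,
      `|field (cl x) i - field (cl (y n)) i| < e.
    move=> i _; have hf : field (cl (y n)) i @[n --> \oo] --> field (cl x) i by exact: cvg_field.
    by move/cvgrPdist_lt: hf => /(_ e e0).
  have : \forall n \near \oo, forall i, i \in enum 'I_N ->
      `|field (cl x) i - field (cl (y n)) i| < e.
    elim: (enum 'I_N) fx => [|j q ih] fx; first by apply: filterE.
    have h1 := ih (fun i iq => fx i (mem_behead (s := j :: q) iq)).
    have h2 := fx j (mem_head _ _).
    by apply: filterS2 h1 h2 => n g1 g2 i; rewrite inE => /predU1P[->|/g1].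
  move=> /filter_ex[n hn]; have [i] := (hy n).2.
  by rewrite distrC ltNge ltW// hn// mem_enum.
have [x [x0 hx]] := peano (fun i => s0 i ^+ 2) C0 fC fcont.
have cls0 : cl (fun i => s0 i ^+ 2) = s0.
  apply/funext => i; rewrite /cl sqrtr_sqr ger0_norm ?(ltW (p0 i))//.
  by have [h1 h2] := ab i; rewrite (min_idPr _) ?(max_idPr _)//; lra.
have [h [h0 hh]] : exists h : R, 0 < h /\ forall t, 0 <= t -> t <= h -> forall i,
    a i ^+ 2 <= x t i <= b i ^+ 2.
  have [d d0 hd] := hx 0 (lexx 0) 1 ltr01.
  have [i|i r r' h1 r0 h3 v hv|r r0 hr] := @uniform_pos R 'I_N
     (fun i r => forall v, `|v - s0 i ^+ 2| <= r -> a i ^+ 2 <= v <= b i ^+ 2).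
  - have [/andP[h1 h2] h3] := ab i.
    have g1 : a i ^+ 2 < s0 i ^+ 2 by rewrite ltr_pXn2r ?nnegrE ?ltW//; lra.
    have g2 : s0 i ^+ 2 < b i ^+ 2 by rewrite ltr_pXn2r ?nnegrE ?ltW//; lra.
    exists (Num.min (s0 i ^+ 2 - a i ^+ 2) (b i ^+ 2 - s0 i ^+ 2)).
      by rewrite lt_min !subr_gt0 g1.
    move=> v; rewrite le_min !ler_norml => /andP[/andP[? ?] /andP[? ?]].
    by apply/andP; split; lra.
  - by apply: h1; apply: le_trans hv h3.
  exists (Num.min d (r / (C + 1))); split.
    by rewrite lt_min d0 divr_gt0//; lra.
  move=> t t0; rewrite le_min ler_pdivlMr => [/andP[td tr]|]; last by lra.
  move=> i; apply: hr; have := hd t t0; rewrite subr0 ger0_norm// => /(_ td i).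
  rewrite x0 mul1r => h1; have h2 := fC (fun i => s0 i ^+ 2) i.
  have h3 : `|t * field (cl (fun i => s0 i ^+ 2)) i| <= t * C by rewrite normrM ger0_norm// ler_wpM2l.
  have := ler_normD (x t i - s0 i ^+ 2 - t * field (cl (fun i => s0 i ^+ 2)) i)
    (t * field (cl (fun i => s0 i ^+ 2)) i).
  rewrite subrK; lra.
have clx t i : 0 <= t -> t <= h -> cl (x t) i = Num.sqrt (x t i).
  move=> t0 th; have [/andP[h1 h2] h3] := ab i; have /andP[g1 g2] := hh t t0 th i.
  have {}g1 : a i <= Num.sqrt (x t i).
    by rewrite -(ger0_norm (ltW h1)) -sqrtr_sqr ler_wsqrtr.
  have b0 : 0 <= b i by lra.
  have {}g2 : Num.sqrt (x t i) <= b i.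
    by rewrite -(ger0_norm b0) -sqrtr_sqr ler_wsqrtr.
  by rewrite /cl (min_idPr _)// (max_idPr _).
have sqx t i : 0 <= t -> t <= h -> cl (x t) i ^+ 2 = x t i.
  move=> t0 th; rewrite clx// sqr_sqrtr//; have /andP[g1 _] := hh t t0 th i.
  by apply: le_trans g1; exact: sqr_ge0.
exists h, (fun t => cl (x t)); split=> //; first by rewrite x0.
move=> t t0 th e e0; have [d d0 hd] := hx t t0 e e0.
by exists d => // u u0 uh ud i; rewrite !sqx//; exact: hd.
Unshelve. all: by end_near.
Qed.

(** The derivative of s_i^2 is bounded by some C, so s_i^2 + C t is nondecreasing and bounded, and
    has a left limit at [tau]. *)
Lemma sflow_limit sigma (tau m M : R) : sflow T I bg Rbar sigma tau%:E -> 0 < m -> kap bg * M < 1 ->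
  (forall t, 0 <= t -> t < tau -> forall i, m <= sigma t i <= M) ->
  exists s, (forall i, dom bg (s i)) /\ forall i, sigma t i @[t --> tau^'-] --> s i.
Proof.
move=> [tau0 ds ps] m0 M1 hb; rewrite lte_fin in tau0.
have [K hK] := @curv_bounded R N T I bg.
have lim i : exists l : R, sigma t i @[t --> tau^'-] --> l.
  have M0 : 0 <= M by have := hb 0 (lexx 0) tau0 i; lra.
  pose C := `|Rbar i| * M ^+ 2 + K.
  have bd t : 0 <= t -> t < tau -> sigma t i ^+ 2 <= M ^+ 2.
    move=> t0 tt'; have /andP[h1 h2] := hb t t0 tt' i.
    by rewrite lerXn2r ?nnegrE//; lra.
  have C0 t : 0 <= t -> t < tau -> `|field (sigma t) i| <= C.
    move=> t0 tt'; apply: le_trans (ler_normB _ _) _; apply: lerD => //.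
    by rewrite normrM (ger0_norm (sqr_ge0 _)) ler_wpM2l// bd.
  have P : path_on tau%:E (fun t => - (sigma t i ^+ 2 + t * C)) (fun t => - (field (sigma t) i + C)).
    apply: path_opp; apply: path_add; first exact: ps.
    split=> [|t _ _].
      apply: cvgMf; last exact: cvg_cst.
      exact: cvg_at_right_filter cvg_id.
    by apply: is_derive_eq; rewrite /GRing.scale/=; ring.
  have cg : cvg (sigma t i ^+ 2 + t * C @[t --> tau^'-]).
    apply: nondecreasing_at_left_is_cvgr; near=> x.
      move=> u v; rewrite !in_itv/= => /andP[xu ut] /andP[xv vt] uv.
      have x0 : 0 <= x by near: x; exact: nbhs_left_ge.
      rewrite -lerN2; have := path_nonincreasing P (le_trans x0 (ltW xu)) uv; apply; first by rewrite lte_fin.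
      move=> w /andP[uw wv]; have w0 : 0 <= w by lra.
      have wt : w < tau by lra.
      by have := C0 w w0 wt; rewrite ler_norml; lra.
    have x0 : 0 <= x by near: x; exact: nbhs_left_ge.
    exists (M ^+ 2 + tau * `|C|) => _ [u + <-]; rewrite /= in_itv/= => /andP[xu ut].
    have u0 : 0 <= u by lra.
    have h1 := bd u u0 ut; have := ler_norm C => h2.
    have h3 : u * C <= tau * `|C|.
      by apply: le_trans (ler_wpM2l u0 h2) _; rewrite ler_wpM2r// ltW.
    by rewrite lerD.
  move/cvg_ex: cg => [l hl].
  exists (Num.sqrt (l - tau * C)).
  have : (sigma t i ^+ 2 + t * C) - t * C @[t --> tau^'-] --> l - tau * C.
    apply: cvgBf; first exact: hl.
    apply: cvgMf; last exact: cvg_cst.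
    exact: cvg_at_left_filter cvg_id.
  move=> /cvg_sqrtf; apply: cvg_trans; apply: near_eq_cvg; near=> t.
  have t0 : 0 <= t by near: t; exact: nbhs_left_ge.
  have tt' : t < tau by near: t; exact: nbhs_left_lt.
  have /andP[h1 _] := hb t t0 tt' i.
  by rewrite addrK sqrtr_sqr ger0_norm//; lra.
have [s hs] := choice lim; exists s; split=> // i.
have h1 : m <= s i.
  apply: cvgr_to_ge (hs i) _; near=> t.
  have t0 : 0 <= t by near: t; exact: nbhs_left_ge.
  have tt' : t < tau by near: t; exact: nbhs_left_lt.
  by have /andP[] := hb t t0 tt' i.
have h2 : s i <= M.
  apply: cvgr_to_le (hs i) _; near=> t.
  have t0 : 0 <= t by near: t; exact: nbhs_left_ge.
  have tt' : t < tau by near: t; exact: nbhs_left_lt.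
  by have /andP[] := hb t t0 tt' i.
rewrite /dom (lt_le_trans m0 h1)/=; apply: le_lt_trans M1.
by rewrite ler_wpM2l// kap_ge0.
Unshelve. all: by end_near.
Qed.

(** Near [tau] the derivative is within e of its limit; s_i^2 is compared on [t, u] with lines of
    the two extreme slopes, and then u tends to [tau]. *)
Let left_derivative sigma (tau : R) s i : sflow T I bg Rbar sigma tau%:E ->
  (forall i, dom bg (s i)) -> (forall i, sigma t i @[t --> tau^'-] --> s i) ->
  forall e : R, 0 < e -> exists2 d : R, 0 < d & forall t, t < tau -> tau - t <= d ->
    `|sigma t i ^+ 2 - s i ^+ 2 - (t - tau) * field s i| <= e * `|t - tau|.
Proof.
move=> [tau0 ds ps] dst sl e e0; rewrite lte_fin in tau0.
have : \forall t \near tau^'-, `|field s i - field (sigma t) i| < e.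
  have hf : field (sigma t) i @[t --> tau^'-] --> field s i by exact: cvg_field.
  by move/cvgrPdist_lt: hf => /(_ e e0).
move=> [d /= d0 hd]; exists (Num.min (d / 2) (tau / 2)).
  by rewrite lt_min !divr_gt0.
move=> t tt'; rewrite le_min => /andP[td t2].
have near u : t <= u -> u < tau -> `|field s i - field (sigma u) i| < e.
  by move=> tu ut; apply: hd => //=; rewrite gtr0_norm; lra.
have t0 : 0 <= t by lra.
have lin (c : R) : path_on tau%:E (fun t => t * c) (fun=> c).
  split=> [|u _ _].
    by apply: cvgMf; [exact: cvg_at_right_filter cvg_id|exact: cvg_cst].
  by apply: is_derive_eq; rewrite /GRing.scale/=; ring.
have up : s i ^+ 2 + tau * (- field s i - e) <= sigma t i ^+ 2 + t * (- field s i - e).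
  have L : sigma u i ^+ 2 + u * (- field s i - e) @[u --> tau^'-] --> s i ^+ 2 + tau * (- field s i - e).
    apply: cvgDf; first exact: cvgX2f.
    by apply: cvgMf; [exact: cvg_at_left_filter cvg_id|exact: cvg_cst].
  apply: cvgr_to_le L _; near=> u.
  have tu : t <= u by near: u; exact: nbhs_left_ge.
  have ut : u < tau by near: u; exact: nbhs_left_lt.
  have := path_nonincreasing (path_add (ps i) (lin (- field s i - e))) t0 tu; apply.
    by rewrite lte_fin.
  move=> w /andP[tw wu]; have := near w (ltW tw) (lt_trans wu ut).
  by rewrite ltr_norml /field; lra.
have lo : - s i ^+ 2 + tau * (field s i - e) <= - sigma t i ^+ 2 + t * (field s i - e).
  have L : - sigma u i ^+ 2 + u * (field s i - e) @[u --> tau^'-] --> - s i ^+ 2 + tau * (field s i - e).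
    apply: cvgDf; first by apply: cvgN; exact: cvgX2f.
    by apply: cvgMf; [exact: cvg_at_left_filter cvg_id|exact: cvg_cst].
  apply: cvgr_to_le L _; near=> u.
  have tu : t <= u by near: u; exact: nbhs_left_ge.
  have ut : u < tau by near: u; exact: nbhs_left_lt.
  have := path_nonincreasing (path_add (path_opp (ps i)) (lin (field s i - e))) t0 tu; apply.
    by rewrite lte_fin.
  move=> w /andP[tw wu]; have := near w (ltW tw) (lt_trans wu ut).
  by rewrite ltr_norml /field; lra.
rewrite (ltr0_norm (x := t - tau)) ?subr_lt0// ler_norml; apply/andP; split; lra.
Unshelve. all: by end_near.
Qed.

(** At [tau] both one-sided derivatives of the glued path equal the field at the limit, the left one
    by continuity of the field, the right one by [local_flow]. *)
Lemma sflow_continue sigma (tau : R) s : sflow T I bg Rbar sigma tau%:E ->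
  (forall i, dom bg (s i)) -> (forall i, sigma t i @[t --> tau^'-] --> s i) ->
  exists (h : R) (sigma' : R -> 'I_N -> R), [/\ 0 < h,
    sflow T I bg Rbar sigma' (tau + h)%:E, forall t, t < tau -> sigma' t = sigma t
  & sigma' tau = s].
Proof.
move=> fl dst sl; have [tau0 ds ps] := fl; rewrite lte_fin in tau0.
have [h [x [h0 x0 dx hx]]] := local_flow dst.
pose y t := if t < tau then sigma t else x (t - tau).
have yl t : t < tau -> y t = sigma t by rewrite /y => ->.
have yr t : tau <= t -> y t = x (t - tau) by rewrite /y leNgt => /negbTE ->.
have yt : y tau = s by rewrite yr// subrr.
exists h, y; split=> //; split=> [|t t0 tt' i|i]; first by rewrite lte_fin; lra.
  have [tl|tr] := ltP t tau; first by rewrite yl// ds.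
  by rewrite yr// dx//; rewrite lte_fin in tt'; lra.
split=> [|t t0 tt'].
  rewrite yl//; have := (ps i).1; apply: cvg_trans; apply: near_eq_cvg; near=> t.
  by rewrite yl//; near: t; exact: nbhs_right_lt.
rewrite lte_fin in tt'.
have [tl|tr] := ltP t tau.
  rewrite yl//; have := (ps i).2 t t0; rewrite lte_fin => /(_ tl).
  apply: near_eq_is_derive; near=> u; rewrite yl//; near: u; exact: lt_nbhsl.
apply: is_derive_eps => e e0.
have [d d0 hd] := hx (t - tau) ltac:(lra) ltac:(lra) e e0.
have right u : tau <= u -> u <= tau + h -> `|u - t| <= d ->
    `|y u i ^+ 2 - y t i ^+ 2 - (u - t) * field (y t) i| <= e * `|u - t|.
  move=> tu uh ut; rewrite (yr _ tr) (yr _ tu).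
  have E : u - t = (u - tau) - (t - tau) by ring.
  by rewrite E; apply: hd; rewrite -?E//; lra.
move: tr; rewrite le_eqVlt => /predU1P[E|tr].
  have [d' d'0 hd'] := left_derivative i fl dst sl e0.
  exists (Num.min h (Num.min d d')); first by rewrite !lt_min h0 d0.
  move=> u; rewrite !le_min => /andP[h1 /andP[h2 h3]].
  have [ul|ur] := ltP u tau.
    rewrite -E yl// yt; apply: hd' => //; move: h3; rewrite -E distrC => h3.
    by apply: le_trans (ler_norm _) h3.
  by apply: right => //; have := le_trans (ler_norm _) h1; lra.
exists (Num.min (t - tau) (Num.min d (tau + h - t))).
  by rewrite !lt_min d0 !subr_gt0 tr.
move=> u; rewrite !le_min => /andP[h1 /andP[h2 h3]].
have h4 := le_trans (ler_norm _) h3.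
have {}h1 : t - u <= t - tau by apply: le_trans h1; rewrite distrC ler_norm.
by apply: right => //; lra.
Unshelve. all: by end_near.
Qed.

End Extension.

(** * From scaled radii back to circle packing metrics *)

Section ScaleContinuity.
Context {R : realType}.
Variable bg : background.

Lemma cvg_scale {X} {F : set_system X} {FF : Filter F} (f : X -> R) (l : R) :
  f @ F --> l -> scale bg (f t) @[t --> F] --> scale bg l.
Proof.
move=> fl; rewrite /scale; case: bg => //.
have E : expR (f t) @[t --> F] --> expR l by apply: continuous_cvg fl; exact: continuous_expR.
rewrite tanh_half; under eq_fun do rewrite tanh_half.
apply: cvgMf; first by apply: cvgBf E _; exact: cvg_cst.
apply: cvgVf; last by apply: cvgDf E _; exact: cvg_cst.
by have := expR_gt0 l; rewrite gt_eqF//; lra.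
Qed.

Lemma cvg_unscale {X} {F : set_system X} {FF : Filter F} (f : X -> R) (l : R) :
  dom bg l -> f @ F --> l -> unscale bg (f t) @[t --> F] --> unscale bg l.
Proof.
rewrite /dom /unscale /kap; case: bg => [//|]; rewrite mul1r => /andP[l0 l1] fl.
apply: continuous_cvg; last first.
  apply: cvgMf; first by apply: cvgDf fl; exact: cvg_cst.
  apply: cvgVf; last by apply: cvgBf fl; exact: cvg_cst.
  by rewrite gt_eqF//; lra.
by apply: continuous_ln; rewrite divr_gt0//; lra.
Qed.

(** Carries the exponential rate from s over to r. The inverse hyperbolic tangent is Lipschitz only
    away from 1, hence the bound M. *)
Lemma unscale_lipschitz (M : R) : kap bg * M < 1 -> exists2 C : R, 0 < C &
  forall a b, dom bg a -> dom bg b -> a <= M -> b <= M ->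
  `|unscale bg a - unscale bg b| <= C * `|a - b|.
Proof.
rewrite /dom /unscale /kap; case: bg => [_|]; first by exists 1 => // a b *; rewrite mul1r.
rewrite !mul1r => M1; exists (2 / (1 - M)); first by rewrite divr_gt0//; lra.
have H a b : 0 < a -> 0 < b -> a <= M -> b <= M ->
    ln ((1 + a) / (1 - a)) - ln ((1 + b) / (1 - b)) <= 2 / (1 - M) * `|a - b|.
  move=> a0 b0 aM bM.
  have p1 : 0 < (1 + a) / (1 - a) by rewrite divr_gt0//; lra.
  have p2 : 0 < (1 + b) / (1 - b) by rewrite divr_gt0//; lra.
  rewrite -ln_div ?posrE//; set q := (_ / _) / (_ / _).
  have q0 : 0 < q by rewrite divr_gt0.
  have /le_ln1Dx : -1 < q - 1 by lra.
  rewrite addrC subrK => /le_trans; apply.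
  have -> : q - 1 = (2 * (a - b)) / ((1 - a) * (1 + b)).
    by rewrite /q; field; rewrite !gt_eqF//; lra.
  apply: (@le_trans _ _ ((2 * `|a - b|) / ((1 - a) * (1 + b)))).
    rewrite ler_pM2r ?invr_gt0 ?mulr_gt0 ?ler_pM2l ?ler_norm//; lra.
  have -> : 2 / (1 - M) * `|a - b| = (2 * `|a - b|) / (1 - M) by ring.
  apply: ler_wpM2l; first by rewrite mulr_ge0.
  rewrite lef_pV2 ?posrE ?mulr_gt0//; nra.
move=> a b /andP[a0 a1] /andP[b0 b1] aM bM; rewrite ler_norml; apply/andP; split; last exact: H.
by have := H b a b0 a0 bM aM; rewrite distrC; lra.
Qed.

End ScaleContinuity.

Section Link.
Context {R : realType} {N : nat}.
Variables (T : triangulation N) (I : {set 'I_N} -> R) (bg : background).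
Hypothesis I_ge0 : forall e, e \in edges T -> 0 <= I e.
Implicit Types (r : 'rV[R]_N) (i j k : 'I_N).

Definition scaled r i : R := scale bg (r 0 i).

Lemma edge_lengthC (w x y : R) : edge_length bg w x y = edge_length bg w y x.
Proof.
rewrite /edge_length; case: bg; first by congr Num.sqrt; ring.
by congr acosh; ring.
Qed.

Lemma lenC r i j : len I bg r i j = len I bg r j i.
Proof. by rewrite /len edge_lengthC finset.setUC. Qed.

Lemma ext_Kcurv_curv r i : positive_radii r -> ext_Kcurv T I bg r i = curv T I bg (scaled r) i.
Proof.
move=> r0; congr (_ - _); apply: eq_bigr => -[j k] /andP[_ f] /=.
have [h1 h2 h3] := face_I I_ge0 f.
rewrite /vang sangC -(ext_angleE bg h1 h3 h2 (r0 i) (r0 k) (r0 j)) /len.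
by rewrite (edge_lengthC _ (r 0 k)).
Qed.

Lemma Omega_triangle r i j k : Omega T I bg r -> face T i j k ->
  [/\ len I bg r j k < len I bg r i j + len I bg r i k,
      len I bg r i j < len I bg r j k + len I bg r i k
    & len I bg r i k < len I bg r j k + len I bg r i j].
Proof.
move=> [_ h] f.
have f2 : face T j k i by rewrite faceAC faceC.
have f3 : face T i k j by rewrite faceAC.
have := h _ _ _ f; have := h _ _ _ f2; have := h _ _ _ f3.
rewrite (lenC r j i) (lenC r k j).
by move: (len _ _ r j k) (len _ _ r i j) (len _ _ r i k) => x y z *; split; lra.
Qed.

Lemma Kcurv_ext r i : Omega T I bg r -> Kcurv T I bg r i = ext_Kcurv T I bg r i.
Proof.
move=> Or; congr (_ - _); apply: eq_bigr => -[j k] /andP[_ f] /=.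
have [h1 h2 h3] := Omega_triangle Or f.
by rewrite /ext_angle h1 h2 h3.
Qed.

Lemma Rcurv_ext r i : Omega T I bg r -> Rcurv T I bg r i = ext_Rcurv T I bg r i.
Proof. by move=> Or; rewrite /Rcurv Kcurv_ext. Qed.

Lemma Omega_proper_faces r : Omega T I bg r -> proper_faces T I bg (scaled r).
Proof.
move=> Or i j k f; have [h1 h2 h3] := Omega_triangle Or f.
have [c1 c2 c3] := face_I I_ge0 f; have r0 := Or.1.
rewrite addrC in h1.
exact: gram_gt0_triangle c1 c2 c3 (r0 i) (r0 j) (r0 k) h1 h3 h2.
Qed.

Lemma row_norm_le (x : 'rV[R]_N) (e : R) : 0 <= e -> (forall i, `|x 0 i| <= e) -> `|x| <= e.
Proof.
move=> e0 h; rewrite /Num.norm /= mx_normrE; apply: bigmax_le => // -[a b] _ /=.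
by rewrite (ord1 a).
Qed.

Lemma cvg_row {X} {F : set_system X} {FF : Filter F} (f : X -> 'rV[R]_N) (l : 'rV[R]_N) :
  (forall i, f t 0 i @[t --> F] --> l 0 i) -> f @ F --> l.
Proof.
move=> h; apply/cvgrPdist_le => e e0.
have : \forall t \near F, forall i, i \in enum 'I_N -> `|l 0 i - f t 0 i| <= e.
  elim: (enum 'I_N) => [|i q ih]; first by apply: filterE.
  have /cvgrPdist_le/(_ e e0) := h i; apply: filterS2 ih => t h1 h2 j.
  by rewrite inE => /predU1P[->|/h1].
apply: filterS => t ht; apply: row_norm_le; first exact: ltW.
by move=> i; rewrite !mxE; apply: ht; exact: mem_enum.
Qed.

Lemma cvg_coord {X} {F : set_system X} {FF : Filter F} (f : X -> 'rV[R]_N) (l : 'rV[R]_N) i :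
  f @ F --> l -> f t 0 i @[t --> F] --> l 0 i.
Proof.
move=> fl; exact: (@continuous_cvg _ _ _ F FF f (fun M : 'rV[R]_N => M 0 i) l (@coord_continuous _ _ _ 0 i l) fl).
Qed.

Variable Rbar : 'I_N -> R.

(** The two curvatures agree on [Omega], so that all results on the extended flow apply to the flow
    in [Omega]. *)
Lemma flow_ext (r : R -> 'rV[R]_N) tau :
  flow_solution bg (Omega T I bg) (Rcurv T I bg) Rbar r tau ->
  flow_solution bg (@positive_radii R N) (ext_Rcurv T I bg) Rbar r tau.
Proof.
move=> [tau0 dr r0 h]; split=> // [t t0 tt'|t i t0 tt']; first by have [] := dr t t0 tt'.
rewrite -Rcurv_ext; first exact: h.
by apply: dr => //; exact: ltW.
Qed.

Lemma flow_Omega (r : R -> 'rV[R]_N) tau :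
  flow_solution bg (@positive_radii R N) (ext_Rcurv T I bg) Rbar r tau ->
  (forall t, 0 <= t -> (t%:E < tau)%E -> Omega T I bg (r t)) ->
  flow_solution bg (Omega T I bg) (Rcurv T I bg) Rbar r tau.
Proof.
move=> [tau0 _ r0 h] dr; split=> // t i t0 tt'.
rewrite Rcurv_ext; first exact: h.
by apply: dr => //; exact: ltW.
Qed.

Let field_ext r i : positive_radii r -> (Rbar i - ext_Rcurv T I bg r i) * metric_coef bg (r 0 i)
  = Rbar i * scaled r i ^+ 2 - curv T I bg (scaled r) i.
Proof.
move=> r0; rewrite /ext_Rcurv ext_Kcurv_curv// /metric_coef /scaled mulrBl divfK//.
by rewrite expf_neq0// gt_eqF//; apply: (dom_gt0 (bg := bg)); exact: dom_scale.
Qed.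

Lemma flow_sflow (r : R -> 'rV[R]_N) tau :
  flow_solution bg (@positive_radii R N) (ext_Rcurv T I bg) Rbar r tau ->
  sflow T I bg Rbar (fun t => scaled (r t)) tau.
Proof.
move=> [tau0 dr r0 h]; split=> // [t t0 tt' i|i]; first by apply: dom_scale; exact: dr.
split=> [|t t0 tt'].
  by apply: cvgX2f; apply: cvg_scale; exact: cvg_coord.
by rewrite -field_ext; [exact: h|apply: dr => //; exact: ltW].
Qed.

Lemma near_time (t : R) tau : (t%:E < tau)%E -> \forall u \near t, (u%:E < tau)%E.
Proof.
case: tau => [v| |//]; last by move=> _; apply: filterE => u; rewrite ltry.
rewrite lte_fin => tv; near=> u; rewrite lte_fin; near: u; exact: lt_nbhsl.
Unshelve. all: by end_near.
Qed.

Lemma sflow_flow (s : R -> 'I_N -> R) tau : sflow T I bg Rbar s tau ->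
  flow_solution bg (@positive_radii R N) (ext_Rcurv T I bg) Rbar
    (fun t => \row_i unscale bg (s t i)) tau.
Proof.
move=> [tau0 ds ps].
have sc t : 0 <= t -> (t%:E < tau)%E -> scaled (\row_i unscale bg (s t i)) = s t.
  by move=> t0 tt'; apply/funext => i; rewrite /scaled mxE unscaleK//; exact: ds.
have pr t : 0 <= t -> (t%:E < tau)%E -> positive_radii (\row_i unscale bg (s t i)).
  by move=> t0 tt' i; rewrite mxE; apply: unscale_gt0; exact: ds.
have near0 : \forall t \near 0^'+, 0 <= t /\ (t%:E < tau)%E.
  near=> t; split; first by near: t; exact: nbhs_right_ge.
  by near: t; apply: cvg_within; exact: near_time.
split=> // [|t i t0 tt'].
  apply: cvg_row => i; rewrite mxE; under eq_fun do rewrite mxE.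
  apply: cvg_unscale; first exact: ds.
  rewrite -[X in _ --> X](ger0_norm (ltW (dom_gt0 (ds 0 (lexx 0) tau0 i)))) -sqrtr_sqr.
  have : Num.sqrt (s t i ^+ 2) @[t --> 0^'+] --> Num.sqrt (s 0 i ^+ 2).
    by apply: cvg_sqrtf; exact: (ps i).1.
  apply: cvg_trans; apply: near_eq_cvg.
  apply: filterS near0 => t [t0 tt'].
  by rewrite sqrtr_sqr ger0_norm// ltW//; exact: dom_gt0 (ds t t0 tt' i).
rewrite field_ext; last exact: pr (ltW t0) tt'.
rewrite sc ?ltW//; apply: near_eq_is_derive ((ps i).2 t t0 tt').
have : \forall u \near t, 0 < u /\ (u%:E < tau)%E.
  by near=> u; split; near: u; [exact: lt_nbhsr|exact: near_time].
apply: filterS => u [u0 ut]; rewrite /metric_coef mxE unscaleK//.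
by apply: ds => //; exact: ltW.
Unshelve. all: by end_near.
Qed.

End Link.

Section Geometry.
Context {R : realType} {N : nat}.
Variables (T : triangulation N) (I : {set 'I_N} -> R) (bg : background).
Hypothesis I_ge0 : forall e, e \in edges T -> 0 <= I e.
Implicit Types (r : 'rV[R]_N) (i j k : 'I_N).

Lemma cvg_len {X} {F : set_system X} {FF : Filter F} (f : X -> 'rV[R]_N) r i j k :
  face T i j k -> positive_radii r -> f @ F --> r -> len I bg (f t) i j @[t --> F] --> len I bg r i j.
Proof.
move=> fc r0 fr; have I0 := I_ge0 (face_edge fc); rewrite /len; move: (I _) I0 => w w0.
have fi : f t 0 i @[t --> F] --> r 0 i by exact: cvg_coord.
have fj : f t 0 j @[t --> F] --> r 0 j by exact: cvg_coord.
rewrite /edge_length; case: bg.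
  apply: cvg_sqrtf; apply: cvgDf; first by apply: cvgDf; exact: cvgX2f.
  by apply: cvgMf; [apply: cvgMf => //; apply: cvgMf => //; exact: cvg_cst|exact: cvg_cst].
have E (g : X -> R) (x : R) : g @ F --> x -> expR (g t) @[t --> F] --> expR x.
  by move=> gx; apply: continuous_cvg gx; exact: continuous_expR.
have C (g : X -> R) (x : R) : g @ F --> x -> cosh (g t) @[t --> F] --> cosh x.
  move=> gx; apply: cvgMf; last exact: cvg_cst.
  by apply: cvgDf; [exact: E|apply: E; exact: cvgN].
have S (g : X -> R) (x : R) : g @ F --> x -> sinh (g t) @[t --> F] --> sinh x.
  move=> gx; apply: cvgMf; last exact: cvg_cst.
  by apply: cvgBf; [exact: E|apply: E; exact: cvgN].
have A : cosh (f t 0 i) * cosh (f t 0 j) + w * sinh (f t 0 i) * sinh (f t 0 j) @[t --> F]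
    --> cosh (r 0 i) * cosh (r 0 j) + w * sinh (r 0 i) * sinh (r 0 j).
  apply: cvgDf; first by apply: cvgMf; exact: C.
  by apply: cvgMf; [apply: cvgMf; [exact: cvg_cst|exact: S]|exact: S].
have h1 : 1 <= cosh (r 0 i) * cosh (r 0 j) + w * sinh (r 0 i) * sinh (r 0 j).
  have c1 := cosh_ge1 (r 0 i); have c2 := cosh_ge1 (r 0 j).
  have s1 := sinh_gt0 (r0 i); have s2 := sinh_gt0 (r0 j).
  have : 0 <= w * sinh (r 0 i) * sinh (r 0 j) by nneg.
  have : 1 * 1 <= cosh (r 0 i) * cosh (r 0 j) by apply: ler_pM.
  lra.
move: (cosh _ * _ + _) h1 A => x x1 A.
rewrite /acosh; apply: continuous_cvg; last first.
  apply: cvgDf; first exact: A.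
  by apply: cvg_sqrtf; apply: cvgBf; [exact: cvgX2f|exact: cvg_cst].
apply: continuous_ln; have := sqrtr_ge0 (x ^+ 2 - 1); lra.
Qed.

Lemma near_Omega {X} {F : set_system X} {FF : Filter F} (f : X -> 'rV[R]_N) r :
  Omega T I bg r -> f @ F --> r -> \forall t \near F, Omega T I bg (f t).
Proof.
move=> Or fr; have [r0 tr] := Or.
have near1 : \forall t \near F, forall i, 0 < f t 0 i.
  apply: filter_forall => i; have fi : f t 0 i @[t --> F] --> r 0 i by exact: cvg_coord.
  by apply: cvgr_gt fi _ _; exact: r0.
have near2 : \forall t \near F, forall p : 'I_N * 'I_N * 'I_N, face T p.1.1 p.1.2 p.2 ->
    len I bg (f t) p.1.1 p.1.2 < len I bg (f t) p.1.1 p.2 + len I bg (f t) p.2 p.1.2.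
  apply: filter_forall => -[[i j] k] /=.
  have [fc|] := boolP (face T i j k); last by move=> _; apply: filterE.
  have c1 : len I bg (f t) i j @[t --> F] --> len I bg r i j by exact: cvg_len fc r0 fr.
  have fc2 : face T i k j by rewrite faceAC.
  have fc3 : face T k j i by rewrite faceC faceAC faceC.
  have c2 : len I bg (f t) i k @[t --> F] --> len I bg r i k by exact: cvg_len fc2 r0 fr.
  have c3 : len I bg (f t) k j @[t --> F] --> len I bg r k j by exact: cvg_len fc3 r0 fr.
  have L : len I bg (f t) i k + len I bg (f t) k j - len I bg (f t) i j @[t --> F]
      --> len I bg r i k + len I bg r k j - len I bg r i j by apply: cvgBf c1; exact: cvgDf.
  have : 0 < len I bg r i k + len I bg r k j - len I bg r i j by rewrite subr_gt0 tr.
  move=> L0; have : \forall t \near F, 0 < len I bg (f t) i k + len I bg (f t) k j - len I bg (f t) i j.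
    by apply: cvgr_gt L _ _.
  by apply: filterS => t; rewrite subr_gt0.
apply: filterS2 near1 near2 => t h1 h2; split=> // i j k fc.
exact: (h2 (i, j, k)).
Qed.

Lemma lenZ r (c : R) i j : bg = Euclidean -> 0 <= c -> len I bg (c *: r) i j = c * len I bg r i j.
Proof.
move=> bgE c0; rewrite /len bgE /= !mxE.
have -> : (c * r 0 i) ^+ 2 + (c * r 0 j) ^+ 2 + 2 * (c * r 0 i) * (c * r 0 j) * I [set i; j]%SET
  = c ^+ 2 * (r 0 i ^+ 2 + r 0 j ^+ 2 + 2 * r 0 i * r 0 j * I [set i; j]%SET) by ring.
by rewrite sqrtrM ?sqr_ge0// sqrtr_sqr ger0_norm.
Qed.

Lemma OmegaZ r (c : R) : bg = Euclidean -> 0 < c -> Omega T I bg r -> Omega T I bg (c *: r).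
Proof.
move=> bgE c0 [r0 tr]; split=> [i|i j k fc]; first by rewrite mxE mulr_gt0.
by rewrite !(lenZ _ _ _ bgE (ltW c0)) -mulrDr ltr_pM2l// tr.
Qed.

Lemma KcurvZ r (c : R) i : bg = Euclidean -> 0 < c -> Kcurv T I bg (c *: r) i = Kcurv T I bg r i.
Proof.
move=> bgE c0.
have E j k : len I bg (c *: r) j k = c * len I bg r j k by exact: lenZ bgE (ltW c0).
have A x y z : angle bg (c * x) (c * y) (c * z) = angle bg x y z.
  rewrite bgE /angle; congr acos.
  have -> : (c * y) ^+ 2 + (c * z) ^+ 2 - (c * x) ^+ 2 = (c ^+ 2) * (y ^+ 2 + z ^+ 2 - x ^+ 2) by ring.
  have -> : 2 * (c * y) * (c * z) = c ^+ 2 * (2 * y * z) by ring.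
  by rewrite -mulf_div divff ?mul1r// expf_neq0// gt_eqF.
exact: (congr1 (fun x => 2 * pi - x) (eq_bigr _ (fun p _ =>
  etrans (f_equal3 (angle bg) (E _ _) (E _ _) (E _ _)) (A _ _ _)))).
Qed.

Lemma exists_vertex : exists i : 'I_N, True.
Proof.
have /finset.set0Pn[f fF] := faces_neq0 T; have := card_face fF.
move=> /eqP; rewrite eqn_leq => /andP[_]; rewrite -[(2 < _)%N]/(2 < #|f|)%N => h.
have /card_gt0P[i _] : (0 < #|f|)%N by exact: leq_trans h.
by exists i.
Qed.

(** A homothety preserves [Omega] and the Euclidean angles, and the curvature equation too when Rbar
    = 0; its ratio is the one that matches the sums of squares. *)
Lemma normalize_spec (Rbar : 'I_N -> R) r0 rbar : positive_radii r0 ->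
  Omega T I bg rbar -> Rcurv T I bg rbar =1 Rbar ->
  let rb := normalize bg Rbar r0 rbar in
  [/\ Omega T I bg rb,
      forall i, curv T I bg (scaled bg rb) i = Rbar i * scaled bg rb i ^+ 2
    & normalized bg (scaled bg rb) Rbar (scaled bg r0)].
Proof.
move=> r00 Ob Rb /=.
have curvE r i : Omega T I bg r -> curv T I bg (scaled bg r) i = Kcurv T I bg r i.
  by move=> Or; rewrite Kcurv_ext// ext_Kcurv_curv//; exact: Or.1.
have KE i : Kcurv T I bg rbar i = Rbar i * scaled bg rbar i ^+ 2.
  rewrite -Rb /Rcurv divfK// expf_neq0// gt_eqF//; apply: (dom_gt0 (bg := bg)); apply: dom_scale; exact: Ob.1.
have [bgE|bgH] : bg = Euclidean \/ bg = Hyperbolic by case: bg; [left|right].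
  have -> : normalize bg Rbar r0 rbar = if [forall i, Rbar i == 0] then
        Num.sqrt ((\sum_i r0 0 i ^+ 2) / (\sum_i rbar 0 i ^+ 2)) *: rbar
      else rbar by rewrite /normalize bgE.
  case: ifPn => [/forallP Z|nZ]; last first.
    split=> // [i|_ Z]; first by rewrite curvE.
    by move: nZ; rewrite negb_forall => /existsP[i]; rewrite Z eqxx.
  have Rz i : Rbar i = 0 by apply/eqP.
  have pos r : positive_radii r -> 0 < \sum_i r 0 i ^+ 2.
    move=> rp; have [i _] := exists_vertex; rewrite (bigD1 i)//= ltr_pwDl ?exprn_gt0//.
    by apply: sumr_ge0 => *; exact: sqr_ge0.
  have p0 := pos _ r00; have p1 := pos _ Ob.1.
  set c := Num.sqrt _; have c0 : 0 < c by rewrite sqrtr_gt0 divr_gt0.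
  have Oc := OmegaZ bgE c0 Ob.
  split=> // [i|_ _]; first by rewrite curvE// KcurvZ// KE Rz !mul0r.
  rewrite /scaled bgE /= /c; under [RHS]eq_bigr do rewrite mxE exprMn.
  by rewrite -mulr_sumr sqr_sqrtr ?divfK ?gt_eqF// divr_ge0// ltW.
have -> : normalize bg Rbar r0 rbar = rbar by rewrite /normalize bgH.
by split=> // [i|bgE]; [rewrite curvE|rewrite bgE in bgH].
Qed.

End Geometry.

(** Otherwise y would eventually grow linearly. Applied to y and to -y, it makes the limit of a
    convergent flow a stationary point. *)
Lemma path_limit_derivative {R : realType} (y y' : R -> R) (l v : R) : path_on +oo%E y y' ->
  y t @[t --> +oo] --> l -> y' t @[t --> +oo] --> v -> v <= 0.
Proof.
move=> P yl yv; rewrite leNgt; apply/negP => v0.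
have n1 : \forall t \near +oo, y t < l + 1 by apply: cvgr_lt yl _ _; lra.
have n2 : \forall t \near +oo, v / 2 < y' t by apply: cvgr_gt yv _ _; lra.
have [A [_ hA]] : \forall t \near +oo, y t < l + 1 /\ v / 2 < y' t by apply: filterS2 n1 n2.
pose a := `|A| + 1; have a0 : 0 <= a by rewrite addr_ge0.
have Aa : A < a by have := ler_norm A; rewrite /a; lra.
pose b := a + 2 / v * (`|l + 1 - y a| + 1).
have c0 : 0 <= 2 / v * (`|l + 1 - y a| + 1).
  by apply: mulr_ge0; [rewrite divr_ge0// ltW|rewrite addr_ge0].
have ab : a <= b by rewrite lerDl.
have L : path_on +oo%E (fun t : R => t * (v / 2)) (fun=> v / 2).
  split=> [|t _ _].
    by apply: cvgMf; [exact: cvg_at_right_filter cvg_id|exact: cvg_cst].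
  by apply: is_derive_eq; rewrite /GRing.scale/=; ring.
have h : - y b + b * (v / 2) <= - y a + a * (v / 2).
  have := path_nonincreasing (path_add (path_opp P) L) a0 ab (ltry _); apply.
  by move=> t /andP[at' _]; have [_] := hA t (lt_trans Aa at'); lra.
have [yb _] := hA b (lt_le_trans Aa ab).
have E : b * (v / 2) = a * (v / 2) + (`|l + 1 - y a| + 1) by rewrite /b; field; rewrite gt_eqF.
by have := ler_norm (l + 1 - y a); rewrite E in h; lra.
Qed.

Lemma exp_decay_lt {R : realType} (C c e t : R) : 0 < C -> 0 < c -> 0 < e ->
  C / (c * e) <= t -> C * expR (- c * t) < e.
Proof.
move=> C0 c0 e0; rewrite ler_pdivrMr ?mulr_gt0// => h.
have E : expR (- c * t) = (expR (c * t))^-1 by rewrite mulNr expRN.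
rewrite E ltr_pdivrMr ?expR_gt0//; apply: le_lt_trans h _.
have := expR_ge1Dx (c * t); move: (expR _) => x hx.
have : e * (1 + c * t) <= e * x by rewrite ler_wpM2l// ltW.
lra.
Qed.

(** * Limits, bounds and continuation of the flows *)

Section Flows.
Context {R : realType} {N : nat}.
Variables (T : triangulation N) (I : {set 'I_N} -> R) (bg : background).
Hypothesis I_ge0 : forall e, e \in edges T -> 0 <= I e.
Variables (Rbar : 'I_N -> R).
Implicit Types (r : R -> 'rV[R]_N) (i j k : 'I_N) (tau : \bar R).

Let flow := flow_solution bg (@positive_radii R N) (ext_Rcurv T I bg) Rbar.

Lemma flow_restrict r tau tau' : flow r tau -> (0 < tau')%E -> (tau' <= tau)%E -> flow r tau'.
Proof.
move=> [t0 dr r0 h] t'0 tt'; split=> // [t tp th|t i tp th].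
  by apply: dr => //; exact: lt_le_trans tt'.
by apply: h => //; exact: lt_le_trans tt'.
Qed.

Lemma cvg_scaled {X} {F : set_system X} {FF : Filter F} (f : X -> 'rV[R]_N) (l : 'rV[R]_N) :
  positive_radii l -> (forall i, scaled bg (f t) i @[t --> F] --> scaled bg l i) ->
  (\forall t \near F, positive_radii (f t)) -> f @ F --> l.
Proof.
move=> l0 fl nf; apply: cvg_row => i; rewrite -[X in _ --> X](scaleK bg (l0 i)).
have : unscale bg (scaled bg (f t) i) @[t --> F] --> unscale bg (scaled bg l i).
  by apply: cvg_unscale (fl i); exact: dom_scale.
apply: cvg_trans; apply: near_eq_cvg; apply: filterS nf => t ft.
by rewrite /scaled scaleK.
Qed.

Lemma flow_cvg r tau t : flow r tau -> 0 < t -> (t%:E < tau)%E -> r u @[u --> t] --> r t.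
Proof.
move=> fl t0 tt'; have [tau0 ds ps] := flow_sflow I_ge0 fl; have [_ dr _ _] := fl.
have nr : \forall u \near t, positive_radii (r u).
  near=> u; apply: dr; near: u; [|exact: near_time].
  by apply: filterS (lt_nbhsr t0) => u; exact: ltW.
apply: cvg_scaled => // [|i]; first by apply: dr => //; exact: ltW.
have s0 x : positive_radii (r x) -> Num.sqrt (scaled bg (r x) i ^+ 2) = scaled bg (r x) i.
  by move=> px; rewrite sqrtr_sqr ger0_norm// ltW//; apply: (dom_gt0 (bg := bg)); exact: dom_scale.
have h : Num.sqrt (scaled bg (r u) i ^+ 2) @[u --> t] --> Num.sqrt (scaled bg (r t) i ^+ 2).
  by apply: cvg_sqrtf; exact: path_cvg (ps i) t0 tt'.
rewrite s0 in h; last by apply: dr => //; exact: ltW.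
by apply: cvg_trans h; apply: near_eq_cvg; apply: filterS nr => u /s0.
Unshelve. all: by end_near.
Qed.

Lemma flow_limit_curvature r (rbar : 'rV[R]_N) : flow r +oo%E -> Omega T I bg rbar ->
  r t @[t --> +oo] --> rbar -> Rcurv T I bg rbar =1 Rbar.
Proof.
move=> fl Ob rl i; have [tau0 ds ps] := flow_sflow I_ge0 fl.
have b0 := Ob.1; have db j : dom bg (scaled bg rbar j) by exact: dom_scale.
have sl j : scaled bg (r t) j @[t --> +oo] --> scaled bg rbar j.
  by apply: cvg_scale; exact: cvg_coord.
have gl : scaled bg (r t) i ^+ 2 @[t --> +oo] --> scaled bg rbar i ^+ 2 by exact: cvgX2f.
have dl : Rbar i * scaled bg (r t) i ^+ 2 - curv T I bg (scaled bg (r t)) i @[t --> +oo]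
    --> Rbar i * scaled bg rbar i ^+ 2 - curv T I bg (scaled bg rbar) i.
  by apply: cvgBf; [apply: cvgMf => //; exact: cvg_cst|exact: cvg_curv].
have h1 : Rbar i * scaled bg rbar i ^+ 2 - curv T I bg (scaled bg rbar) i <= 0 :=
  path_limit_derivative (ps i) gl dl.
have h2 : - (Rbar i * scaled bg rbar i ^+ 2 - curv T I bg (scaled bg rbar) i) <= 0 :=
  path_limit_derivative (path_opp (ps i)) (cvgN gl) (cvgN dl).
rewrite /Rcurv Kcurv_ext// ext_Kcurv_curv//.
have -> : curv T I bg (scaled bg rbar) i = Rbar i * scaled bg rbar i ^+ 2.
  by apply/eqP; rewrite eq_le; move: h1 h2; rewrite oppr_le0 subr_le0 subr_ge0 => -> ->.
by rewrite mulfK// expf_neq0// gt_eqF//; exact: dom_gt0 (db i).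
Qed.

Variable rbar : 'rV[R]_N.
Hypotheses (Rbar_le0 : forall i, Rbar i <= 0) (Ob : Omega T I bg rbar)
  (Rb : Rcurv T I bg rbar =1 Rbar).
Variables (r : R -> 'rV[R]_N) (tau : \bar R).
Hypothesis fl : flow r tau.

Let rb := normalize bg Rbar (r 0) rbar.

Let r00 : positive_radii (r 0).
Proof. by have [tau0 dr _ _] := fl; exact: dr. Qed.

Let Orb : Omega T I bg rb.
Proof. by have [] := normalize_spec I_ge0 r00 Ob Rb. Qed.

Let drb i : dom bg (scaled bg rb i). Proof. by apply: dom_scale; exact: Orb.1. Qed.

Let crb i : curv T I bg (scaled bg rb) i = Rbar i * scaled bg rb i ^+ 2.
Proof. by have [_ h _] := normalize_spec I_ge0 r00 Ob Rb; exact: h. Qed.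

Let prb : proper_faces T I bg (scaled bg rb). Proof. exact: Omega_proper_faces. Qed.

Lemma flow_bounds : exists m M : R, [/\ 0 < m, kap bg * M < 1 &
  forall t, 0 <= t -> (t%:E < tau)%E -> forall i, m <= scaled bg (r t) i <= M].
Proof.
have sfl := flow_sflow I_ge0 fl.
have [M M1 hM] := sflow_le I_ge0 drb prb Rbar_le0 crb sfl.
have [m m0 hm] := sflow_ge I_ge0 drb prb Rbar_le0 crb sfl.
by exists m, M; split=> // t t0 tt' i; rewrite hm ?hM.
Qed.

Lemma flow_no_essential_singularity : ~ essential_singularity r tau.
Proof.
move=> [i [t_ [[ht _] rt]]]; have [m [M [m0 _ hb]]] := flow_bounds.
have L : scale bg (r (t_ n) 0 i) @[n --> \oo] --> scale bg (0 : R) by exact: cvg_scale.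
have : m <= scale bg (0 : R).
  apply: cvgr_to_ge L _; apply: nearW => n; have [t0 tt'] := ht n.
  by have /andP[] := hb _ t0 tt' i.
rewrite /scale; case: bg; first by lra.
by rewrite tanh_half expR0 subrr mul0r; lra.
Qed.

Lemma flow_converges_exponentially : tau = +oo%E -> converges_exponentially r rb.
Proof.
move=> tauE; have sfl := flow_sflow I_ge0 fl.
have [_ _ nrb] := normalize_spec I_ge0 r00 Ob Rb.
have [C [c [C0 c0 hC]]] := sflow_exponential I_ge0 drb prb Rbar_le0 crb sfl nrb.
have [m [M [m0 M1 hb]]] := flow_bounds.
have lt_tau (t : R) : (t%:E < tau)%E by rewrite tauE ltry.
have [D D0 hD] := unscale_lipschitz M1.
(* M bounds the flow; the bound passes to the limit [rb], to which [hD] is also applied. *)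
have bM i : scaled bg rb i <= M.
  apply/ler_addgt0Pr => e e0; have t0 : 0 <= C / (c * e) by rewrite divr_ge0 ?mulr_ge0// ltW.
  have := le_lt_trans (hC _ t0 (lt_tau _) i) (exp_decay_lt C0 c0 e0 (lexx _)).
  by have /andP[_ h] := hb _ t0 (lt_tau _) i; rewrite ltr_norml; lra.
exists (D * C), c; split=> // [|t t0]; first exact: mulr_gt0.
apply: row_norm_le => [|i]; first by rewrite mulr_ge0 ?expR_ge0// ltW// mulr_gt0.
have [_ dr _ _] := fl; have rt := dr t t0 (lt_tau t) i.
rewrite !mxE -(scaleK bg rt) -(scaleK bg (Orb.1 i)).
have /andP[_ h] := hb t t0 (lt_tau t) i.
apply: le_trans (hD _ _ (dom_scale _ rt) (drb i) h (bM i)) _.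
by rewrite -mulrA ler_pM2l//; exact: hC.
Qed.

Lemma flow_extends (t1 : R) : tau = t1%:E -> exists rs h r', [/\ positive_radii rs,
  r t @[t --> t1^'-] --> rs, 0 < h, flow r' (t1 + h)%:E
  & (forall t, 0 <= t -> t < t1 -> r' t = r t) /\ r' t1 = rs].
Proof.
move=> tauE; have [m [M [m0 M1 hb]]] := flow_bounds.
have [tau0 dr _ _] := fl; rewrite tauE lte_fin in tau0.
have sfl := flow_sflow I_ge0 fl; rewrite tauE in sfl.
have hb' t : 0 <= t -> t < t1 -> forall i, m <= scaled bg (r t) i <= M.
  by move=> t0 tt' i; apply: hb => //; rewrite tauE lte_fin.
have [s [ds sl]] := sflow_limit sfl m0 M1 hb'.
have [h [s' [h0 sfl' s's s't]]] := sflow_continue I_ge0 sfl ds sl.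
exists (\row_i unscale bg (s i)), h, (fun t => \row_i unscale bg (s' t i)).
have sE : scaled bg (\row_i unscale bg (s i)) = s.
  by apply/funext => i; rewrite /scaled mxE unscaleK.
have ps : positive_radii (\row_i unscale bg (s i)) by move=> i; rewrite mxE; exact: unscale_gt0.
split=> //; [|exact: sflow_flow|].
  apply: cvg_scaled => //; first by move=> i; rewrite sE.
  near=> t; apply: dr; first by near: t; exact: nbhs_left_ge.
  by rewrite tauE lte_fin; near: t; exact: nbhs_left_lt.
split=> [t t0 tt'|]; last by rewrite s't.
apply/rowP => i; rewrite mxE s's// /scaled scaleK//; apply: dr => //.
by rewrite tauE lte_fin.
Unshelve. all: by end_near.
Qed.

End Flows.

(** * Removable singularities *)

Section Singularities.
Context {R : realType} {N : nat}.
Variables (T : triangulation N) (I : {set 'I_N} -> R) (bg : background).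
Hypothesis I_ge0 : forall e, e \in edges T -> 0 <= I e.
Variables (Rbar : 'I_N -> R).
Implicit Types (r : R -> 'rV[R]_N) (rs : 'rV[R]_N) (i j k : 'I_N) (tau : \bar R).

Let cvg_defect {X} {F : set_system X} {FF : Filter F} (f : X -> 'rV[R]_N) rs i j k :
  face T i j k -> positive_radii rs -> f @ F --> rs ->
  len I bg (f t) i k + len I bg (f t) k j - len I bg (f t) i j @[t --> F]
    --> len I bg rs i k + len I bg rs k j - len I bg rs i j.
Proof.
move=> fc r0 fr.
have fc2 : face T i k j by rewrite faceAC.
have fc3 : face T k j i by rewrite faceC faceAC faceC.
have c1 : len I bg (f t) i j @[t --> F] --> len I bg rs i j by exact: cvg_len fc r0 fr.
have c2 : len I bg (f t) i k @[t --> F] --> len I bg rs i k by exact: cvg_len fc2 r0 fr.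
have c3 : len I bg (f t) k j @[t --> F] --> len I bg rs k j by exact: cvg_len fc3 r0 fr.
by apply: cvgBf c1; apply: cvgDf c2 c3.
Qed.

Lemma no_removable_singularity_at_infinity r rs : Omega T I bg rs ->
  converges_exponentially r rs -> ~ removable_singularity T I bg r +oo%E.
Proof.
move=> Or [C [c [C0 c0 hC]]] [t_ [[ht tl] _ [i [j [k [fc L]]]]]].
have {}tl : t_ n @[n --> \oo] --> +oo by apply/cvgeryP.
have rl : r (t_ n) @[n --> \oo] --> rs.
  apply/cvgrPdist_lt => e e0; near=> n; rewrite distrC.
  apply: le_lt_trans (hC _ (ht n).1) (exp_decay_lt C0 c0 e0 _).
  by near: n; move/cvgryPge: tl; apply.
have D : len I bg (r (t_ n)) i k + len I bg (r (t_ n)) k j - len I bg (r (t_ n)) i j @[n --> \oo]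
    --> len I bg rs i k + len I bg rs k j - len I bg rs i j.
  by apply: (cvg_defect fc Or.1).
have := Or.2 i j k fc; rewrite -subr_gt0.
by rewrite (cvg_unique _ D L) ?ltxx//; exact: norm_hausdorff.
Unshelve. all: by end_near.
Qed.

(** A triangle inequality that fails at the limit held before [t1], so its defect tends to a number
    both nonpositive and nonnegative. The compact set is the box of radii within a factor 2 of the
    limit. *)
Lemma removable_singularity_of_limit r (t1 : R) rs : 0 < t1 ->
  (forall t, 0 <= t -> t < t1 -> Omega T I bg (r t)) -> positive_radii rs ->
  r t @[t --> t1^'-] --> rs -> ~ Omega T I bg rs -> removable_singularity T I bg r t1%:E.
Proof.
move=> t10 Or rs0 rl nO => //.
have [i [j [k [fc deg]]]] : exists i j k, face T i j k /\
    len I bg rs i k + len I bg rs k j - len I bg rs i j <= 0.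
  apply: contrapT => H; apply: nO; split=> // i j k fc.
  rewrite ltNge; apply/negP => h; apply: H; exists i, j, k; split=> //.
  by rewrite subr_le0.
have : \forall t \near t1^'-, forall i, rs 0 i / 2 <= r t 0 i <= 2 * rs 0 i.
  apply: filter_forall => l.
  have cl : r t 0 l @[t --> t1^'-] --> rs 0 l by exact: cvg_coord.
  have p := rs0 l.
  have n1 : \forall t \near t1^'-, rs 0 l / 2 < r t 0 l by apply: cvgr_gt cl _ _; lra.
  have n2 : \forall t \near t1^'-, r t 0 l < 2 * rs 0 l by apply: cvgr_lt cl _ _; lra.
  by apply: filterS2 n1 n2 => t h1 h2; rewrite !ltW.
move=> [d /= d0 hd].
pose q := Num.min d t1; have q0 : 0 < q by rewrite lt_min d0.
have qd : q <= d by rewrite ge_min lexx.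
have qt : q <= t1 by rewrite ge_min lexx orbT.
(* With n + 2 the shift is less than q already for n = 0, so all times are nonnegative and closer
   than d to [t1]. *)
pose t_ n : R := t1 - q * n.+2%:R^-1.
have tb n : 0 < q * n.+2%:R^-1 < q.
  rewrite mulr_gt0 ?invr_gt0//= -[ltRHS]mulr1 ltr_pM2l// invf_lt1//.
  by rewrite ltr1n.
have t0 n : 0 <= t_ n by have := tb n; rewrite /t_; move: (q * _) => x; lra.
have tlt n : t_ n < t1 by have := tb n; rewrite /t_; move: (q * _) => x; lra.
have tl : t_ n @[n --> \oo] --> t1.
  apply/cvgrPdist_lt => e e0; near=> n.
  rewrite /t_ opprB addrC subrK ger0_norm; last by have /andP[/ltW] := tb n.
  rewrite mulrC -ltr_pdivlMr//.
  apply: (@lt_trans _ _ n.+1%:R^-1).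
    by rewrite ltf_pV2 ?posrE// ltr_nat.
  near: n; have eq0 : 0 < e / q by rewrite divr_gt0.
  exact: near_infty_natSinv_lt (PosNum eq0).
have rtl : r (t_ n) @[n --> \oo] --> rs.
  have tleft : t_ n @[n --> \oo] --> t1^'-.
    move=> A hA; have h : \forall n \near \oo, t_ n < t1 -> A (t_ n) := tl _ hA.
    have : \forall n \near \oo, A (t_ n) by apply: filterS h => n /(_ (tlt n)).
    by [].
  exact: cvg_comp tleft rl.
exists t_; split.
- split; first by move=> n; split=> //; rewrite lte_fin.
  by apply: cvg_EFin; [exact: nearW|exact: tl].
- exists [set v : 'rV[R]_N | forall l, `[rs 0 l / 2, 2 * rs 0 l]%classic (v ord0 l)].
    split.
      by apply: (@rV_compact R N (fun l => `[rs 0 l / 2, 2 * rs 0 l]%classic)) => l; exact: segment_compact.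
    move=> v /= hv l; have := hv l; rewrite /= in_itv/= => /andP[h _].
    by have := rs0 l; lra.
  move=> n l /=; rewrite in_itv/=; apply: hd => //=.
  by have /andP[h1 h2] := tb n; rewrite /t_ opprB addrC subrK gtr0_norm//; exact: lt_le_trans qd.
exists i, j, k; split=> //.
have D : len I bg (r (t_ n)) i k + len I bg (r (t_ n)) k j - len I bg (r (t_ n)) i j @[n --> \oo]
    --> len I bg rs i k + len I bg rs k j - len I bg rs i j by apply: (cvg_defect fc rs0).
suff E : len I bg rs i k + len I bg rs k j - len I bg rs i j = 0 by rewrite E in D.
apply/eqP; rewrite eq_le deg /=; apply: cvgr_to_ge D _; apply: nearW => n.
by rewrite subr_ge0 ltW// (Or _ (t0 n) (tlt n)).2.
Unshelve. all: by end_near.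
Qed.

End Singularities.

Theorem theorem1p4 (R : realType) (N : nat) (T : triangulation N)
    (I : {set 'I_N} -> R) (bg : background) (Rbar : 'I_N -> R)
    (I_ge0 : forall e, e \in edges T -> 0 <= I e) :
  [/\ forall (r : R -> 'rV[R]_N) (rbar : 'rV[R]_N),
        flow_solution bg (Omega T I bg) (Rcurv T I bg) Rbar r +oo%E ->
        Omega T I bg rbar -> r t @[t --> +oo] --> rbar ->
        admissible T I bg Rbar /\ Rcurv T I bg rbar =1 Rbar,
      forall rbar : 'rV[R]_N,
        (forall i, Rbar i <= 0) ->
        Omega T I bg rbar -> Rcurv T I bg rbar =1 Rbar ->
        (forall (r : R -> 'rV[R]_N) (tau : \bar R),
           flow_solution bg (Omega T I bg) (Rcurv T I bg) Rbar r tau ->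
           ~ essential_singularity r tau) /\
        (forall (r : R -> 'rV[R]_N) (tau : \bar R),
           maximal_solution bg (Omega T I bg) (Rcurv T I bg) Rbar r tau ->
           ((tau < +oo)%E -> ~ removable_singularity T I bg r tau) ->
           [/\ tau = +oo%E,
               converges_exponentially r (normalize bg Rbar (r 0) rbar)
             & ~ removable_singularity T I bg r +oo%E])
    & forall rbar : 'rV[R]_N,
        (forall i, Rbar i <= 0) ->
        Omega T I bg rbar -> Rcurv T I bg rbar =1 Rbar ->
        forall (r : R -> 'rV[R]_N) (tau : \bar R),
          maximal_solution bg (@positive_radii R N) (ext_Rcurv T I bg) Rbar r tau ->
          tau = +oo%E /\
          converges_exponentially r (normalize bg Rbar (r 0) rbar)].
Proof.
split=> [r rbar fl Ob rl|rbar R0 Ob Rb|rbar R0 Ob Rb r tau [fl mx]].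
- have E := flow_limit_curvature I_ge0 (flow_ext fl) Ob rl.
  by split=> //; exists rbar.
- split=> [r tau fl|r tau [fl mx] nrs].
    exact: (flow_no_essential_singularity I_ge0 R0 Ob Rb (flow_ext fl)).
  have fle := flow_ext fl; have [tau0 dr _ _] := fl.
  have tauE : tau = +oo%E.
    case: tau fl mx nrs fle tau0 dr => [t1| |//] fl mx nrs fle t10 dr; last by [].
    rewrite lte_fin in t10.
    have [rs [h [r' [rs0 rl h0 fl' [r'r r't]]]]] := flow_extends I_ge0 R0 Ob Rb fle erefl.
    have [Ors|nO] := pselect (Omega T I bg rs); last first.
      case: (nrs (ltry _)); apply: removable_singularity_of_limit rs0 rl nO => //.
    have c' : r' u @[u --> t1] --> r' t1.
      by apply: (flow_cvg I_ge0 fl' t10); rewrite lte_fin ltrDl.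
    rewrite r't in c'.
    have [d /= d0 hd] := near_Omega I_ge0 Ors c'.
    (* [Omega] is open and r' continuous at t1, so for a short time after t1 the extended solution
       stays in [Omega] and solves the original flow, against maximality. *)
    pose q := Num.min h d; have q0 : 0 < q by rewrite lt_min h0.
    have qh : q <= h by rewrite ge_min lexx.
    have qd : q <= d by rewrite ge_min lexx orbT.
    have flq : flow_solution bg (Omega T I bg) (Rcurv T I bg) Rbar r' (t1 + q)%:E.
      apply: flow_Omega; first by apply: flow_restrict fl' _ _; rewrite ?lte_fin ?lee_fin; lra.
      move=> t t0; rewrite lte_fin => tq; have [tl|tr] := ltP t t1.
        by rewrite r'r//; apply: dr; rewrite ?lte_fin.
      by apply: hd; rewrite /= ler0_norm; lra.
    have le1 : (t1%:E <= (t1 + q)%:E)%E by rewrite lee_fin; lra.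
    have : (t1 + q)%:E = t1%:E.
      by apply: mx flq le1 _ => t t0; rewrite lte_fin; exact: r'r.
    by move=> [E]; exfalso; clear -E q0; lra.
  have [Orb _ _] := normalize_spec I_ge0 (dr 0 (lexx 0) tau0).1 Ob Rb.
  have ce := flow_converges_exponentially I_ge0 R0 Ob Rb fle tauE.
  by split=> //; exact: no_removable_singularity_at_infinity ce.
have tauE : tau = +oo%E.
  have [tau0 _ _ _] := fl; case: tau fl mx tau0 => [t1| |//] fl mx t10; last by [].
  have [rs [h [r' [_ _ h0 fl' [r'r _]]]]] := flow_extends I_ge0 R0 Ob Rb fl erefl.
  have le1 : (t1%:E <= (t1 + h)%:E)%E by rewrite lee_fin; lra.
  have : (t1 + h)%:E = t1%:E.
    by apply: mx fl' le1 _ => t t0; rewrite lte_fin; exact: r'r.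
  by move=> [E]; exfalso; clear -E h0; lra.
by split=> //; exact: (flow_converges_exponentially I_ge0 R0 Ob Rb fl tauE).
Qed.
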